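(* Let $n\ge1$ and let $\alpha\in(0,n+2)$, $\lambda$, $\sigma$ be constants with $0<\lambda<\frac{n+2-\alpha}{n}$ and $0\le\sigma\le\frac{n+2}{n}$. Suppose $u$ is a nonnegative function with $u\in C^{2,1}(\mathbb{R}^n\times(0,16))\cap L^\lambda(\mathbb{R}^n\times(0,16))$ satisfying $$0\le u_t-\Delta u\le \Big(\iint_{\mathbb{R}^n\times(0,16)}\Phi(x-y,t-s)^{\alpha/n}u(y,s)^\lambda\,dy\,ds\Big)\,u(x,t)^\sigma\quad\text{in }B_4(0)\times(0,16).$$ Then $\max_{|x|\le1}u(x,t)=O(t^{-n/2})$ as $t\to0^+$.
   Context: $\Phi$ is the heat kernel: $\Phi(x,t)=(4\pi t)^{-n/2}e^{-|x|^2/(4t)}$ for $t>0$ and $\Phi(x,t)=0$ for $t\le0$. $B_r(0)$ is the open ball of radius $r$ centered at the origin of $\mathbb{R}^n$. *)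

(* Defs.v *)
From HB Require Import structures.
From mathcomp Require Import all_boot all_order all_algebra.
From mathcomp Require Import all_classical all_reals all_analysis.
Set Implicit Arguments. Unset Strict Implicit. Unset Printing Implicit Defensive.
Import Order.TTheory GRing.Theory Num.Theory.
Import numFieldNormedType.Exports.
Local Open Scope classical_set_scope.
Local Open Scope ring_scope.

Section defs.
Variable R : realType.

Definition sqnorm n (x : 'rV[R]_n) : R := \sum_(i < n) (x ord0 i) ^+ 2.

Definition unitv n (i : 'I_n) : 'rV[R]_n := delta_mx ord0 i.

Definition heat_kernel n (x : 'rV[R]_n) (t : R) : R :=
  if 0 < t then powR (4 * pi * t) (- (n%:R / 2)) * expR (- (sqnorm x / (4 * t)))
  else 0.

Definition pdx n (i : 'I_n) (u : 'rV[R]_n -> R -> R) (x : 'rV[R]_n) (t : R) : R :=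
  derive (fun y => u y t) x (unitv i).
Definition pdt n (u : 'rV[R]_n -> R -> R) (x : 'rV[R]_n) (t : R) : R :=
  derive (fun s => u x s) t 1.
Definition laplacian n (u : 'rV[R]_n -> R -> R) (x : 'rV[R]_n) (t : R) : R :=
  \sum_(i < n) pdx i (pdx i u) x t.

Definition jcont n (f : 'rV[R]_n -> R -> R) (x : 'rV[R]_n) (t : R) : Prop :=
  {for (x, t), continuous (fun p : 'rV[R]_n * R => f p.1 p.2)}.

Definition C21 n (T : R) (u : 'rV[R]_n -> R -> R) : Prop :=
  forall x t, 0 < t < T ->
    [/\ derivable (fun s => u x s) t 1,
        forall i, derivable (fun y => u y t) x (unitv i),
        forall i j, derivable (fun y => pdx j u y t) x (unitv i),
        jcont u x t /\ jcont (@pdt n u) x t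
      & forall i, jcont (pdx i u) x t /\
                  forall j, jcont (pdx i (pdx j u)) x t].

(* Lebesgue integral over R^n of a function with values in \bar R,
   as the iterated one-dimensional Lebesgue integral (Tonelli). *)
Fixpoint intRn (n : nat) : ('rV[R]_n -> \bar R) -> \bar R :=
  match n return ('rV[R]_n -> \bar R) -> \bar R with
  | 0 => fun f => f 0
  | k.+1 => fun f =>
      (\int[@lebesgue_measure R]_(a in setT)
         intRn (fun y : 'rV[R]_k => f (row_mx (a%:M : 'M[R]_1) y)))%E
  end.

Definition int_strip n (T : R) (F : 'rV[R]_n -> R -> \bar R) : \bar R :=
  (\int[@lebesgue_measure R]_(s in [set s : R | (0 < s < T)%R]) intRn (fun y => F y s))%E.

End defs.

(* Main.v *)
(** Testing the equation against (b - q)_+^3 tau^(-m) exp(-q/(4 tau)), where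
    q = |y - x|^2 and tau = T - s, gives three facts about the nonnegative
    supersolution u: with m large, monotonicity of a weighted mass, hence
    bounds on int u(s) and on iint f near t = 0 for f = u_t - Delta u, the
    second one tending to 0; with m = n/2 and T > s1, a bound for the mass of
    u(s1) in small balls; with m = n/2 and T -> s1, a local Duhamel
    inequality for u(x, t).

    These bound the potential Phi^(alpha/n) * u^lambda near the origin: away
    from the diagonal the kernel is bounded; near it, for lambda < 1 use
    Young's inequality, and for lambda >= 1 insert the Duhamel inequality
    into u^lambda and integrate by Tonelli.  Hence f <= K u^sigma with
    sigma <= (n + 2)/n, which is scale invariant at worst.

    If t^(n/2) u were unbounded, maximising u d^n (d the parabolic distance to
    the boundary of a cylinder) would give points where u = r^(-n), r is small
    against the square root of t, and u <= (2/r)^n on a parabolic cylinder of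
    size r.  In the Duhamel inequality at scale r the source contributes
    O(theta) r^(-n) over a time theta r^2, and the initial slice contributes
    theta^(-n/2) r^(-n) times the mass of u in a ball of radius r, which tends
    to 0: a contradiction. *)

Require Import Defs.
From HB Require Import structures.
From mathcomp Require Import all_boot all_order all_algebra.
From mathcomp Require Import all_classical all_reals all_analysis.
From mathcomp Require Import measurable_realfun ring lra.
Import Order.TTheory GRing.Theory Num.Theory.
Import numFieldNormedType.Exports.
Local Open Scope classical_set_scope.
Local Open Scope ring_scope.
Set Implicit Arguments. Unset Strict Implicit. Unset Printing Implicit Defensive.

(** Test functions must have compact support, since the inequalities for [u_t - Delta u] hold only
    in a ball and nothing bounds [u] pointwise at infinity. The cube is the lowest power of the
    truncation that is C^2. For [m = n/2] the kernel solves the backward heat equation, so the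
    truncation leaves only two positive terms, absorbed by a slightly wider kernel, and a negative
    one, dropped in upper bounds. Monotonicity needs the sign of the whole remainder, which an
    excess of [m] over [n/2] provides. The condition on [lambda] enters as
    [alpha/2 + n (lambda - 1)/2 < 1], the integrability of a beta kernel in time: [tau^(-alpha/2)]
    bounds the kernel of the potential, and [n (lambda - 1)/2] is the time exponent of the integral
    of the heat kernel to the power [lambda]. The final constants are chosen in the order [theta],
    [B], [delta]. A small [theta] makes the source term a fraction of the lower bound at the pole;
    [B], the ratio of the parabolic distance to [r], then beats the loss [theta^(-n/2)] on the
    initial slice; [delta] finally makes the mass created by the source small. *)

Definition rv_display : measure_display -> measure_display.
Proof. exact. Qed.

(** * Measurable structure on row vectors *)

Section measurable_rv.
Context {R : realType}.
Variable n : nat.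

Let coors : 'I_n -> 'rV[R]_n -> measurableTypeR R := fun i x => x ord0 i.

Let rv_set0 : g_sigma_preimage coors set0.
Proof. exact: sigma_algebra0. Qed.

Let rv_setC A : g_sigma_preimage coors A -> g_sigma_preimage coors (~` A).
Proof. exact: sigma_algebraC. Qed.

Let rv_bigcup (F : _^nat) : (forall i, g_sigma_preimage coors (F i)) ->
  g_sigma_preimage coors (\bigcup_i (F i)).
Proof. exact: sigma_algebra_bigcup. Qed.

(** Generated by the coordinates rather than by the open sets: a map into row vectors is then
    measurable as soon as its coordinates are, and continuous functions are recovered in
    [measurable_jcont]. *)
HB.instance Definition _ := @isMeasurable.Build (rv_display default_measure_display)
  'rV[R]_n (g_sigma_preimage coors) rv_set0 rv_setC rv_bigcup.

Lemma measurable_coord i : measurable_fun [set: 'rV[R]_n] (fun x => x ord0 i : R).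
Proof.
move=> _ Y mY; rewrite setTI; apply: sub_sigma_algebra => /=.
rewrite -bigcup_seq/=; exists i => /=; first by rewrite mem_index_enum.
by exists Y => //; rewrite setTI.
Qed.

End measurable_rv.

Lemma measurable_fun_rvP {R : realType} d (T : measurableType d) n (f : T -> 'rV[R]_n) :
  (forall i, measurable_fun [set: T] (fun x => f x ord0 i : R)) ->
  measurable_fun [set: T] f.
Proof.
move=> mf _ A mA; rewrite setTI.
pose G := [set B : set 'rV[R]_n | measurable (f @^-1` B)].
suff : G A by [].
apply: (smallest_sub _ _ mA).
  split => [|B GB|F GF]; rewrite /G/=.
  - by rewrite preimage_set0.
  - by rewrite setTD -preimage_setC; exact: measurableC.
  - by rewrite preimage_bigcup; apply: bigcup_measurable => k _; exact: GF.
move=> B; rewrite -bigcup_seq => -[i _ [C mC <-]].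
by rewrite /G/= setTI -(setTI (_ @^-1` _)); exact: mf.
Qed.

(** * Lebesgue measure on row vectors, by recursion on the dimension *)

Section lebesgue_rv.
Context {R : realType}.
Local Notation leb := (@lebesgue_measure R).

(** The concatenation is the one used in [intRn], so that the recursions defining the integral and
    the measure match. *)
Definition consrv n (p : measurableTypeR R * 'rV[R]_n) : 'rV[R]_n.+1 :=
  row_mx (p.1%:M : 'M[R]_1) p.2.

Lemma consrv0 n p : @consrv n p ord0 ord0 = p.1.
Proof.
rewrite /consrv mxE; case: splitP => // j _.
by rewrite mxE (ord1 j) eqxx mulr1n.
Qed.

Lemma consrvS n p i : @consrv n p ord0 (lift ord0 i) = p.2 ord0 i.
Proof.
rewrite /consrv mxE; case: splitP => [j|j].
  by rewrite (ord1 j).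
by rewrite /= /bump /= !add1n => -[ij]; congr (p.2 _ _); apply: val_inj.
Qed.

Lemma measurable_consrv n : measurable_fun setT (@consrv n).
Proof.
apply: measurable_fun_rvP => i.
case: (unliftP ord0 i) => [j|] ->.
  under eq_fun do rewrite consrvS.
  apply: (measurableT_comp (measurable_coord j)); exact: measurable_snd.
under eq_fun do rewrite consrv0.
exact: measurable_fst.
Qed.

Definition headtail n (x : 'rV[R]_n.+1) : measurableTypeR R * 'rV[R]_n :=
  (x ord0 ord0, \row_i x ord0 (lift ord0 i)).

Lemma consrvK n : cancel (@consrv n) (@headtail n).
Proof.
move=> [a y]; rewrite /headtail consrv0; congr pair.
by apply/rowP => i; rewrite mxE consrvS.
Qed.

Lemma measurable_headtail n : measurable_fun setT (@headtail n).
Proof.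
apply: measurable_fun_pair; first exact: measurable_coord.
apply: measurable_fun_rvP => i; rewrite /comp /=.
by under eq_fun do rewrite mxE; exact: measurable_coord.
Qed.

(** Exhausting sequences of the two factors can be taken with a common index because both
    increase. *)
Lemma sigma_finite_product d1 d2 (T1 : measurableType d1) (T2 : measurableType d2)
  (m1 : {sigma_finite_measure set T1 -> \bar R})
  (m2 : {sigma_finite_measure set T2 -> \bar R}) :
  sigma_finite setT (m1 \x m2)%E.
Proof.
have /sigma_finiteP[F [TF ndF Foo]] := sigma_finiteT m1.
have /sigma_finiteP[G [TG ndG Goo]] := sigma_finiteT m2.
exists (fun n => F n `*` G n).
  rewrite -setXTT TF TG predeqE => -[x y]; split.
    move=> [/= [n _ Fnx] [k _ Gky]]; exists (maxn n k) => //; split.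
    - by move: x Fnx; exact/subsetPset/ndF/leq_maxl.
    - by move: y Gky; exact/subsetPset/ndG/leq_maxr.
  by move=> [n _ []/= ? ?]; split; exists n.
move=> k; have [? ?] := Foo k; have [? ?] := Goo k.
split; first exact: measurableX.
by rewrite product_measure1E// lte_mul_pinfty// ge0_fin_numE.
Qed.

Section lebesgue_rv_succ.
Variables (n : nat) (m : {sigma_finite_measure set 'rV[R]_n -> \bar R}).

Definition lebesgue_rv_succ : set 'rV[R]_n.+1 -> \bar R :=
  pushforward (leb \x m)%E (@consrv n).

Let succ0 : lebesgue_rv_succ set0 = 0%E.
Proof. by rewrite /lebesgue_rv_succ /pushforward preimage_set0 measure0. Qed.

Let succ_ge0 A : (0 <= lebesgue_rv_succ A)%E.
Proof. by rewrite /lebesgue_rv_succ /pushforward; exact: measure_ge0. Qed.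

Let succ_additive : semi_sigma_additive lebesgue_rv_succ.
Proof.
move=> F mF tF mUF; rewrite /lebesgue_rv_succ /pushforward preimage_bigcup.
apply: measure_semi_sigma_additive.
- by move=> k; rewrite -[X in measurable X]setTI; apply: measurable_consrv.
- apply/trivIsetP => /= i j _ _ ij; rewrite -preimage_setI.
  by move/trivIsetP : tF => /(_ _ _ _ _ ij) ->//; rewrite preimage_set0.
- by rewrite -preimage_bigcup -[X in measurable X]setTI; exact: measurable_consrv.
Qed.

HB.instance Definition _ := isMeasure.Build _ _ _
  lebesgue_rv_succ succ0 succ_ge0 succ_additive.

Let succ_sigma_finite : sigma_finite setT lebesgue_rv_succ.
Proof.
have [F TF mF] := sigma_finite_product leb m.
exists (fun k => @headtail n @^-1` F k).
  by rewrite -preimage_bigcup -TF preimage_setT.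
move=> k; split.
  by rewrite -[X in measurable X]setTI; apply: measurable_headtail => //; case: (mF k).
rewrite /lebesgue_rv_succ /pushforward -comp_preimage.
rewrite (_ : _ \o _ = id) ?preimage_id; last exact/funext/consrvK.
by case: (mF k).
Qed.

HB.instance Definition _ := Measure_isSigmaFinite.Build _ _ _
  lebesgue_rv_succ succ_sigma_finite.

End lebesgue_rv_succ.

(** The recursion returns bundled sigma-finite measures, because the next product and every use of
    Tonelli's theorem ask for sigma-finiteness. *)
Fixpoint lebesgue_rv n : {sigma_finite_measure set 'rV[R]_n -> \bar R} :=
  match n return {sigma_finite_measure set 'rV[R]_n -> \bar R} with
  | 0 => \d_(0 : 'rV[R]_0)
  | k.+1 => lebesgue_rv_succ (lebesgue_rv k)
  end.

Lemma measurable_fun_rv0 d (T : measurableType d) (f : 'rV[R]_0 -> T) :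
  measurable_fun setT f.
Proof.
rewrite (_ : f = cst (f 0)); first exact: measurable_cst.
by apply/funext => x; rewrite (thinmx0 x).
Qed.

Lemma ge0_integral_rvS n (f : 'rV[R]_n.+1 -> \bar R) :
  measurable_fun setT f -> (forall x, 0 <= f x)%E ->
  (\int[lebesgue_rv n.+1]_x f x =
   \int[leb]_a \int[lebesgue_rv n]_y f (consrv (a, y)))%E.
Proof.
move=> mf f0; rewrite ge0_integral_pushforward //=; last exact: measurable_consrv.
rewrite preimage_setT fubini_tonelli1 //.
by apply: measurableT_comp => //; exact: measurable_consrv.
Qed.

(** Bridge from the iterated integral of the statement to a single measure, for which domination,
    Tonelli and monotone convergence are available. *)
Lemma intRnE n (f : 'rV[R]_n -> \bar R) :
  measurable_fun setT f -> (forall x, 0 <= f x)%E ->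
  intRn f = (\int[lebesgue_rv n]_x f x)%E.
Proof.
elim: n f => [|n IH] f mf f0.
  rewrite /= integral_dirac // diracT mul1e //.
rewrite ge0_integral_rvS //=; apply: eq_integral => a _; rewrite IH //.
exact: (measurableT_comp mf (measurableT_comp (@measurable_consrv n)
  (pair1_measurable a))).
Qed.

End lebesgue_rv.

(** * Topology of row vectors; measurability of jointly continuous functions *)

Section rv_topology.
Context {R : realType}.

Lemma rv_norm_leP n (x : 'rV[R]_n) e :
  (forall i, `|x ord0 i| <= e) -> 0 <= e -> `|x| <= e.
Proof.
move=> xe e0; rewrite [leLHS]/Num.norm /= mx_normrE; apply/bigmax_leP; split => // -[i j] _ /=.
by rewrite (ord1 i).
Qed.

Lemma coord_norm_le n (x : 'rV[R]_n) i : `|x ord0 i| <= `|x|.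
Proof.
rewrite [leRHS]/Num.norm /= mx_normrE.
by apply/bigmax_geP; right => /=; exists (ord0, i).
Qed.

Definition grid k (a : R) : R := (Num.floor (k.+1%:R * a))%:~R / k.+1%:R.

Lemma grid_dist k a : `|a - grid k a| <= k.+1%:R^-1.
Proof.
have /andP[] := floor_itv (k.+1%:R * a); rewrite intrD /grid.
set z := (_)%:~R => h1 h2; have k0 : 0 < k.+1%:R :> R by rewrite ltr0n.
rewrite ler_norml; apply/andP; split.
  rewrite -(ler_pM2l k0) mulrN divff ?gt_eqF // mulrBr mulrCA divff ?gt_eqF //; lra.
rewrite -(ler_pM2l k0) divff ?gt_eqF // mulrBr mulrCA divff ?gt_eqF //; lra.
Qed.

Lemma cvg_grid a : grid k a @[k --> \oo] --> a.
Proof.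
apply/cvgrPdist_le => e e0; near=> k.
apply: (le_trans (grid_dist k a)); apply/ltW.
by near: k; exact: (near_infty_natSinv_lt (PosNum e0)).
Unshelve. all: by end_near. Qed.

Lemma cvg_grid_rv n (x : 'rV[R]_n) : map_mx (grid k) x @[k --> \oo] --> x.
Proof.
apply/cvgrPdist_le => e e0; near=> k.
apply: rv_norm_leP => [i|]; last exact: ltW.
rewrite !mxE; apply: (le_trans (grid_dist k _)); apply/ltW.
by near: k; exact: (near_infty_natSinv_lt (PosNum e0)).
Unshelve. all: by end_near. Qed.

Lemma measurable_floor_eq k (m : int) :
  measurable [set a : R | Num.floor (k.+1%:R * a) = m].
Proof.
have k0 : 0 < k.+1%:R :> R by rewrite ltr0n.
rewrite (_ : [set _ | _] = `[m%:~R / k.+1%:R, (m + 1)%:~R / k.+1%:R[%classic).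
  exact: measurable_itv.
apply/seteqP; split => a /=; rewrite in_itv /= ler_pdivrMr // ltr_pdivlMr // mulrC.
  by move=> <-; exact: floor_itv.
by move/floor_def.
Qed.

(* A function continuous on [D] is there the limit of its compositions with
   the grid roundings, which take countably many values. *)
Lemma measurable_jcont n (g : 'rV[R]_n -> R -> R)
    (D : set (measurableTypeR R * 'rV[R]_n)) :
  measurable D -> (forall s y, D (s, y) -> jcont g y s) ->
  measurable_fun D (fun p => g p.2 p.1 : measurableTypeR R).
Proof.
move=> mD cg.
apply: (@measurable_fun_cvg _ _ _ _
  (fun k p => g (map_mx (grid k) p.2) (grid k p.1))); last first.
  move=> [s y] /cg /= cgp.
  have h : (map_mx (grid k) y, grid k s) @[k --> \oo] --> (y, s).
    by apply: (@cvg_pair _ _ _ _ (nbhs y) (nbhs s));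
      [exact: cvg_grid_rv|exact: cvg_grid].
  exact: (cvg_comp _ _ h cgp).
(* Each approximation factors through the integer labels [Z] of a grid cell, so a preimage is a
   countable union of fibres of [Z]. Rounded points may leave [D]; continuity serves only in the
   limit, at points of [D]. *)
move=> k _ B mB; apply: measurableI => //.
pose Z (p : measurableTypeR R * 'rV[R]_n) : int * 'rV[int]_n :=
  (Num.floor (k.+1%:R * (p.1 : R)), map_mx (fun a => Num.floor (k.+1%:R * a)) p.2).
pose G (z : int * 'rV[int]_n) :=
  g (map_mx (fun m : int => m%:~R / k.+1%:R) z.2) (z.1%:~R / k.+1%:R).
rewrite (_ : _ @^-1` _ =
    \bigcup_z (if asbool (B (G z)) then Z @^-1` [set z] else set0)); last first.
  have GE p : G (Z p) = g (map_mx (grid k) p.2) (grid k p.1).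
    by rewrite /G /Z /= -map_mx_comp.
  apply/seteqP; split => p /=.
    by move=> Bp; exists (Z p) => //; rewrite GE; case: asboolP.
  by case=> z _; case: asboolP => // Bz /= Zp; rewrite -GE Zp.
apply: countable_bigcupT_measurable => [|z]; first exact: countableP.
case: asboolP => // _.
rewrite (_ : _ @^-1` _ = (fst @^-1` [set a : R | Num.floor (k.+1%:R * a) = z.1]) `&`
   \bigcap_(i in [set: 'I_n]) ((fun p : measurableTypeR R * 'rV[R]_n => p.2 ord0 i) @^-1`
     [set a : R | Num.floor (k.+1%:R * a) = z.2 ord0 i])); last first.
  apply/seteqP; split => p /=.
    by move=> <-; split => // i _ /=; rewrite mxE.
  move=> [h1 h2]; rewrite [RHS]surjective_pairing /Z; congr pair => //.
  by apply/rowP => i; rewrite mxE; exact: h2.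
apply: measurableI.
  by rewrite -[X in measurable X]setTI; apply: measurable_fst => //; exact: measurable_floor_eq.
apply: fin_bigcap_measurable => // i _; rewrite -[X in measurable X]setTI.
apply: (measurableT_comp (measurable_coord i) measurable_snd) => //.
exact: measurable_floor_eq.
Qed.

End rv_topology.

(** * Gaussian integrals and the volume of cubes *)

Section gauss_rv.
Context {R : realType}.
Local Notation leb := (@lebesgue_measure R).

Lemma sqnorm_ge0 n (x : 'rV[R]_n) : 0 <= sqnorm x.
Proof. by apply: sumr_ge0 => i _; exact: sqr_ge0. Qed.

Lemma coord_sqr_le_sqnorm n (x : 'rV[R]_n) i : x ord0 i ^+ 2 <= sqnorm x.
Proof.
rewrite /sqnorm (bigD1 i) //= lerDl; apply: sumr_ge0 => j _; exact: sqr_ge0.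
Qed.

Lemma rvBE n (x y : 'rV[R]_n) i : (x - y) ord0 i = x ord0 i - y ord0 i.
Proof. by rewrite !mxE. Qed.

Lemma sqnorm_consrv n a (y : 'rV[R]_n) (x : 'rV[R]_n.+1) :
  sqnorm (consrv (a, y) - x) = (a - (headtail x).1) ^+ 2 + sqnorm (y - (headtail x).2).
Proof.
rewrite /sqnorm big_ord_recl rvBE consrv0; congr (_ + _).
by apply: eq_bigr => i _; rewrite !rvBE consrvS /headtail /= mxE.
Qed.

Lemma measurable_sqnormB d (T : measurableType d) n (f g : T -> 'rV[R]_n) :
  measurable_fun setT f -> measurable_fun setT g ->
  measurable_fun setT (fun z => sqnorm (f z - g z)).
Proof.
move=> mf mg; apply: measurable_sum => i.
apply: measurable_funX.
under eq_fun do rewrite !mxE.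
by apply: measurable_funB; apply: (measurableT_comp (measurable_coord i)).
Qed.

Lemma integral_gauss1 (c m : R) : 0 < c ->
  (\int[leb]_a (expR (- c * (a - m) ^+ 2))%:E = (Num.sqrt (pi / c))%:E)%E.
Proof.
(* Variance [1 / (2 c)]: the integrand becomes the normal density divided by its peak. *)
move=> c0; pose s := Num.sqrt (c^-1 / 2).
have s0 : s != 0 by rewrite gt_eqF // sqrtr_gt0 divr_gt0 ?invr_gt0.
have s2 : s ^+ 2 = c^-1 / 2 by rewrite sqr_sqrtr // divr_ge0 ?invr_ge0 // ltW.
have h := integral_normal_pdf m s.
have fE a : expR (- c * (a - m) ^+ 2) = (normal_peak s)^-1 * normal_pdf m s a.
  rewrite normal_pdfE // mulrA mulVf ?mul1r ?gt_eqF ?normal_peak_gt0 //.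
  rewrite /normal_fun s2; congr expR.
  by rewrite -[_ *+ 2]mulr_natr divfK ?pnatr_eq0 // invrK; ring.
under eq_integral do rewrite fE EFinM.
rewrite ge0_integralZl //=; last 3 first.
- by apply/measurable_EFinP; exact: measurable_normal_pdf.
- by move=> a _; rewrite lee_fin normal_pdf_ge0.
- by rewrite lee_fin invr_ge0 normal_peak_ge0.
rewrite h mule1 /normal_peak invrK s2; congr (Num.sqrt _)%:E.
by rewrite -[_ *+ 2]mulr_natr; field; rewrite gt_eqF.
Qed.

Lemma measurable_gauss_rv n (c : R) (x : 'rV[R]_n) :
  measurable_fun setT (fun y : 'rV[R]_n => expR (- c * sqnorm (y - x))).
Proof.
apply: measurableT_comp => //; apply: measurable_funM => //.
by apply: measurable_sqnormB => //; exact: measurable_id.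
Qed.

Lemma integral_gauss_rv n (c : R) (x : 'rV[R]_n) : 0 < c ->
  (\int[lebesgue_rv n]_y (expR (- c * sqnorm (y - x)))%:E =
    (Num.sqrt (pi / c) ^+ n)%:E)%E.
Proof.
move=> c0; elim: n x => [|n IH] x.
  rewrite /= integral_dirac //; last exact: measurable_fun_rv0.
  by rewrite diracT mul1e /sqnorm big_ord0 mulr0 expR0 expr0.
rewrite ge0_integral_rvS; last 2 first.
- by apply/measurable_EFinP; exact: measurable_gauss_rv.
- by move=> y; rewrite lee_fin expR_ge0.
under eq_integral => a _.
  under eq_integral do rewrite sqnorm_consrv mulrDr expRD EFinM.
  rewrite ge0_integralZl //=; [|by apply/measurable_EFinP; exact: measurable_gauss_rv].
  rewrite IH muleC.
  over.
rewrite ge0_integralZl //=; first last.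
- apply/measurable_EFinP; apply: measurableT_comp => //; apply: measurable_funM => //.
  by apply: measurable_funX; apply: measurable_funB.
by rewrite integral_gauss1 // -EFinM -exprSr.
Qed.

Lemma measurable_box n (x : 'rV[R]_n) (h : R) :
  measurable [set y : 'rV[R]_n | forall i, `|y ord0 i - x ord0 i| <= h].
Proof.
rewrite (_ : [set _ | _] = \bigcap_(i in [set: 'I_n])
  ((fun y : 'rV[R]_n => `|y ord0 i - x ord0 i|) @^-1` `]-oo, h]%classic)); last first.
  apply/seteqP; split => y /= hy i.
    by move=> _ /=; rewrite in_itv /=; exact: hy.
  by have := hy i I; rewrite /= in_itv.
apply: fin_bigcap_measurable => // i _; rewrite -[X in measurable X]setTI.
have : measurable_fun setT (fun y : 'rV[R]_n => `|y ord0 i - x ord0 i|).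
  apply: measurableT_comp => //.
  by apply: measurable_funB => //; exact: measurable_coord.
by apply => //; exact: measurable_itv.
Qed.

Lemma lebesgue_rv_box n (x : 'rV[R]_n) (h : R) : 0 < h ->
  lebesgue_rv n [set y | forall i, `|y ord0 i - x ord0 i| <= h] = ((2 * h) ^+ n)%:E.
Proof.
move=> h0; elim: n x => [|n IH] x.
  rewrite expr0 /= diracE mem_set //=; last by case.
rewrite /= /lebesgue_rv_succ /pushforward.
rewrite (_ : _ @^-1` _ = `[(headtail x).1 - h, (headtail x).1 + h]%classic `*`
   [set y : 'rV[R]_n | forall i, `|y ord0 i - (headtail x).2 ord0 i| <= h]); last first.
  apply/seteqP; split => -[a y] /= hy.
    split => [|i].
      by have := hy ord0; rewrite consrv0 in_itv /= ler_distl.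
    by have := hy (lift ord0 i); rewrite consrvS mxE.
  move=> i; case: (unliftP ord0 i) => [j|] ->.
    by rewrite consrvS; have := hy.2 j; rewrite mxE.
  by rewrite consrv0; have := hy.1; rewrite in_itv /= ler_distl.
rewrite product_measure1E //; last exact: measurable_box.
rewrite [X in (_ * X)%E]IH /= lebesgue_measure_itv /= lte_fin ifT; last first.
  by rewrite ltrD2l; lra.
by rewrite -EFinB -EFinM exprS; congr (_ * _)%:E; ring.
Qed.

End gauss_rv.

(** * Integrability of continuous functions with bounded support *)

Section slab.
Context {R : realType}.
Local Notation leb := (@lebesgue_measure R).

(** The norm of row vectors is the maximum norm: its balls are cubes, compact and of explicit
    measure. Euclidean distances are always written with [sqnorm]. *)
Lemma rv_ballE n (L : R) : 0 <= L ->
  [set y : 'rV[R]_n | `|y| <= L] =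
  [set y : 'rV[R]_n | forall i, `|y ord0 i - (0 : 'rV[R]_n) ord0 i| <= L].
Proof.
move=> L0; apply/seteqP; split => y /= hy.
  by move=> i; rewrite mxE subr0; exact: le_trans (coord_norm_le _ _) hy.
by apply: rv_norm_leP => // i; have := hy i; rewrite mxE subr0.
Qed.

Lemma measurable_rv_ball n (L : R) : 0 <= L ->
  measurable [set y : 'rV[R]_n | `|y| <= L].
Proof. by move=> L0; rewrite rv_ballE //; exact: measurable_box. Qed.

Lemma lebesgue_rv_ball_lty n (L : R) : 0 < L ->
  (lebesgue_rv n [set y : 'rV[R]_n | (`|y| <= L)%R] < +oo)%E.
Proof. by move=> L0; rewrite rv_ballE ?lebesgue_rv_box ?ltry // ltW. Qed.

Lemma compact_rv_ball n (L : R) : compact [set y : 'rV[R]_n | `|y| <= L].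
Proof.
have [L0|L0] := leP 0 L.
  rewrite (_ : [set _ | _] =
    [set y : 'rV[R]_n | forall i, `[- L, L]%classic (y ord0 i)]); last first.
    apply/seteqP; split => y /= hy.
      by move=> i; rewrite in_itv /= -ler_norml (le_trans (coord_norm_le _ _)).
    by apply: rv_norm_leP => // i; have := hy i; rewrite in_itv /= -ler_norml.
  by apply: (@rV_compact R n (fun=> `[- L, L]%classic)) => i; exact: segment_compact.
rewrite (_ : [set _ | _] = set0); first exact: compact0.
by apply/seteqP; split => y //= hy; move: (le_lt_trans hy L0); rewrite normr_lt0.
Qed.

Lemma jcont_bounded n (g : 'rV[R]_n -> R -> R) (L s0 s1 : R) :
  (forall y s, `|y| <= L -> s0 <= s <= s1 -> jcont g y s) ->
  exists K, forall y s, `|y| <= L -> s0 <= s <= s1 -> `|g y s| <= K.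
Proof.
move=> cg; pose A := [set y : 'rV[R]_n | `|y| <= L] `*` `[s0, s1]%classic.
have cA : compact A by apply: compact_setX; [exact: compact_rv_ball|exact: segment_compact].
have cf : {within A, continuous (fun p : 'rV[R]_n * R => g p.1 p.2)}.
  apply: continuous_in_subspaceT => -[y s]; rewrite inE => -[/= hy].
  by rewrite in_itv /= => hs; exact: cg.
have [M [_ hM]] := compact_bounded (continuous_compact cf cA).
exists (M + 1) => y s hy hs; apply: (hM (M + 1)); first by rewrite ltrDl.
by exists (y, s) => //; split => //=; rewrite in_itv.
Qed.

Lemma integrable_bounded_support d (T : measurableType d) (mu : {measure set T -> \bar R})
    (f : T -> R) (B : set T) (K : R) :
  measurable B -> (mu B < +oo)%E -> measurable_fun setT f ->
  (forall x, B x -> `|f x| <= K) -> (forall x, ~ B x -> f x = 0) ->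
  mu.-integrable setT (EFin \o f).
Proof.
move=> mB Boo mf fK f0.
have -> : EFin \o f = (EFin \o f) \_ B.
  apply/funext => x; rewrite patchE; case: ifPn => //.
  by move=> /negP xB; rewrite /= f0 //; apply: contra_not xB; rewrite inE.
apply/(integrable_mkcond _ mB); apply: measurable_bounded_integrable => //.
  exact: measurable_funTS.
exists K; split; first exact: num_real.
by move=> y Ky x Bx /=; exact: le_trans (fK x Bx) (ltW Ky).
Qed.

Lemma jcont_const n (w : 'rV[R]_n -> R) y s :
  {for y, continuous w} -> jcont (fun z _ => w z) y s.
Proof.
move=> cw; apply: (@cvg_comp _ _ _ fst w _ (nbhs y)) => //.
exact: cvg_fst.
Qed.

(** The slice is extended to a function constant in time, to which the space-time criterion
    applies. *)
Lemma measurable_slice n (g : 'rV[R]_n -> R -> R) s :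
  (forall y, jcont g y s) -> measurable_fun setT (fun y : 'rV[R]_n => g y s).
Proof.
move=> cg; have h : measurable_fun setT
   (fun p : measurableTypeR R * 'rV[R]_n => (g p.2 s : measurableTypeR R)).
  apply: (@measurable_jcont _ _ (fun y _ => g y s)) => // s' y _.
  apply: jcont_const.
  have := cg y; rewrite /jcont /continuous_at => h.
  have h2 : (z, s) @[z --> y] --> (y, s).
    apply: (@cvg_pair _ _ _ (nbhs y) (nbhs y) (nbhs s) _ _ _ id (fun=> s)) => //; exact: cvg_cst.
  exact: (cvg_comp _ _ h2 h).
exact: (measurableT_comp h (pair1_measurable (0 : measurableTypeR R))).
Qed.

Lemma integrable_slice n (g : 'rV[R]_n -> R -> R) (L s : R) :
  0 < L -> (forall y, jcont g y s) -> (forall y, L < `|y| -> g y s = 0) ->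
  (lebesgue_rv n).-integrable setT (fun y => (g y s)%:E).
Proof.
move=> L0 cg g0; have [K hK] := @jcont_bounded n g L s s
  (fun y s' _ => ltac:(by case/andP => h1 h2; rewrite (_ : s' = s) //; apply/eqP; rewrite eq_le h1 h2)).
apply: (@integrable_bounded_support _ _ _ (fun y => g y s) [set y : 'rV[R]_n | `|y| <= L] K).
- by apply: measurable_rv_ball; exact: ltW.
- exact: lebesgue_rv_ball_lty.
- exact: measurable_slice.
- by move=> y hy; apply: hK => //; rewrite lexx.
- by move=> y /negP; rewrite -ltNge; exact: g0.
Qed.

Lemma integrable_slab n (g : 'rV[R]_n -> R -> R) (L s0 s1 : R) :
  0 < L -> (forall y s, s0 <= s <= s1 -> jcont g y s) ->
  (forall y s, s0 <= s <= s1 -> L < `|y| -> g y s = 0) ->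
  (leb \x lebesgue_rv n)%E.-integrable setT
    ((fun p => (g p.2 p.1)%:E) \_ (`[s0, s1]%classic `*` setT)).
Proof.
move=> L0 cg g0.
have mA : measurable (`[s0, s1]%classic `*` setT : set (measurableTypeR R * 'rV[R]_n)).
  exact: measurableX.
have [K hK] := @jcont_bounded n g L s0 s1 (fun y s _ h => cg y s h).
rewrite (_ : _ \_ _ = EFin \o ((fun p => g p.2 p.1) \_ (`[s0, s1]%classic `*` setT))); last first.
  by apply/funext => p; rewrite /= !patchE; case: ifP.
pose B : set (measurableTypeR R * 'rV[R]_n) :=
  `[s0, s1]%classic `*` [set y : 'rV[R]_n | `|y| <= L].
apply: (@integrable_bounded_support _ _ (leb \x lebesgue_rv n)%E _ B K).
- by apply: measurableX => //; by apply: measurable_rv_ball; exact: ltW.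
- rewrite /B /= product_measure1E //; last by apply: measurable_rv_ball; exact: ltW.
  apply: lte_mul_pinfty => //.
  + by rewrite ge0_fin_numE // /= lebesgue_measure_itv /=; case: ifP => // _; rewrite -EFinB ltry.
  + exact: lebesgue_rv_ball_lty.
- apply/(measurable_restrictT _ mA).
  by apply: measurable_jcont => // s y [] /=; rewrite in_itv /= => /cg.
- move=> [s y] [/= hs hy]; rewrite patchE mem_set //=.
  by apply: hK => //; move: hs; rewrite in_itv.
- move=> [s y] h; rewrite patchE; case: ifPn => //; rewrite inE => -[/= hs _].
  apply: g0; first by move: hs; rewrite in_itv.
  by rewrite ltNge; apply/negP => hy; apply: h.
Qed.

End slab.

(** * Integration by parts in space and in time *)

Section ibp.
Context {R : realType}.
Local Notation leb := (@lebesgue_measure R).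

(** A directional derivative only sees a function along a line, so it passes to any function with
    the same values along a line, possibly on another space. This links partial derivatives to
    derivatives in one variable. *)
Lemma is_derive_line (V W : normedModType R) (f : V -> R) (g : W -> R) x v y w d :
  (forall h, f (h *: v + x) = g (h *: w + y)) ->
  is_derive x v f d -> is_derive y w g d.
Proof.
move=> fg; have fgx : f x = g y by have := fg 0; rewrite !scale0r !add0r.
have E : (fun h => h^-1 *: ((f \o shift x) (h *: v) - f x)) =
         (fun h => h^-1 *: ((g \o shift y) (h *: w) - g y)).
  by apply/funext => h; rewrite /= fg fgx.
by case; rewrite /derivable /derive E => h1 h2; split.
Qed.

Lemma integral_rvS n (f : 'rV[R]_n.+1 -> \bar R) :
  (lebesgue_rv n.+1).-integrable setT f ->
  (leb \x lebesgue_rv n)%E.-integrable setT (f \o @consrv R n).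
Proof.
move=> /integrableP[mf foo]; apply/integrableP; split.
  by apply: measurableT_comp => //; exact: measurable_consrv.
move: foo; rewrite ge0_integral_pushforward //=.
  exact: measurable_consrv.
exact: measurableT_comp.
Qed.

Lemma integral_rvSE n (f : 'rV[R]_n.+1 -> \bar R) :
  (lebesgue_rv n.+1).-integrable setT f ->
  (\int[lebesgue_rv n.+1]_x f x =
   \int[leb]_a \int[lebesgue_rv n]_y f (consrv (a, y)))%E.
Proof.
move=> fi; have ffi := integral_rvS fi.
rewrite /= (integral_pushforward (@measurable_consrv R n)) //.
- by rewrite preimage_setT -integral12_prod_meas1.
- by case/integrableP : fi.
Qed.

Lemma integral_rvSE2 n (f : 'rV[R]_n.+1 -> \bar R) :
  (lebesgue_rv n.+1).-integrable setT f ->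
  (\int[lebesgue_rv n.+1]_x f x =
   \int[lebesgue_rv n]_y \int[leb]_a f (consrv (a, y)))%E.
Proof.
by move=> fi; rewrite integral_rvSE // (Fubini (integral_rvS fi)).
Qed.

Lemma FTC2_cont (F f : R -> R) (a b : R) : a < b ->
  (forall x, a <= x <= b -> is_derive x 1 F (f x)) ->
  (forall x, a <= x <= b -> {for x, continuous f}) ->
  (\int[leb]_(x in `[a, b]) (f x)%:E = (F b)%:E - (F a)%:E)%E.
Proof.
move=> ab dF cf.
have cF x : a <= x <= b -> {for x, continuous F}.
  move=> /dF [h _]; apply: differentiable_continuous.
  exact/derivable1_diffP.
apply: continuous_FTC2 => //.
- by apply: continuous_in_subspaceT => x; rewrite inE /= in_itv /= => /cf.
- split.
  + by move=> x; rewrite in_itv /= => /andP[/ltW h1 /ltW h2]; case: (dF x _) => //; rewrite h1 h2.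
  + by apply: cvg_at_right_filter; apply: cF; rewrite lexx ltW.
  + by apply: cvg_at_left_filter; apply: cF; rewrite lexx ltW.
- move=> x; rewrite in_itv /= => /andP[/ltW h1 /ltW h2].
  by rewrite derive1E; case: (dF x _) => //; rewrite h1 h2.
Qed.

Lemma rvE n (x y : 'rV[R]_n) h i : (h *: x + y) ord0 i = h * x ord0 i + y ord0 i.
Proof. by rewrite !mxE. Qed.

Lemma unitvE n (i j : 'I_n) : unitv R i ord0 j = (j == i)%:R.
Proof. by rewrite mxE eqxx. Qed.

Lemma consrv_head_line n (a h : R) (y : 'rV[R]_n) :
  h *: unitv R ord0 + consrv (a, y) = consrv (h *: 1 + a, y).
Proof.
apply/rowP => i; rewrite rvE unitvE; case: (unliftP ord0 i) => [j|] ->.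
  by rewrite !consrvS /= mulr0 add0r.
by rewrite !consrv0 eqxx.
Qed.

Lemma consrv_tail_line n (a h : R) (y : 'rV[R]_n) j :
  h *: unitv R (lift ord0 j) + consrv (a, y) = consrv (a, h *: unitv R j + y).
Proof.
apply/rowP => i; rewrite rvE unitvE; case: (unliftP ord0 i) => [k|] ->.
  by rewrite !consrvS /= rvE unitvE (inj_eq (@lift_inj _ ord0)).
by rewrite !consrv0 /= mulr0 add0r.
Qed.

Lemma norm_consrv_ge_head n (a : R) (y : 'rV[R]_n) : `|a| <= `|consrv (a, y)|.
Proof. by rewrite -[X in `|X| <= _](@consrv0 _ n (a, y)) coord_norm_le. Qed.

Lemma norm_consrv_ge_tail n (a : R) (y : 'rV[R]_n) : `|y| <= `|consrv (a, y)|.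
Proof.
apply: rv_norm_leP => // i.
by rewrite -(@consrvS _ n (a, y)) coord_norm_le.
Qed.

Lemma continuous_consrv n : continuous (fun p : R * 'rV[R]_n => consrv p).
Proof.
move=> p; apply/cvgrPdist_lt => e e0; near=> q.
apply: (@le_lt_trans _ _ `|p - q|); last first.
  by near: q; apply: (@cvgr_dist_lt _ _ _ (nbhs p) _ id) => //; exact: cvg_id.
apply: rv_norm_leP => // i; rewrite rvBE.
case: (unliftP ord0 i) => [k|] ->.
  rewrite !consrvS prod_normE /= le_max; apply/orP; right.
  by rewrite -rvBE; exact: coord_norm_le.
by rewrite !consrv0 prod_normE /= le_max lexx.
Unshelve. all: by end_near. Qed.

Lemma deriv0_locally0 (f : R -> R) (x d : R) :
  (\forall y \near x, f y = 0) -> is_derive x 1 f d -> d = 0.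
Proof.
move=> f0 [_ <-]; rewrite -[RHS](@derive_cst _ _ _ (0 : R) x 1).
exact: near_eq_derive.
Qed.

Lemma derivative_support n (v w : 'rV[R]_n -> R) (i : 'I_n) L :
  (forall x, is_derive x (unitv R i) v (w x)) ->
  (forall x, L < `|x| -> v x = 0) -> forall x, L < `|x| -> w x = 0.
Proof.
move=> dv v0 x xL.
apply: (@deriv0_locally0 (fun h => v (h *: unitv R i + x)) 0); last first.
  apply: is_derive_line (dv x) => h; rewrite addr0; congr v.
  by rewrite [in RHS]/GRing.scale /= mulr1.
have : `|h *: unitv R i + x| @[h --> (0 : R)] --> `|0 *: unitv R i + x|.
  have h : h *: unitv R i + x @[h --> 0] --> 0 *: unitv R i + x.
    by apply: cvgD; [apply: cvgZr_tmp; exact: cvg_id|exact: cvg_cst].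
  by apply: (cvg_comp _ _ h); exact: norm_continuous.
rewrite scale0r add0r => /cvgr_gt /(_ L xL).
by apply: filterS => h /v0.
Qed.

End ibp.

Section green.
Context {R : realType}.
Local Notation leb := (@lebesgue_measure R).

Lemma integrable_csupport n (w : 'rV[R]_n -> R) (L : R) : 0 < L -> continuous w ->
  (forall x, L < `|x| -> w x = 0) ->
  (lebesgue_rv n).-integrable setT (fun y => (w y)%:E).
Proof.
move=> L0 cw w0; apply: (@integrable_slice _ _ (fun y _ => w y) L 0) => // y.
by apply: jcont_const; exact: cw.
Qed.

(** Induction on the dimension. For a tail coordinate the integral already vanishes at each fixed
    head; for the head coordinate Fubini puts that variable inside, and the fundamental theorem
    leaves two values of [v] outside its support. *)
Lemma integral_partial0 n (v w : 'rV[R]_n -> R) (i : 'I_n) (L : R) : 0 < L ->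
  (forall x, is_derive x (unitv R i) v (w x)) -> continuous w ->
  (forall x, L < `|x| -> v x = 0) ->
  (\int[lebesgue_rv n]_x (w x)%:E = 0)%E.
Proof.
move=> L0; elim: n v w i => [|n IH] v w i dv cw v0; first by case: i {dv}.
have w0 := derivative_support dv v0.
have wi := integrable_csupport L0 cw w0.
case: (unliftP ord0 i) => [j|] ij; rewrite {}ij in dv.
  rewrite integral_rvSE //; apply: integral0_eq => a _.
  apply: (IH (fun y => v (consrv (a, y))) (fun y => w (consrv (a, y))) j).
  - move=> y; apply: is_derive_line (dv (consrv (a, y))) => h.
    by rewrite consrv_tail_line.
  - move=> y.
    have h : (a, z) @[z --> y] --> (a, y).
      apply: (@cvg_pair _ _ _ (nbhs y) (nbhs a) (nbhs y) _ _ _ (fun=> a) id) => //.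
      exact: cvg_cst.
    apply: (cvg_comp _ _ (cvg_comp _ _ h (@continuous_consrv R n (a, y)))).
    exact: cw.
  - by move=> y yL; apply: v0; exact: lt_le_trans yL (norm_consrv_ge_tail _ _).
rewrite integral_rvSE2 //; apply: integral0_eq => y _.
(* The margin 1 puts both endpoints strictly outside the support, where [v] is known to vanish. *)
transitivity (\int[leb]_(a in `[(- (L + 1))%R, (L + 1)%R]) (w (consrv (a, y)))%:E)%E.
  rewrite [RHS]integral_mkcond; apply: eq_integral => a _.
  rewrite patchE; case: ifPn => // ha; rewrite w0 //.
  apply: (lt_le_trans _ (norm_consrv_ge_head _ _)).
  rewrite ltNge; apply: contra ha => ha; rewrite inE /= in_itv /= -ler_norml.
  by rewrite (le_trans ha) // lerDl.
have dF (a : R) : is_derive a 1 (fun b => v (consrv (b, y))) (w (consrv (a, y))).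
  apply: is_derive_line (dv (consrv (a, y))) => h.
  by rewrite consrv_head_line.
have cF (a : R) : {for a, continuous (fun b => w (consrv (b, y)))}.
  have h : (b, y) @[b --> a] --> (a, y).
    apply: (@cvg_pair _ _ _ (nbhs a) (nbhs a) (nbhs y) _ _ _ id (fun=> y)) => //.
    exact: cvg_cst.
  apply: (cvg_comp _ _ (cvg_comp _ _ h (@continuous_consrv R n (a, y)))).
  exact: cw.
have L1 : - (L + 1) < L + 1 by lra.
have -> := FTC2_cont L1 (fun a _ => dF a) (fun a _ => cF a).
rewrite !v0 ?subee //.
- apply: (lt_le_trans _ (norm_consrv_ge_head _ _)).
  by rewrite normrN ger0_norm ?ltrDl // addr_ge0 // ltW.
- apply: (lt_le_trans _ (norm_consrv_ge_head _ _)).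
  by rewrite ger0_norm ?ltrDl // addr_ge0 // ltW.
Qed.

Lemma jcont_time n (g : 'rV[R]_n -> R -> R) y s :
  jcont g y s -> {for s, continuous (fun t => g y t)}.
Proof.
move=> cg; have h : (y, t) @[t --> s] --> (y, s).
  apply: (@cvg_pair _ _ _ (nbhs s) (nbhs y) (nbhs s) _ _ _ (fun=> y) id) => //.
  exact: cvg_cst.
exact: (cvg_comp _ _ h cg).
Qed.

Lemma jcont_space n (g : 'rV[R]_n -> R -> R) y s :
  jcont g y s -> {for y, continuous (fun z => g z s)}.
Proof.
move=> cg; have h : (z, s) @[z --> y] --> (y, s).
  apply: (@cvg_pair _ _ _ (nbhs y) (nbhs y) (nbhs s) _ _ _ id (fun=> s)) => //.
  exact: cvg_cst.
exact: (cvg_comp _ _ h cg).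
Qed.

(** Fubini on the slab and the fundamental theorem at each fixed [y] replace differentiation under
    the integral sign. *)
Lemma integral_time_derivative n (U Ut : 'rV[R]_n -> R -> R) (L s0 s1 : R) :
  0 < L -> s0 < s1 ->
  (forall y s, s0 <= s <= s1 -> is_derive s 1 (U y) (Ut y s)) ->
  (forall y s, s0 <= s <= s1 -> jcont U y s) ->
  (forall y s, s0 <= s <= s1 -> jcont Ut y s) ->
  (forall y s, s0 <= s <= s1 -> L < `|y| -> U y s = 0) ->
  (forall y s, s0 <= s <= s1 -> L < `|y| -> Ut y s = 0) ->
  (\int[lebesgue_rv n]_y (U y s1)%:E = \int[lebesgue_rv n]_y (U y s0)%:E +
    \int[leb]_(s in `[s0, s1]) \int[lebesgue_rv n]_y (Ut y s)%:E)%E.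
Proof.
move=> L0 s01 dU cU cUt U0 Ut0.
have h1 : s0 <= s1 <= s1 by rewrite lexx ltW.
have h0 : s0 <= s0 <= s1 by rewrite lexx ltW.
have i1 := integrable_slice L0 (fun y => cU y s1 h1) (fun y => U0 y s1 h1).
have i0 := integrable_slice L0 (fun y => cU y s0 h0) (fun y => U0 y s0 h0).
have iU := integrable_slab L0 cUt Ut0.
have := Fubini iU.
have -> : (\int[leb]_s \int[lebesgue_rv n]_y
     ((fun p => (Ut p.2 p.1)%:E) \_ (`[s0, s1]%classic `*` setT)) (s, y) =
   \int[leb]_(s in `[s0, s1]) \int[lebesgue_rv n]_y (Ut y s)%:E)%E.
  rewrite [RHS]integral_mkcond; apply: eq_integral => s _.
  rewrite patchE; case: ifPn => hs.
    apply: eq_integral => y _; rewrite patchE /= mem_set //; split => //=.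
    by move: hs; rewrite inE.
  apply: integral0_eq => y _; rewrite patchE memNset // => -[/= h _].
  by move/negP : hs; apply; rewrite inE.
move=> ->.
have -> : (\int[lebesgue_rv n]_y \int[leb]_s
     ((fun p => (Ut p.2 p.1)%:E) \_ (`[s0, s1]%classic `*` setT)) (s, y) =
   \int[lebesgue_rv n]_y ((U y s1)%:E - (U y s0)%:E))%E.
  apply: eq_integral => y _.
  have <- := FTC2_cont s01 (dU y) (fun s hs => jcont_time (cUt y s hs)).
  rewrite [RHS]integral_mkcond; apply: eq_integral => s _.
  rewrite !patchE /=; congr (if _ then _ else _).
  by apply/idP/idP; rewrite !inE /=; [case|split].
rewrite integralB // addeC subeK //.
exact: integrable_fin_num.
Qed.

End green.

(** * The parabolic Green identity *)

Section green_identity.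
Context {R : realType}.
Local Notation leb := (@lebesgue_measure R).

Lemma jcontD n (f g : 'rV[R]_n -> R -> R) y s :
  jcont f y s -> jcont g y s -> jcont (fun z t => f z t + g z t) y s.
Proof. by move=> cf cg; apply: cvgD. Qed.

Lemma jcontN n (f : 'rV[R]_n -> R -> R) y s :
  jcont f y s -> jcont (fun z t => - f z t) y s.
Proof. by move=> cf; apply: cvgN. Qed.

Lemma jcontB n (f g : 'rV[R]_n -> R -> R) y s :
  jcont f y s -> jcont g y s -> jcont (fun z t => f z t - g z t) y s.
Proof. by move=> cf cg; apply: jcontD => //; exact: jcontN. Qed.

Lemma jcontM n (f g : 'rV[R]_n -> R -> R) y s :
  jcont f y s -> jcont g y s -> jcont (fun z t => f z t * g z t) y s.
Proof. by move=> cf cg; apply: cvgM. Qed.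

Lemma jcont_sum n (I : Type) (r : seq I) (f : I -> 'rV[R]_n -> R -> R) y s :
  (forall i, jcont (f i) y s) -> jcont (fun z t => \sum_(i <- r) f i z t) y s.
Proof.
move=> cf; elim: r => [|i r IH].
  rewrite (_ : (fun z t => _) = (fun z t => 0)); first exact: cvg_cst.
  by apply/funext => z; apply/funext => t; rewrite big_nil.
rewrite (_ : (fun z t => _) = (fun z t => f i z t + \sum_(i <- r) f i z t)).
  by apply: jcontD.
by apply/funext => z; apply/funext => t; rewrite big_cons.
Qed.

Lemma integral_sum0 d (T : measurableType d) (mu : {measure set T -> \bar R})
    (I : Type) (r : seq I) (w : I -> T -> R) :
  (forall i, mu.-integrable setT (EFin \o w i)) ->
  (forall i, \int[mu]_x (w i x)%:E = 0)%E ->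
  mu.-integrable setT (fun x => (\sum_(i <- r) w i x)%:E) /\
  (\int[mu]_x (\sum_(i <- r) w i x)%:E = 0)%E.
Proof.
move=> iw w0; elim: r => [|i r [IH1 IH2]].
  under eq_fun do rewrite big_nil.
  by split; [exact: integrable0|exact: integral0].
have E : (fun x => (\sum_(j <- i :: r) w j x)%:E) =
   (fun x => (w i x)%:E + (\sum_(j <- r) w j x)%:E)%E.
  by apply/funext => x; rewrite big_cons EFinD.
rewrite E; split; first exact: (integrableD measurableT (iw i) IH1).
by rewrite (integralD measurableT (iw i) IH1) w0 IH2 adde0.
Qed.

Lemma is_derive_mul (V : normedModType R) (f g : V -> R) x v df dg :
  is_derive x v f df -> is_derive x v g dg ->
  is_derive x v (fun z => f z * g z) (f x * dg + df * g x).
Proof.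
move=> hf hg; rewrite [df * _]mulrC.
exact: (is_deriveM hf hg).
Qed.

(** This is the source called [f] in the names of the hypotheses and lemmas below. *)
Definition heat_op n (u : 'rV[R]_n -> R -> R) y s := pdt u y s - laplacian u y s.

Lemma C21_jcont n T (u : 'rV[R]_n -> R -> R) y s : C21 T u -> 0 < s < T ->
  jcont u y s.
Proof. by move=> Cu /(Cu y) [_ _ _ []]. Qed.

Lemma jcont_heat_op n T (u : 'rV[R]_n -> R -> R) y s : C21 T u -> 0 < s < T ->
  jcont (heat_op u) y s.
Proof.
move=> Cu /(Cu y) [_ _ _ [_ ct] cx]; apply: jcontB => //.
by apply: jcont_sum => i; case: (cx i).
Qed.

(** The difference [psi Delta u - u Delta psi] is the divergence of a field with bounded support,
    hence integrates to 0. The derivatives of [psi] are given as data; they are two-sided in time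
    even at [s1], so that a kernel with pole at time [T] is admissible only for [s1 < T]. *)
Lemma green_identity n T (u psi psit : 'rV[R]_n -> R -> R)
    (psii psiii : 'I_n -> 'rV[R]_n -> R -> R) (L s0 s1 : R) :
  C21 T u -> 0 < L -> 0 < s0 -> s0 < s1 -> s1 < T ->
  (forall y s, s0 <= s <= s1 -> is_derive s 1 (psi y) (psit y s)) ->
  (forall i y s, s0 <= s <= s1 ->
    is_derive y (unitv R i) (fun z => psi z s) (psii i y s)) ->
  (forall i y s, s0 <= s <= s1 ->
    is_derive y (unitv R i) (fun z => psii i z s) (psiii i y s)) ->
  (forall y s, s0 <= s <= s1 ->
    [/\ jcont psi y s, jcont psit y s & forall i, jcont (psiii i) y s]) ->
  (forall y s, s0 <= s <= s1 -> L < `|y| -> psi y s = 0 /\ psit y s = 0) ->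
  (\int[lebesgue_rv n]_y (u y s1 * psi y s1)%:E =
   \int[lebesgue_rv n]_y (u y s0 * psi y s0)%:E +
    \int[leb]_(s in `[s0, s1]) \int[lebesgue_rv n]_y
      (psi y s * heat_op u y s + u y s * (psit y s + \sum_(i < n) psiii i y s))%:E)%E.
Proof.
move=> Cu L0 s0_gt0 s01 s1T dt dx dxx cpsi sp.
have st s : s0 <= s <= s1 -> 0 < s < T.
  by case/andP => h1 h2; rewrite (lt_le_trans s0_gt0) //= (le_lt_trans h2).
have hd y s : s0 <= s <= s1 -> is_derive s 1 (fun s => u y s * psi y s)
    (u y s * psit y s + pdt u y s * psi y s).
  move=> hs; apply: is_derive_mul; last exact: dt.
  by case: (Cu y s (st s hs)) => h _ _ _ _; exact: derivableP.
have hc y s : s0 <= s <= s1 -> jcont (fun y s => u y s * psi y s) y s.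
  by move=> hs; case: (cpsi y s hs) => ? _ _; apply: jcontM => //; exact: C21_jcont (st s hs).
have hct y s : s0 <= s <= s1 ->
    jcont (fun y s => u y s * psit y s + pdt u y s * psi y s) y s.
  move=> hs; case: (cpsi y s hs) => ? ? _.
  case: (Cu y s (st s hs)) => _ _ _ [? ?] _.
  by apply: jcontD; apply: jcontM.
have hs0 y s : s0 <= s <= s1 -> L < `|y| -> u y s * psi y s = 0.
  by move=> hs yL; rewrite (sp y s hs yL).1 mulr0.
have hst0 y s : s0 <= s <= s1 -> L < `|y| -> u y s * psit y s + pdt u y s * psi y s = 0.
  by move=> hs yL; case: (sp y s hs yL) => -> ->; rewrite !mulr0 addr0.
have -> := integral_time_derivative L0 s01 hd hc hct hs0 hst0.
congr (_ + _)%E; apply: eq_integral => s; rewrite inE /= in_itv /= => hs.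
have sT := st s hs.
(* The [i]-th part of the divergence: the products of first derivatives cancel between its two
   terms. *)
pose w (i : 'I_n) y := psi y s * pdx i (pdx i u) y s - u y s * psiii i y s.
have sps y : L < `|y| -> psi y s = 0 by move=> /(sp y s hs) [].
have s1' i := derivative_support (fun y => dx i y s hs) sps.
have s2' i := derivative_support (fun y => dxx i y s hs) (s1' i).
have cw i : continuous (w i).
  move=> y; apply: (@jcont_space _ n
    (fun y s => psi y s * pdx i (pdx i u) y s - u y s * psiii i y s)).
  case: (cpsi y s hs) => ? _ ?; case: (Cu y s sT) => _ _ _ [? ?] cx.
  by apply: jcontB; apply: jcontM => //; case: (cx i).
have w0 i y : L < `|y| -> w i y = 0.
  by move=> yL; rewrite /w sps // (s2' i y yL) mul0r mulr0 subrr.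
have iw i := integrable_csupport L0 (cw i) (w0 i).
have dw i y : is_derive y (unitv R i)
    (fun z => psi z s * pdx i u z s - u z s * psii i z s) (w i y).
  case: (Cu y s sT) => _ d1 d2 _ _.
  have e1 := is_derive_mul (dx i y s hs) (derivableP (d2 i i)).
  have e2 := is_derive_mul (derivableP (d1 i)) (dxx i y s hs).
  rewrite (_ : w i y = (psi y s * pdx i (pdx i u) y s + psii i y s * pdx i u y s) -
    (u y s * psiii i y s + pdx i u y s * psii i y s)); first exact: (is_deriveB e1 e2).
  by rewrite /w; ring.
have wint i : (\int[lebesgue_rv n]_y (w i y)%:E = 0)%E.
  apply: (integral_partial0 L0 (dw i) (cw i)) => y yL.
  by rewrite sps // (s1' i y yL) mul0r mulr0 subrr.
have [isum sum0] := integral_sum0 (index_enum 'I_n) iw wint.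
have iG : (lebesgue_rv n).-integrable setT (fun y =>
    (psi y s * heat_op u y s + u y s * (psit y s + \sum_(i < n) psiii i y s))%:E).
  apply: (@integrable_slice _ _ (fun y s => psi y s * heat_op u y s +
     u y s * (psit y s + \sum_(i < n) psiii i y s)) L s) => //.
    move=> y; case: (cpsi y s hs) => ? ? ?.
    apply: jcontD; apply: jcontM => //; first exact: jcont_heat_op sT.
      exact: C21_jcont sT.
    by apply: jcontD => //; exact: jcont_sum.
  move=> y yL; case: (sp y s hs yL) => -> ->.
  by rewrite big1 ?mul0r ?addr0 ?mulr0 ?addr0 // => i _; exact: s2'.
rewrite -[RHS]adde0 -sum0 -integralD //; apply: eq_integral => y _.
rewrite -EFinD; congr EFin; rewrite /heat_op /laplacian /w sumrB -!mulr_sumr.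
by ring.
Qed.

End green_identity.

(** * Powers of the positive part and radial functions *)

Section test_function.
Context {R : realType}.

Definition pos (a : R) : R := Num.max 0 a.

Lemma pos_ge0 a : 0 <= pos a. Proof. by rewrite /pos le_max lexx. Qed.

Lemma pos_id a : 0 <= a -> pos a = a. Proof. by move=> a0; rewrite /pos max_r. Qed.

Lemma pos_eq0 a : a <= 0 -> pos a = 0. Proof. by move=> a0; rewrite /pos max_l. Qed.

Lemma pos_norm a : `|pos a| <= `|a|.
Proof.
have [a0|/ltW a0] := leP 0 a; first by rewrite pos_id.
by rewrite pos_eq0 // normr0.
Qed.

Lemma continuous_pos : continuous pos.
Proof.
move=> a; rewrite /pos.
by apply: (@continuous_max _ _ (cst 0) id) => //; exact: cvg_cst.
Qed.

(** Away from 0 the function is locally 0 or a power. At 0 one factor of [pos h] pays for the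
    division by [h], a second one, present since [k > 0], tends to 0, and the others are at most
    1. *)
Lemma is_derive_posX k (a : R) : (0 < k)%N ->
  is_derive a 1 (fun r => pos r ^+ k.+1) (k.+1%:R * pos a ^+ k).
Proof.
move=> k0; have [a0|a0|a0] := ltgtP a 0.
- rewrite pos_eq0 ?(ltW a0) // expr0n (gtn_eqF k0) mulr0.
  apply: (@near_eq_is_derive _ _ _ (cst 0)).
  near=> r; rewrite pos_eq0 ?expr0n //; apply/ltW.
  by near: r; exact: lt_nbhsl.
- rewrite pos_id ?(ltW a0) //.
  have dX : is_derive a 1 (fun r : R => r ^+ k.+1) (k.+1%:R * a ^+ k).
    split; first exact: exprn_derivable.
    by rewrite exp_derive /GRing.scale /= mulr1.
  apply: near_eq_is_derive dX.
  near=> r; rewrite pos_id //; apply/ltW.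
  by near: r; exact: lt_nbhsr.
- rewrite a0 pos_eq0 // expr0n (gtn_eqF k0) mulr0.
  have h : h^-1 *: (((fun r => pos r ^+ k.+1) \o shift 0) (h *: 1) - pos 0 ^+ k.+1)
      @[h --> (0 : R)^'] --> (0 : R).
    apply/cvgrPdist_le => e e0; near=> h.
    rewrite pos_eq0 // expr0n subr0 sub0r normrN /= addr0 [h *: 1]mulr1.
    have hn0 : 0 < `|h| by rewrite normr_gt0; near: h; exact: nbhs_dnbhs_neq.
    rewrite /GRing.scale /= normrM normfV mulrC ler_pdivrMr // normrX.
    have h1 : `|pos h| <= 1.
      apply: (le_trans (pos_norm h)); near: h; apply: dnbhs0_le; exact: ltr01.
    have h2 : `|pos h| <= e.
      apply: (le_trans (pos_norm h)); near: h; exact: dnbhs0_le.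
    rewrite exprS mulrC ler_pM ?exprn_ge0 ?pos_norm //.
    case: k k0 => // k _.
    by rewrite exprS -[e]mulr1 ler_pM ?exprn_ge0 ?exprn_ile1.
  split; first by apply/cvg_ex; exists 0.
  exact: cvg_lim.
Unshelve. all: by end_near. Qed.

Lemma jcont_comp n (F : R -> R) (g : 'rV[R]_n -> R -> R) y s :
  {for g y s, continuous F} -> jcont g y s -> jcont (fun z t => F (g z t)) y s.
Proof. by move=> cF cg; exact: (cvg_comp _ _ cg cF). Qed.

Lemma jcont_cst n (c : R) (y : 'rV[R]_n) s : jcont (fun _ _ => c) y s.
Proof. exact: cvg_cst. Qed.

Lemma jcont_coord n i (y : 'rV[R]_n) s : jcont (fun z _ => z ord0 i) y s.
Proof. by apply: jcont_const; exact: coord_continuous. Qed.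

Lemma jcont_timevar n (y : 'rV[R]_n) s : jcont (fun _ t => t) y s.
Proof. exact: cvg_snd. Qed.

Lemma jcontX n k (g : 'rV[R]_n -> R -> R) y s :
  jcont g y s -> jcont (fun z t => g z t ^+ k) y s.
Proof. by move=> cg; apply: (jcont_comp (F := fun r => r ^+ k)) => //; exact: exprn_continuous. Qed.

Lemma jcont_sqnormB n (x : 'rV[R]_n) y s : jcont (fun z _ => sqnorm (z - x)) y s.
Proof.
rewrite (_ : (fun z _ => _) = (fun (z : 'rV[R]_n) (_ : R) =>
    \sum_(i < n) (z ord0 i - x ord0 i) ^+ 2)); last first.
  by apply/funext => z; apply/funext => t; apply: eq_bigr => i _; rewrite rvBE.
apply: jcont_sum => i; apply: jcontX; apply: jcontB; last exact: jcont_cst.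
exact: jcont_coord.
Qed.

Lemma norm_sqr_le_sqnorm n (x : 'rV[R]_n) : `|x| ^+ 2 <= sqnorm x.
Proof.
have h : `|x| <= Num.sqrt (sqnorm x).
  apply: rv_norm_leP => [i|]; last exact: sqrtr_ge0.
  by rewrite -sqrtr_sqr ler_wsqrtr // coord_sqr_le_sqnorm.
rewrite -[leRHS](sqr_sqrtr (sqnorm_ge0 x)).
by rewrite lerXn2r // nnegrE ?sqrtr_ge0.
Qed.

Lemma is_derive_add (V : normedModType R) (f g : V -> R) x v df dg :
  is_derive x v f df -> is_derive x v g dg ->
  is_derive x v (fun z => f z + g z) (df + dg).
Proof. by move=> hf hg; exact: (is_deriveD hf hg). Qed.

Lemma is_derive_const (V : normedModType R) (c : R) (x v : V) :
  is_derive x v (fun=> c) 0.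
Proof. exact: is_derive_cst. Qed.

Lemma is_derive_var (x : R) : is_derive x 1 (fun r : R => r) 1.
Proof. exact: is_derive_id. Qed.

(** Along a coordinate line the squared distance is an explicit quadratic polynomial in the
    parameter, so the chain rule in one variable suffices. *)
Lemma is_derive_radial n (x y : 'rV[R]_n) i (F : R -> R) d :
  is_derive (sqnorm (y - x)) 1 F d ->
  is_derive y (unitv R i) (fun z => F (sqnorm (z - x))) (d * (2 * (y ord0 i - x ord0 i))).
Proof.
move=> dF; set q := sqnorm (y - x); set zi := y ord0 i - x ord0 i.
pose p (h : R) := q + (2 * zi * h + h * h).
have qE h : sqnorm (h *: unitv R i + y - x) = p h.
  rewrite /p /q /sqnorm (bigD1 i) //= [X in _ = X + _](bigD1 i) //=.
  rewrite !rvBE rvE unitvE eqxx mulr1 -/zi.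
  rewrite (eq_bigr (fun j => ((y - x) ord0 j) ^+ 2)); last first.
    by move=> j ji; rewrite !rvBE rvE unitvE (negbTE ji) mulr0 add0r.
  by rewrite /zi; ring.
have dp : is_derive (0 : R) 1 p (2 * zi).
  have i1 := is_derive_var 0.
  have H := is_derive_add (is_derive_const q (0 : R) 1)
    (is_derive_add (is_derive_mul (is_derive_const (2 * zi) (0 : R) 1) i1)
       (is_derive_mul i1 i1)).
  by apply: (is_derive_eq H); ring.
have p0 : p 0 = q by rewrite /p; ring.
have dF' : is_derive (p 0) 1 F d by rewrite p0.
have := is_derive1_comp dF' dp.
apply: is_derive_line => h /=; rewrite qE; congr (F (p _)).
by rewrite [h *: 1]mulr1 addr0.
Qed.

Lemma is_derive_coordB n (x y : 'rV[R]_n) i :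
  is_derive y (unitv R i) (fun z => z ord0 i - x ord0 i) 1.
Proof.
have := is_derive_add (is_derive_var 0) (is_derive_const (y ord0 i - x ord0 i) (0 : R) 1).
rewrite addr0; apply: is_derive_line => h /=.
rewrite rvE unitvE eqxx mulr1 [h *: 1]mulr1 addr0 addrA //.
Qed.

End test_function.

(** * The test function and its image under the backward heat operator *)

Section representation.
Context {R : realType}.
Local Notation leb := (@lebesgue_measure R).

(** For [m = n/2] and [q] the squared distance, this is the heat kernel up to the factor
    [(4 pi)^(-n/2)]; larger exponents serve the monotonicity of the mass. *)
Definition gk (m tau q : R) : R := tau `^ (- m) * expR (- (q / (4 * tau))).

Lemma gk_ge0 m tau q : 0 <= gk m tau q.
Proof. by rewrite mulr_ge0 ?powR_ge0 ?expR_ge0. Qed.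

Lemma is_derive_gk_time (m T q s : R) : s < T ->
  is_derive s 1 (fun s => gk m (T - s) q)
    (gk m (T - s) q * (m / (T - s) - q / (4 * (T - s) ^+ 2))).
Proof.
move=> sT; have tau0 : 0 < T - s by rewrite subr_gt0.
have tn0 : T - s != 0 by rewrite gt_eqF.
have dtau : is_derive s 1 (fun s => T - s) (- 1).
  have H := is_derive_add (is_derive_const T s 1)
    (is_derive_mul (is_derive_const (- 1) s 1) (is_derive_var s)).
  rewrite (_ : (fun s => T - s) = (fun s => T + - 1 * s)); last first.
    by apply/funext => r; rewrite mulN1r.
  by apply: (is_derive_eq H); ring.
have dp := is_derive1_comp (g := fun s => T - s) (is_derive1_powR (- m) tau0) dtau.
have tn4 : 4 * (T - s) != 0 by rewrite mulf_neq0 // pnatr_eq0.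
have dinv := is_deriveV (f := fun s => 4 * (T - s)) tn4 (is_derive_mul (is_derive_const 4 s 1) dtau).
have dq := is_derive_mul (is_derive_const (- q) s 1) dinv.
have de := is_derive1_comp (g := fun z => - q * (4 * (T - z))^-1) (is_derive_expR _) dq.
have H := is_derive_mul dp de.
rewrite (_ : (fun s => gk m (T - s) q) = (fun z =>
  (((@powR R)^~ (- m) \o (fun s => T - s)) z *
    (expR \o (fun z => - q * (4 * (T - z))^-1)) z))); last first.
  by apply/funext => r; rewrite /gk /= mulNr.
apply: (is_derive_eq H) => /=.
have -> : (T - s) `^ (- m - 1) = (T - s) `^ (- m) / (T - s).
  rewrite powRB; [by rewrite powRr1 // ltW|by rewrite (negbTE tn0) implybT].
rewrite /gk -mulNr; rewrite /GRing.scale /=.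
by field.
Qed.

Definition testfun n (x : 'rV[R]_n) (b T m : R) (y : 'rV[R]_n) (s : R) : R :=
  pos (b - sqnorm (y - x)) ^+ 3 * gk m (T - s) (sqnorm (y - x)).

Lemma is_derive_gk m (tau r : R) : 0 < tau ->
  is_derive r 1 (gk m tau) (- (gk m tau r / (4 * tau))).
Proof.
move=> tau0.
have d1 := is_derive_mul (is_derive_const (- (4 * tau)^-1) r 1) (is_derive_var r).
have de := is_derive1_comp (g := fun z => - (4 * tau)^-1 * z) (is_derive_expR _) d1.
have H := is_derive_mul (is_derive_const (tau `^ (- m)) r 1) de.
rewrite (_ : gk m tau = (fun z =>
  (tau `^ (- m) * (expR \o (fun z => - (4 * tau)^-1 * z)) z))); last first.
  by apply/funext => q; rewrite /gk /= mulNr mulrC [X in - X]mulrC mulrC.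
by apply: (is_derive_eq H) => /=; ring.
Qed.

Lemma is_derive_posB k (b r : R) : (0 < k)%N ->
  is_derive r 1 (fun r => pos (b - r) ^+ k.+1) (- (k.+1%:R * pos (b - r) ^+ k)).
Proof.
move=> k0.
have d1 : is_derive r 1 (fun r => b - r) (- 1).
  have H := is_derive_add (is_derive_const b r 1)
    (is_derive_mul (is_derive_const (- 1) r 1) (is_derive_var r)).
  rewrite (_ : (fun r => b - r) = (fun r => b + - 1 * r)); last first.
    by apply/funext => q; rewrite mulN1r.
  by apply: (is_derive_eq H); ring.
have H := is_derive1_comp (g := fun r => b - r) (is_derive_posX _ k0) d1.
by apply: (is_derive_eq H); ring.
Qed.

(** If [phi] is the radial profile of [testfun] at fixed [tau], as a function of the squared
    distance, this is [2 phi'], and [testfun_hess] is [2 phi'']. *)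
Definition testfun_grad (b m tau r : R) : R :=
  (- (6 * pos (b - r) ^+ 2) - pos (b - r) ^+ 3 / (2 * tau)) * gk m tau r.

Definition testfun_hess (b m tau r : R) : R :=
  (12 * pos (b - r) + 3 * pos (b - r) ^+ 2 / tau + pos (b - r) ^+ 3 / (8 * tau ^+ 2))
  * gk m tau r.

Lemma is_derive_testfun n (x : 'rV[R]_n) (b T m : R) i (y : 'rV[R]_n) (s : R) : s < T ->
  is_derive y (unitv R i) (fun z => testfun x b T m z s)
    ((y ord0 i - x ord0 i) * testfun_grad b m (T - s) (sqnorm (y - x))).
Proof.
move=> sT; have tau0 : 0 < T - s by rewrite subr_gt0.
have tn0 : T - s != 0 by rewrite gt_eqF.
set q := sqnorm (y - x).
have H := is_derive_radial i (is_derive_mul (is_derive_posB (k := 2) b q isT) (is_derive_gk m q tau0)).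
by apply: (is_derive_eq H); rewrite /testfun_grad -/q; field.
Qed.

Lemma is_derive_testfun_grad n (x : 'rV[R]_n) (b T m : R) i (y : 'rV[R]_n) (s : R) : s < T ->
  is_derive y (unitv R i)
    (fun z => (z ord0 i - x ord0 i) * testfun_grad b m (T - s) (sqnorm (z - x)))
    (testfun_grad b m (T - s) (sqnorm (y - x)) +
     2 * (y ord0 i - x ord0 i) ^+ 2 * testfun_hess b m (T - s) (sqnorm (y - x))).
Proof.
move=> sT; have tau0 : 0 < T - s by rewrite subr_gt0.
have tn0 : T - s != 0 by rewrite gt_eqF.
set q := sqnorm (y - x).
have d2 := is_derive_mul (is_derive_const (- 6) q 1) (is_derive_posB (k := 1) b q isT).
have d3 := is_derive_mul (is_derive_const (- (2 * (T - s))^-1) q 1) (is_derive_posB (k := 2) b q isT).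
have H := is_derive_mul (is_derive_coordB x y i)
  (is_derive_radial i (is_derive_mul (is_derive_add d2 d3) (is_derive_gk m q tau0))).
rewrite (_ : (fun z => _ * testfun_grad _ _ _ _) = (fun z : 'rV[R]_n => (z ord0 i - x ord0 i) *
  ((- 6 * pos (b - sqnorm (z - x)) ^+ 2 +
    - (2 * (T - s))^-1 * pos (b - sqnorm (z - x)) ^+ 3) * gk m (T - s) (sqnorm (z - x))))); last first.
  by apply/funext => z; rewrite /testfun_grad; congr (_ * (_ * _)); field.
apply: (is_derive_eq H); rewrite /testfun_grad /testfun_hess -/q.
by rewrite expr1; field.
Qed.

Lemma is_derive_testfun_time n (x : 'rV[R]_n) (b T m : R) (y : 'rV[R]_n) (s : R) : s < T ->
  is_derive s 1 (testfun x b T m y)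
   (pos (b - sqnorm (y - x)) ^+ 3 * (gk m (T - s) (sqnorm (y - x)) *
      (m / (T - s) - sqnorm (y - x) / (4 * (T - s) ^+ 2)))).
Proof.
move=> sT.
have H := is_derive_mul (is_derive_const (pos (b - sqnorm (y - x)) ^+ 3) s 1)
  (is_derive_gk_time m (sqnorm (y - x)) sT).
by apply: (is_derive_eq H); ring.
Qed.

Lemma jcont_pos n (x : 'rV[R]_n) b y s : jcont (fun z _ => pos (b - sqnorm (z - x))) y s.
Proof.
apply: jcont_comp; first exact: continuous_pos.
by apply: jcontB; [exact: jcont_cst|exact: jcont_sqnormB].
Qed.

Lemma jcont_inv n (g : 'rV[R]_n -> R -> R) y s : g y s != 0 -> jcont g y s ->
  jcont (fun z t => (g z t)^-1) y s.
Proof. by move=> g0; apply: (jcont_comp (F := GRing.inv)); exact: inv_continuous. Qed.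

Lemma jcont_tau n T (y : 'rV[R]_n) s : jcont (fun _ t => T - t) y s.
Proof. by apply: jcontB; [exact: jcont_cst|exact: jcont_timevar]. Qed.

Lemma jcont_gk n (x : 'rV[R]_n) (T m : R) (y : 'rV[R]_n) (s : R) : s < T ->
  jcont (fun z t => gk m (T - t) (sqnorm (z - x))) y s.
Proof.
move=> sT; have tau0 : 0 < T - s by rewrite subr_gt0.
apply: jcontM.
  apply: (jcont_comp (F := (@powR R)^~ (- m))); last exact: jcont_tau.
  apply: differentiable_continuous; apply/derivable1_diffP.
  by case: (is_derive1_powR (- m) tau0).
apply: jcont_comp; first exact: continuous_expR.
apply: jcontN; apply: jcontM; first exact: jcont_sqnormB.
apply: jcont_inv; first by rewrite mulf_neq0 // ?pnatr_eq0 // gt_eqF.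
by apply: jcontM; [exact: jcont_cst|exact: jcont_tau].
Qed.

(* What the backward heat operator [d/ds + Delta] leaves of [testfun]. *)
Definition testfun_remainder n (b m tau r : R) : R :=
  gk m tau r * ((m - n%:R / 2) / tau * pos (b - r) ^+ 3 +
    6 * r * pos (b - r) ^+ 2 / tau + 24 * r * pos (b - r) - 6 * n%:R * pos (b - r) ^+ 2).

(** With [p = pos (b - q)], the terms in [q p^3 / tau^2] from the time derivative and from the
    Laplacian cancel, as for the heat kernel itself, and [p^3 / tau] keeps the coefficient
    [m - n/2]. All other terms come from derivatives of the truncation. *)
Lemma testfun_heat n (x : 'rV[R]_n) (b T m : R) (y : 'rV[R]_n) (s : R) : s < T ->
  pos (b - sqnorm (y - x)) ^+ 3 * (gk m (T - s) (sqnorm (y - x)) *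
      (m / (T - s) - sqnorm (y - x) / (4 * (T - s) ^+ 2))) +
  \sum_(i < n) (testfun_grad b m (T - s) (sqnorm (y - x)) +
     2 * (y ord0 i - x ord0 i) ^+ 2 * testfun_hess b m (T - s) (sqnorm (y - x))) =
  testfun_remainder n b m (T - s) (sqnorm (y - x)).
Proof.
move=> sT; have tn0 : T - s != 0 by rewrite gt_eqF // subr_gt0.
have qE : \sum_(i < n) (y ord0 i - x ord0 i) ^+ 2 = sqnorm (y - x).
  by apply: eq_bigr => i _; rewrite rvBE.
rewrite big_split /= sumr_const card_ord -mulr_suml -mulr_sumr qE -mulr_natl.
rewrite /testfun_grad /testfun_hess /testfun_remainder; set q := sqnorm _.
by field.
Qed.

(** A crude radius in the maximum norm: beyond it the distance to [x] is at least [b + 1], whose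
    square exceeds [b], so no square root of [b] is needed. *)
Lemma testfun_support n (x : 'rV[R]_n) (b : R) (y : 'rV[R]_n) : 0 < b ->
  `|x| + b + 1 < `|y| -> pos (b - sqnorm (y - x)) = 0.
Proof.
move=> b0 hy; apply: pos_eq0; rewrite subr_le0.
apply: le_trans (norm_sqr_le_sqnorm _).
have h : b + 1 <= `|y - x|.
  by have := ler_normD (y - x) x; rewrite subrK; lra.
apply: (@le_trans _ _ ((b + 1) ^+ 2)); first by nra.
by rewrite lerXn2r // nnegrE; lra.
Qed.

Lemma testfun_green n (u : 'rV[R]_n -> R -> R) (x : 'rV[R]_n) (b T m s0 s1 T0 : R) :
  C21 T0 u -> 0 < b -> 0 < s0 -> s0 < s1 -> s1 < T0 -> s1 < T ->
  (\int[lebesgue_rv n]_y (u y s1 * testfun x b T m y s1)%:E =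
   \int[lebesgue_rv n]_y (u y s0 * testfun x b T m y s0)%:E +
    \int[leb]_(s in `[s0, s1]) \int[lebesgue_rv n]_y
      (testfun x b T m y s * heat_op u y s +
       u y s * testfun_remainder n b m (T - s) (sqnorm (y - x)))%:E)%E.
Proof.
move=> Cu b0 s0_gt0 s01 s1T0 s1T.
have sT s : s0 <= s <= s1 -> s < T by case/andP => _ h; exact: le_lt_trans h s1T.
have L0 : 0 < `|x| + b + 1 by rewrite !ltr_wpDl // addr_ge0 // ltW.
have -> := green_identity (psi := testfun x b T m) (L := `|x| + b + 1)
  (psit := fun y s => pos (b - sqnorm (y - x)) ^+ 3 * (gk m (T - s) (sqnorm (y - x)) *
      (m / (T - s) - sqnorm (y - x) / (4 * (T - s) ^+ 2))))
  (psii := fun i y s => (y ord0 i - x ord0 i) * testfun_grad b m (T - s) (sqnorm (y - x)))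
  (psiii := fun i y s => testfun_grad b m (T - s) (sqnorm (y - x)) +
     2 * (y ord0 i - x ord0 i) ^+ 2 * testfun_hess b m (T - s) (sqnorm (y - x)))
  Cu L0 s0_gt0 s01 s1T0 (fun y s hs => is_derive_testfun_time x b m y (sT s hs))
  (fun i y s hs => is_derive_testfun x b m i y (sT s hs))
  (fun i y s hs => is_derive_testfun_grad x b m i y (sT s hs)).
- congr (_ + _)%E; apply: eq_integral => s; rewrite inE /= in_itv /= => hs.
  by apply: eq_integral => y _; rewrite testfun_heat // sT.
- move=> y s hs; have tn0 : T - s != 0 by rewrite gt_eqF // subr_gt0 sT.
  have c2 : jcont (fun _ t => (T - t) ^+ 2) y s by apply: jcontX; exact: jcont_tau.
  have cq : jcont (fun z _ => sqnorm (z - x)) y s by exact: jcont_sqnormB.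
  have cg : jcont (fun z t => gk m (T - t) (sqnorm (z - x))) y s by apply: jcont_gk; exact: sT.
  have cp k : jcont (fun z _ => pos (b - sqnorm (z - x)) ^+ k) y s.
    by apply: jcontX; exact: jcont_pos.
  have cc c : jcont (fun _ _ => c) y s by exact: jcont_cst.
  have ct : jcont (fun _ t => T - t) y s by exact: jcont_tau.
  have cct c : jcont (fun _ t => c * (T - t)) y s by exact: jcontM.
  split.
  + exact: jcontM.
  + apply: jcontM => //; apply: jcontM => //; apply: jcontB.
      by apply: jcontM => //; exact: jcont_inv.
    apply: jcontM => //; apply: jcont_inv; last exact: jcontM.
    by rewrite mulf_neq0 // ?pnatr_eq0 // expf_neq0.
  + move=> i; apply: jcontD.
      apply: jcontM => //; apply: jcontB.
        by apply: jcontN; exact: jcontM.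
      by apply: jcontM => //; apply: jcont_inv => //; rewrite mulf_neq0 // pnatr_eq0.
    apply: jcontM.
      apply: jcontM => //; apply: jcontX; apply: jcontB => //; exact: jcont_coord.
    apply: jcontM => //; apply: jcontD; first apply: jcontD.
    * by apply: jcontM => //; exact: jcont_pos.
    * by apply: jcontM; [exact: jcontM|exact: jcont_inv].
    * apply: jcontM => //; apply: jcont_inv; last exact: jcontM.
      by rewrite mulf_neq0 // ?pnatr_eq0 // expf_neq0.
- move=> y s _ yL; rewrite /testfun testfun_support //.
  by rewrite expr0n /= !mul0r.
Qed.

End representation.

(** * Majorants of the test function for [m = n/2] *)

Section green_inequality.
Context {R : realType} {n : nat}.
Local Notation leb := (@lebesgue_measure R).
Local Notation mR := (measurableTypeR R).
Local Notation rv := (@lebesgue_rv R n).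
Local Notation st := (leb \x rv)%E.

(** The type places real intervals in the measurable copy of [R]; time comes first, as the outer
    variable of [int_strip]. *)
Definition tbox (A : set R) (B : set 'rV[R]_n) : set (mR * 'rV[R]_n) := A `*` B.

Lemma measurable_tbox (A : set mR) (B : set 'rV[R]_n) :
  measurable A -> measurable B -> measurable (tbox A B).
Proof. exact: measurableX. Qed.

Lemma slab_integrable (g : 'rV[R]_n -> R -> R) (L s0 s1 : R) :
  0 < L -> (forall y s, s0 <= s <= s1 -> jcont g y s) ->
  (forall y s, s0 <= s <= s1 -> L < `|y| -> g y s = 0) ->
  st.-integrable (tbox `[s0, s1] setT) (fun p => (g p.2 p.1)%:E).
Proof.
move=> L0 cg g0; apply/integrable_mkcond; first exact: measurable_tbox.
exact: (integrable_slab L0 cg g0).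
Qed.

Lemma integral_slabE (g : 'rV[R]_n -> R -> R) (L s0 s1 : R) :
  0 < L -> (forall y s, s0 <= s <= s1 -> jcont g y s) ->
  (forall y s, s0 <= s <= s1 -> L < `|y| -> g y s = 0) ->
  (\int[leb]_(s in `[s0, s1]) \int[rv]_y (g y s)%:E =
   \int[st]_(p in tbox `[s0, s1] setT) (g p.2 p.1)%:E)%E.
Proof.
move=> L0 cg g0; have gi := integrable_slab L0 cg g0.
rewrite [RHS]integral_mkcond -(integral12_prod_meas1 gi).
rewrite [LHS]integral_mkcond; apply: eq_integral => s _.
rewrite patchE /fubini_F; case: ifPn => hs.
  apply: eq_integral => y _; rewrite patchE /= mem_set //; split => //=.
  by move: hs; rewrite inE.
apply/esym/integral0_eq => y _; rewrite patchE memNset // => -[/= h _].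
by move/negP : hs; apply; rewrite inE.
Qed.

Lemma measurable_sqball (x : 'rV[R]_n) (b : R) :
  measurable [set y : 'rV[R]_n | sqnorm (y - x) < b].
Proof.
have : measurable_fun setT (fun y : 'rV[R]_n => sqnorm (y - x)).
  by apply: measurable_sqnormB => //; exact: measurable_id.
move=> /(_ measurableT _ (measurable_itv `]-oo, b[)); rewrite setTI.
by congr measurable; apply/seteqP; split => y /=; rewrite in_itv.
Qed.

Lemma measurable_sqcball (x : 'rV[R]_n) (b : R) :
  measurable [set y : 'rV[R]_n | sqnorm (y - x) <= b].
Proof.
have : measurable_fun setT (fun y : 'rV[R]_n => sqnorm (y - x)).
  by apply: measurable_sqnormB => //; exact: measurable_id.
move=> /(_ measurableT _ (measurable_itv `]-oo, b])); rewrite setTI.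
by congr measurable; apply/seteqP; split => y /=; rewrite in_itv.
Qed.

(* The exponent 4 of the heat kernel is relaxed to 8, which absorbs the factor
   [r / tau] appearing in [testfun_remainder]. *)
Definition gam (tau r : R) : R := tau `^ (- (n%:R / 2)) * expR (- (r / (8 * tau))).

Lemma gam_ge0 tau r : 0 <= gam tau r.
Proof. by rewrite mulr_ge0 ?powR_ge0 ?expR_ge0. Qed.

Lemma gam_le (tau r : R) : 0 < tau -> 0 <= r -> gam tau r <= tau `^ (- (n%:R / 2)).
Proof.
move=> t0 r0; rewrite /gam ler_piMr ?powR_ge0 // -expR0 ler_expR oppr_le0.
by rewrite divr_ge0 // mulr_ge0 // ltW.
Qed.

Lemma gk_le_gam (tau r : R) : 0 < tau -> 0 <= r -> gk (n%:R / 2) tau r <= gam tau r.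
Proof.
move=> t0 r0; rewrite ler_wpM2l ?powR_ge0 // ler_expR lerN2.
rewrite ler_wpM2l // lef_pV2 ?posrE ?mulr_gt0 // ler_wpM2r ?ltW //.
by rewrite ltr_nat.
Qed.

Lemma gk_ratio_le_gam (tau r : R) : 0 < tau -> 0 <= r ->
  r / tau * gk (n%:R / 2) tau r <= 8 * gam tau r.
Proof.
move=> t0 r0; rewrite /gk /gam mulrCA [leRHS]mulrCA ler_wpM2l ?powR_ge0 //.
(* The exponent of [gk] is [2 z]: one half pays for the factor [z] through [z exp(-z) <= 1], the
   other is the exponent of [gam]. *)
set z := r / (8 * tau).
have z0 : 0 <= z by rewrite divr_ge0 // mulr_ge0 // ltW.
have -> : r / tau = 8 * z by rewrite /z; field; rewrite gt_eqF.
have -> : r / (4 * tau) = z + z by rewrite /z; field; rewrite gt_eqF.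
rewrite opprD expRD -mulrA ler_pM2l //.
have : z * expR (- z) <= 1.
  rewrite expRN ler_pdivrMr ?expR_gt0 // mul1r.
  by apply: le_trans (expR_ge1Dx z); rewrite lerDr.
by move=> h; rewrite mulrA ler_piMl ?expR_ge0.
Qed.

(** The two positive terms of [testfun_remainder]: for [m = n/2] the coefficient of the cubic term
    is 0, and the last term has the favourable sign for an upper bound. *)
Definition ptestfun_remainder (b m tau r : R) : R :=
  gk m tau r * (6 * r * pos (b - r) ^+ 2 / tau + 24 * r * pos (b - r)).

Lemma testfun_remainder_le (b tau r : R) : 0 < tau ->
  testfun_remainder n b (n%:R / 2) tau r <= ptestfun_remainder b (n%:R / 2) tau r.
Proof.
move=> t0; rewrite ler_wpM2l ?gk_ge0 // subrr mul0r mul0r add0r gerBl.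
by rewrite mulr_ge0 ?mulr_ge0 ?exprn_ge0 ?pos_ge0.
Qed.

(** The constant is [72 = 6 * 8 + 24], the 8 coming from [gk_ratio_le_gam]. *)
Lemma ptestfun_remainder_le (b tau r : R) : 0 < tau -> 0 <= r -> r < b ->
  ptestfun_remainder b (n%:R / 2) tau r <= 72 * b ^+ 2 * gam tau r.
Proof.
move=> t0 r0 rb; rewrite /ptestfun_remainder.
have pE : pos (b - r) = b - r by rewrite pos_id // subr_ge0 ltW.
have h1 := gk_ratio_le_gam t0 r0; have h2 := gk_le_gam t0 r0.
have g0 := gk_ge0 (n%:R / 2) tau r; have G0 := gam_ge0 tau r.
have b0 : 0 < b by exact: le_lt_trans r0 rb.
set p := pos _ in pE *; have p0 : 0 <= p by rewrite pE subr_ge0 ltW.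
have pb : p <= b by rewrite pE gerBl.
have p2b : p ^+ 2 <= b ^+ 2 by rewrite lerXn2r // nnegrE ltW.
have -> : gk (n%:R / 2) tau r * (6 * r * p ^+ 2 / tau + 24 * r * p) =
  6 * p ^+ 2 * (r / tau * gk (n%:R / 2) tau r) + 24 * (r * p) * gk (n%:R / 2) tau r.
  by field; rewrite gt_eqF.
have e1 : 6 * p ^+ 2 * (r / tau * gk (n%:R / 2) tau r) <= 48 * b ^+ 2 * gam tau r.
  rewrite (_ : 48 * b ^+ 2 * gam tau r = 6 * b ^+ 2 * (8 * gam tau r)); last by ring.
  apply: (ler_pM _ _ _ h1).
  - by rewrite mulr_ge0 ?exprn_ge0.
  - by rewrite mulr_ge0 // divr_ge0 // ltW.
  - by rewrite ler_pM2l.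
have e2 : 24 * (r * p) * gk (n%:R / 2) tau r <= 24 * b ^+ 2 * gam tau r.
  apply: (ler_pM _ _ _ h2) => //; first by rewrite !mulr_ge0.
  by rewrite ler_pM2l // expr2; apply: ler_pM => //; exact: ltW.
by rewrite (_ : 72 * b ^+ 2 * gam tau r = 48 * b ^+ 2 * gam tau r + 24 * b ^+ 2 * gam tau r);
  [exact: lerD|ring].
Qed.

End green_inequality.

(** * The Green inequality for nonnegative supersolutions *)

Section supersolution.
Context {R : realType} {n : nat}.
Local Notation leb := (@lebesgue_measure R).
Local Notation rv := (@lebesgue_rv R n).
Local Notation st := (leb \x rv)%E.
Local Notation gam := (@gam R n).

Lemma jcont_gam (x : 'rV[R]_n) T y s : s < T ->
  jcont (fun z t => gam (T - t) (sqnorm (z - x))) y s.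
Proof.
move=> sT; have tau0 : 0 < T - s by rewrite subr_gt0.
apply: jcontM.
  apply: (jcont_comp (F := (@powR R)^~ (- (n%:R / 2)))); last exact: jcont_tau.
  apply: differentiable_continuous; apply/derivable1_diffP.
  by case: (is_derive1_powR (- (n%:R / 2)) tau0).
apply: jcont_comp; first exact: continuous_expR.
apply: jcontN; apply: jcontM; first exact: jcont_sqnormB.
apply: jcont_inv; first by rewrite mulf_neq0 // ?pnatr_eq0 // gt_eqF.
by apply: jcontM; [exact: jcont_cst|exact: jcont_tau].
Qed.

Lemma jcont_testfun (x : 'rV[R]_n) b T m y s : s < T -> jcont (testfun x b T m) y s.
Proof.
by move=> sT; apply: jcontM; [apply: jcontX; exact: jcont_pos|exact: jcont_gk].
Qed.

Lemma jcont_ptestfun_remainder (x : 'rV[R]_n) b T m y s : s < T ->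
  jcont (fun z t => ptestfun_remainder b m (T - t) (sqnorm (z - x))) y s.
Proof.
move=> sT; have tn0 : T - s != 0 by rewrite gt_eqF // subr_gt0.
have cq : jcont (fun z _ => sqnorm (z - x)) y s by exact: jcont_sqnormB.
have cc c : jcont (fun _ _ => c) y s by exact: jcont_cst.
have cp : jcont (fun z _ => pos (b - sqnorm (z - x))) y s by exact: jcont_pos.
apply: jcontM; first exact: jcont_gk.
apply: jcontD.
  apply: jcontM; last by apply: jcont_inv => //; exact: jcont_tau.
  by apply: jcontM; [exact: jcontM|exact: jcontX].
by apply: jcontM => //; exact: jcontM.
Qed.

Lemma jcont_testfun_remainder (x : 'rV[R]_n) b T m y s : s < T ->
  jcont (fun z t => testfun_remainder n b m (T - t) (sqnorm (z - x))) y s.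
Proof.
move=> sT; have tn0 : T - s != 0 by rewrite gt_eqF // subr_gt0.
have cq : jcont (fun z _ => sqnorm (z - x)) y s by exact: jcont_sqnormB.
have cc c : jcont (fun _ _ => c) y s by exact: jcont_cst.
have cp : jcont (fun z _ => pos (b - sqnorm (z - x))) y s by exact: jcont_pos.
have ct : jcont (fun _ t => (T - t)^-1) y s by apply: jcont_inv => //; exact: jcont_tau.
apply: jcontM; first exact: jcont_gk.
apply: jcontB; last by apply: jcontM => //; exact: jcontX.
apply: jcontD; last by apply: jcontM => //; exact: jcontM.
apply: jcontD; first by apply: jcontM; [exact: jcontM|exact: jcontX].
by apply: jcontM => //; apply: jcontM; [exact: jcontM|exact: jcontX].
Qed.

Lemma testfun_out (x : 'rV[R]_n) b T m y s : b <= sqnorm (y - x) -> testfun x b T m y s = 0.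
Proof. by move=> h; rewrite /testfun pos_eq0 ?subr_le0 // expr0n mul0r. Qed.

Lemma testfun_le (x : 'rV[R]_n) b T y s : 0 < b -> s < T ->
  testfun x b T (n%:R / 2) y s <= b ^+ 3 * gam (T - s) (sqnorm (y - x)).
Proof.
move=> b0 sT; have q0 := sqnorm_ge0 (y - x).
apply: ler_pM; rewrite ?exprn_ge0 ?pos_ge0 ?gk_ge0 //.
  rewrite lerXn2r // ?nnegrE ?pos_ge0 ?(ltW b0) //.
  by rewrite /pos ge_max (ltW b0) gerBl.
by apply: gk_le_gam => //; rewrite subr_gt0.
Qed.

Lemma testfun_ge0 (x : 'rV[R]_n) b T m y s : 0 <= testfun x b T m y s.
Proof. by rewrite mulr_ge0 ?exprn_ge0 ?pos_ge0 ?gk_ge0. Qed.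

Variable u : 'rV[R]_n -> R -> R.
Hypothesis Cu : C21 16 u.
Hypothesis u_ge0 : forall x t, 0 < t < 16 -> 0 <= u x t.
Hypothesis f_ge0 : forall x t, sqnorm x < 16 -> 0 < t < 16 -> 0 <= heat_op u x t.

Lemma integral_green_slab (x : 'rV[R]_n) (b T m s0 s1 : R) :
  0 < b -> 0 < s0 -> s0 < s1 -> s1 < 16 -> s1 < T ->
  (\int[rv]_y (u y s1 * testfun x b T m y s1)%:E =
   \int[rv]_y (u y s0 * testfun x b T m y s0)%:E +
    \int[st]_(p in tbox `[s0, s1] setT)
      (testfun x b T m p.2 p.1 * heat_op u p.2 p.1 +
       u p.2 p.1 * testfun_remainder n b m (T - p.1) (sqnorm (p.2 - x)))%:E)%E /\
  st.-integrable (tbox `[s0, s1] setT) (fun p =>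
      (testfun x b T m p.2 p.1 * heat_op u p.2 p.1 +
       u p.2 p.1 * testfun_remainder n b m (T - p.1) (sqnorm (p.2 - x)))%:E).
Proof.
move=> b0 s0_gt0 s01 s1T0 s1T.
have st16 s : s0 <= s <= s1 -> 0 < s < 16.
  by case/andP => h1 h2; rewrite (lt_le_trans s0_gt0) //= (le_lt_trans h2).
have sT s : s0 <= s <= s1 -> s < T by case/andP => _ h; exact: le_lt_trans h s1T.
have L0 : 0 < `|x| + b + 1 by rewrite !ltr_wpDl // addr_ge0 // ltW.
have cG y s : s0 <= s <= s1 -> jcont (fun y s => testfun x b T m y s * heat_op u y s +
       u y s * testfun_remainder n b m (T - s) (sqnorm (y - x))) y s.
  move=> hs; apply: jcontD; apply: jcontM.
  - exact/jcont_testfun/sT.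
  - exact: jcont_heat_op (st16 s hs).
  - exact: C21_jcont (st16 s hs).
  - exact/jcont_testfun_remainder/sT.
have G0 y s : s0 <= s <= s1 -> `|x| + b + 1 < `|y| -> testfun x b T m y s * heat_op u y s +
       u y s * testfun_remainder n b m (T - s) (sqnorm (y - x)) = 0.
  move=> hs yL; rewrite /testfun /testfun_remainder testfun_support //.
  by rewrite !expr0n /= !(mulr0, mul0r, addr0, subr0).
split; last exact: (slab_integrable L0 cG G0).
by rewrite (testfun_green x m Cu b0 s0_gt0 s01 s1T0 s1T) (integral_slabE L0 cG G0).
Qed.

(** Bounding the remainder from above uses [u >= 0]; bounding [testfun] in the source term uses
    [heat_op u >= 0], known in the ball of radius 4, whence the condition on the ball of squared
    radius [b]. The pole [T] stays free: [local_mass] puts it after [s1] by the squared radius of a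
    ball, [pole_ineq] puts it at the time where [u] is evaluated. *)
Lemma green_ineq (x : 'rV[R]_n) (b T s0 s1 : R) :
  0 < b -> (forall y, sqnorm (y - x) < b -> sqnorm y < 16) ->
  0 < s0 -> s0 < s1 -> s1 < 16 -> s1 < T ->
  (\int[rv]_y (u y s1 * testfun x b T (n%:R / 2) y s1)%:E <=
   \int[rv]_(y in [set y : 'rV[R]_n | (sqnorm (y - x) < b)%R])
     (b ^+ 3 * (gam (T - s0) (sqnorm (y - x)) * u y s0))%:E +
   \int[st]_(p in tbox `[s0, s1] [set y : 'rV[R]_n | (sqnorm (y - x) < b)%R])
     (gam (T - p.1) (sqnorm (p.2 - x)) *
       (b ^+ 3 * heat_op u p.2 p.1 + 72 * b ^+ 2 * u p.2 p.1))%:E)%E.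
Proof.
move=> b0 bB s0_gt0 s01 s1T0 s1T.
have st16 s : s0 <= s <= s1 -> 0 < s < 16.
  by case/andP => h1 h2; rewrite (lt_le_trans s0_gt0) //= (le_lt_trans h2).
have sT s : s0 <= s <= s1 -> s < T by case/andP => _ h; exact: le_lt_trans h s1T.
have L0 : 0 < `|x| + b + 1 by rewrite !ltr_wpDl // addr_ge0 // ltW.
have h00 : s0 <= s0 <= s1 by rewrite lexx ltW.
have [-> iG] := integral_green_slab x (n%:R / 2) b0 s0_gt0 s01 s1T0 s1T.
apply: leeD.
  rewrite [leRHS]integral_mkcond; apply: ge0_le_integral => //.
  - by move=> y _; rewrite lee_fin mulr_ge0 ?u_ge0 ?testfun_ge0 ?st16.
  - apply/measurable_EFinP; apply: (@measurable_slice _ _ (fun y s => u y s * testfun x b T (n%:R / 2) y s)) => y.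
    by apply: jcontM; [exact: C21_jcont (st16 _ h00)|exact/jcont_testfun/sT].
  - apply/(measurable_restrictT _ (measurable_sqball x b)).
    apply/measurable_EFinP; apply: measurable_funTS.
    apply: (@measurable_slice _ _ (fun y s => b ^+ 3 * (gam (T - s) (sqnorm (y - x)) * u y s))) => y.
    apply: jcontM; first exact: jcont_cst.
    by apply: jcontM; [exact/jcont_gam/sT|exact: C21_jcont (st16 _ h00)].
  - move=> y _; rewrite patchE; case: ifPn.
      rewrite inE /= => qb; rewrite lee_fin mulrC mulrA.
      by rewrite ler_wpM2r ?u_ge0 ?testfun_le ?st16 // sT.
    by rewrite notin_setE /= => /negP; rewrite -leNgt => /testfun_out ->; rewrite mulr0.
set H := fun y s => testfun x b T (n%:R / 2) y s * heat_op u y s +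
       u y s * ptestfun_remainder b (n%:R / 2) (T - s) (sqnorm (y - x)).
have cH y s : s0 <= s <= s1 -> jcont H y s.
  move=> hs; apply: jcontD; apply: jcontM.
  - exact/jcont_testfun/sT.
  - exact: jcont_heat_op (st16 s hs).
  - exact: C21_jcont (st16 s hs).
  - exact/jcont_ptestfun_remainder/sT.
have HE y s : b <= sqnorm (y - x) -> H y s = 0.
  move=> h; rewrite /H testfun_out // /ptestfun_remainder pos_eq0 ?subr_le0 //.
  by rewrite !expr0n /= !(mulr0, mul0r, addr0).
have H0 y s : s0 <= s <= s1 -> `|x| + b + 1 < `|y| -> H y s = 0.
  move=> hs yL; rewrite /H /testfun /ptestfun_remainder testfun_support //.
  by rewrite !expr0n /= !(mulr0, mul0r, addr0).
have Hge0 y s : s0 <= s <= s1 -> 0 <= H y s.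
  move=> hs; have [h|h] := leP b (sqnorm (y - x)); first by rewrite HE.
  rewrite addr_ge0 // mulr_ge0 ?testfun_ge0 ?u_ge0 ?f_ge0 ?st16 ?bB //.
  rewrite mulr_ge0 ?gk_ge0 // addr_ge0 // ?mulr_ge0 ?exprn_ge0 ?pos_ge0 ?sqnorm_ge0 //.
  by rewrite invr_ge0 subr_ge0 ltW // sT.
apply: (@le_trans _ _ (\int[st]_(p in tbox `[s0, s1] setT) (H p.2 p.1)%:E)%E).
  apply: le_integral => //.
  - exact: measurable_tbox.
  - exact: (slab_integrable L0 cH H0).
  - move=> [s y]; rewrite inE => -[/= hs _]; rewrite lee_fin /H lerD2l.
    rewrite in_itv /= in hs.
    by rewrite ler_wpM2l ?u_ge0 ?st16 // testfun_remainder_le // subr_gt0 sT.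
have mD : measurable (tbox `[s0, s1] [set y : 'rV[R]_n | sqnorm (y - x) < b]).
  by apply: measurable_tbox => //; exact: measurable_sqball.
rewrite integral_mkcond [leRHS]integral_mkcond; apply: ge0_le_integral => //.
- move=> [s y] _; rewrite patchE; case: ifPn => //; rewrite inE => -[/=].
  by rewrite in_itv /= lee_fin => hs _; exact: Hge0.
- have mT : measurable (tbox `[s0, s1] (setT : set 'rV[R]_n)) by exact: measurable_tbox.
  apply/(measurable_restrictT _ mT).
  apply/measurable_EFinP; apply: (@measurable_jcont _ _ H); first exact: measurable_tbox.
  by move=> s y [/=]; rewrite in_itv /= => /cH.
- apply/(measurable_restrictT _ mD).
  apply/measurable_EFinP; apply: (@measurable_jcont _ _ (fun y s => gam (T - s) (sqnorm (y - x)) *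
       (b ^+ 3 * heat_op u y s + 72 * b ^+ 2 * u y s))) => //.
  move=> s y [/=]; rewrite in_itv /= => hs _.
  apply: jcontM; first exact/jcont_gam/sT.
  by apply: jcontD; apply: jcontM; [exact: jcont_cst|exact: jcont_heat_op (st16 s hs)
    |exact: jcont_cst|exact: C21_jcont (st16 s hs)].
- move=> [s y] _; rewrite !patchE.
  have [qb|qb] := ltP (sqnorm (y - x)) b; last first.
    rewrite [X in (_ <= (if X then _ else _))%E]memNset; last by move=> [/= _]; rewrite ltNge qb.
    by case: ifP => // _; rewrite /= HE.
  case: ifPn => hs; last first.
    rewrite memNset // => -[/= h1 h2]; move/negP : hs; apply.
    by rewrite inE; split.
  have hs' : s0 <= s <= s1 by move: hs; rewrite inE => -[/=]; rewrite in_itv.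
  rewrite mem_set; last by split => //=; rewrite in_itv.
  rewrite lee_fin /H /= [leRHS]mulrDr.
  have tau0 : 0 < T - s by rewrite subr_gt0 sT.
  apply: lerD.
    rewrite mulrA ler_wpM2r ?f_ge0 ?bB ?st16 //.
    by rewrite [leRHS]mulrC testfun_le // sT.
  rewrite mulrA [leRHS]mulrC ler_wpM2l ?u_ge0 ?st16 //.
  by rewrite [leRHS]mulrC; apply: ptestfun_remainder_le => //; exact: sqnorm_ge0.
Qed.

End supersolution.

(** * Pointwise bound from the pole of the kernel *)

Section pole.
Context {R : realType} {n : nat}.
Local Notation leb := (@lebesgue_measure R).
Local Notation rv := (@lebesgue_rv R n).
Local Notation st := (leb \x rv)%E.
Local Notation gam := (@gam R n).

Lemma powR_sqr_half (h : R) k : 0 <= h -> (h ^+ 2) `^ (- (k%:R / 2)) = h ^- k.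
Proof.
move=> h0; rewrite -(powR_mulrn 2 h0) -powRrM -(powR_invn k h0); congr (_ `^ _).
by field.
Qed.

Lemma jcont_lower (u : 'rV[R]_n -> R -> R) x t a : jcont u x t -> a < u x t ->
  exists2 e, 0 < e & forall y s, `|y - x| < e -> `|s - t| < e -> a <= u y s.
Proof.
move=> cu au.
have : \forall p \near (x, t), a <= u p.1 p.2.
  exact: (cvgr_ge (f := fun p : 'rV[R]_n * R => u p.1 p.2) (u x t) cu a au).
move=> /nbhs_ballP [e /= e0 he]; exists e => // y s yx sx.
apply: (he (y, s)); rewrite -ball_normE /= prod_normE /= gt_max.
by rewrite distrC yx distrC sx.
Qed.

(** On the cube of half-side [h] at time [h^2] before the pole, the truncation is at least
    [(b/2)^3], the kernel at least [h^(-n) exp(-n/4)], the volume is [(2 h)^n] and [u] is at least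
    half its value at the pole. The product of these bounds is [pole_const * b^3] times that
    value. *)
Definition pole_const : R := 2 ^+ n * expR (- (n%:R / 4)) / 16.

Lemma pole_const_gt0 : 0 < pole_const.
Proof. by rewrite !mulr_gt0 // ?exprn_gt0 ?expR_gt0 // invr_gt0. Qed.

Variable u : 'rV[R]_n -> R -> R.
Hypothesis Cu : C21 16 u.
Hypothesis u_ge0 : forall x t, 0 < t < 16 -> 0 <= u x t.
Hypothesis f_ge0 : forall x t, sqnorm x < 16 -> 0 < t < 16 -> 0 <= heat_op u x t.

(** At time [h^2] before its pole the kernel has width [h], so a cube of half-side [h] carries a
    fixed share of its integral, whatever [h]. *)
Lemma testfun_concentration (x : 'rV[R]_n) (b t h : R) (a : R) :
  0 < b -> 0 < h -> n%:R * h ^+ 2 <= b / 2 -> 0 < t - h ^+ 2 < 16 -> 0 <= a ->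
  (forall y, `|y - x| <= h -> a <= u y (t - h ^+ 2)) ->
  ((a * (2 * pole_const * b ^+ 3))%:E <=
    \int[rv]_y (u y (t - h ^+ 2) * testfun x b t (n%:R / 2) y (t - h ^+ 2))%:E)%E.
Proof.
move=> b0 h0 hb ht a0 ua; set s1 := t - h ^+ 2 in ht ua *.
have h20 : 0 < h ^+ 2 by rewrite exprn_gt0.
have ts1 : t - s1 = h ^+ 2 by rewrite /s1; ring.
have s1t : s1 < t by rewrite /s1 gtrBl.
pose B := [set y : 'rV[R]_n | forall i, `|y ord0 i - x ord0 i| <= h].
have mB : measurable B by exact: measurable_box.
have mf : measurable_fun setT (fun y : 'rV[R]_n => (u y s1 * testfun x b t (n%:R / 2) y s1)%:E).
  apply/measurable_EFinP; apply: (@measurable_slice _ _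
    (fun y s => u y s * testfun x b t (n%:R / 2) y s)) => y.
  by apply: jcontM; [exact: C21_jcont ht|exact: jcont_testfun].
apply: (@le_trans _ _ (\int[rv]_(y in B) (u y s1 * testfun x b t (n%:R / 2) y s1)%:E)%E); last first.
  apply: ge0_subset_integral => // y _.
  by rewrite lee_fin mulr_ge0 ?u_ge0 ?testfun_ge0.
set c := a * (b ^+ 3 / 8 * (h ^- n * expR (- (n%:R / 4)))).
apply: (@le_trans _ _ (\int[rv]_(y in B) cst c%:E y)%E).
  have rB : rv B = ((2 * h) ^+ n)%:E by exact: lebesgue_rv_box.
  rewrite integral_cst // [X in (_ <= _ * X)%E]rB -EFinM lee_fin /c /pole_const exprMn.
  by rewrite le_eqVlt; apply/orP; left; apply/eqP; field; rewrite ?expf_neq0 ?gt_eqF.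
apply: ge0_le_integral => //.
- move=> y _; rewrite lee_fin /c mulr_ge0 // mulr_ge0 //.
    by rewrite mulr_ge0 // exprn_ge0 // ltW.
  by rewrite mulr_ge0 ?expR_ge0 // invr_ge0 exprn_ge0 // ltW.
- exact: measurable_funTS.
move=> y By; rewrite lee_fin /c.
have q_le : sqnorm (y - x) <= n%:R * h ^+ 2.
  rewrite mulr_natl -[X in _ *+ X]card_ord -sumr_const; apply: ler_sum => i _.
  rewrite rvBE -real_normK ?num_real // lerXn2r ?nnegrE ?(ltW h0) //.
have q0 := sqnorm_ge0 (y - x).
apply: ler_pM => //.
- rewrite mulr_ge0 //; first by rewrite mulr_ge0 // exprn_ge0 // ltW.
  by rewrite mulr_ge0 ?expR_ge0 // invr_ge0 exprn_ge0 // ltW.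
- by apply: ua; apply: rv_norm_leP; [move=> i; rewrite rvBE; exact: (By i)|exact: ltW].
rewrite /testfun; apply: ler_pM => //.
- by rewrite mulr_ge0 // exprn_ge0 // ltW.
- by rewrite mulr_ge0 ?expR_ge0 // invr_ge0 exprn_ge0 // ltW.
- rewrite pos_id; last by lra.
  rewrite (_ : b ^+ 3 / 8 = (b / 2) ^+ 3); last by field.
  by rewrite lerXn2r ?nnegrE; lra.
rewrite /gk ts1 powR_sqr_half ?(ltW h0) // ler_pM2l ?invr_gt0 ?exprn_gt0 //.
rewrite ler_expR lerN2 ler_pdivrMr ?mulr_gt0 //.
by rewrite (le_trans q_le) // le_eqVlt; apply/orP; left; apply/eqP; field.
Qed.

(** Instead of letting [s1] tend to the pole and identifying a Dirac mass, [s1] stops at [t - h^2]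
    with [h] so small that continuity gives [u >= u x t / 2] on the cube. The price is the constant
    [pole_const]. The time interval is then extended to [t] by positivity. *)
Lemma pole_ineq (x : 'rV[R]_n) (b t s0 : R) :
  0 < b -> (forall y, sqnorm (y - x) < b -> sqnorm y < 16) ->
  0 < s0 -> s0 < t -> t < 16 ->
  ((pole_const * b ^+ 3 * u x t)%:E <=
   \int[rv]_(y in [set y : 'rV[R]_n | (sqnorm (y - x) < b)%R])
     (b ^+ 3 * (gam (t - s0) (sqnorm (y - x)) * u y s0))%:E +
   \int[st]_(p in tbox `[s0, t[ [set y : 'rV[R]_n | (sqnorm (y - x) < b)%R])
     (gam (t - p.1) (sqnorm (p.2 - x)) *
       (b ^+ 3 * heat_op u p.2 p.1 + 72 * b ^+ 2 * u p.2 p.1))%:E)%E.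
Proof.
move=> b0 bB s0_gt0 s0t t16.
have t_in : 0 < t < 16 by rewrite (lt_trans s0_gt0).
have s0_in : 0 < s0 < 16 by rewrite s0_gt0 (lt_trans s0t).
have g0 y s : sqnorm (y - x) < b -> 0 < s < 16 ->
   0 <= gam (t - s) (sqnorm (y - x)) * (b ^+ 3 * heat_op u y s + 72 * b ^+ 2 * u y s).
  move=> qb hs; rewrite mulr_ge0 ?gam_ge0 // addr_ge0 // !mulr_ge0 ?exprn_ge0 ?(ltW b0) ?u_ge0 //.
  by rewrite f_ge0 // bB.
have [u0|u0] := leP (u x t) 0.
  have -> : u x t = 0 by apply/eqP; rewrite eq_le u0 u_ge0.
  rewrite mulr0 adde_ge0 //; apply: integral_ge0.
    move=> y _; rewrite lee_fin mulr_ge0 ?exprn_ge0 ?(ltW b0) //.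
    by rewrite mulr_ge0 ?gam_ge0 ?u_ge0.
  move=> [s y] [/=]; rewrite in_itv /= => /andP[h1 h2] qb; rewrite lee_fin g0 //.
  by rewrite (lt_le_trans s0_gt0) //= (lt_trans h2).
have half : u x t / 2 < u x t by lra.
have [e e0 he] := jcont_lower (C21_jcont Cu t_in) half.
(* The first two bounds keep the cube at time [t - h^2] in the neighbourhood given by continuity,
   since [h^2 <= h]; the third gives [s0 < s1], the last [n h^2 <= b / 2]. The successor of [n]
   avoids a zero denominator. *)
pose h := Num.min (e / 2) (Num.min (1 / 2) (Num.min ((t - s0) / 2) (b / (2 * n.+1%:R)))).
have n0 : 0 < n.+1%:R :> R by rewrite ltr0n.
have h0 : 0 < h by rewrite !lt_min !divr_gt0 //= ?mulr_gt0 // subr_gt0.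
have [h1 h2 h3 h4] : [/\ h <= e / 2, h <= 1 / 2, h <= (t - s0) / 2 & h <= b / (2 * n.+1%:R)].
  by rewrite /h; split; rewrite !ge_min lexx ?orbT.
have hh : h ^+ 2 <= h by nra.
have h20 : 0 < h ^+ 2 by rewrite exprn_gt0.
set s1 := t - h ^+ 2.
have s01 : s0 < s1 by rewrite /s1; lra.
have s1t : s1 < t by rewrite /s1 gtrBl.
have s1_in : 0 < s1 < 16 by rewrite (lt_trans s0_gt0) //= (lt_trans s1t).
have nb : n%:R * h ^+ 2 <= b / 2.
  apply: (@le_trans _ _ (n.+1%:R * h)).
    by apply: ler_pM => //; [exact: ltW|rewrite ler_nat].
  by rewrite (le_trans (ler_wpM2l (ltW n0) h4)) // le_eqVlt; apply/orP; left; apply/eqP; field; rewrite gt_eqF.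
have ux y : `|y - x| <= h -> u x t / 2 <= u y s1.
  move=> hy; apply: he; first by rewrite (le_lt_trans hy); lra.
  by rewrite /s1 addrAC subrr add0r normrN ger0_norm ?(ltW h20) //; lra.
have u20 : 0 <= u x t / 2 by lra.
have k1 := testfun_concentration b0 h0 nb s1_in u20 ux.
have k2 := green_ineq Cu u_ge0 f_ge0 b0 bB s0_gt0 s01 (lt_trans s1t t16) s1t.
rewrite (_ : pole_const * b ^+ 3 * u x t = u x t / 2 * (2 * pole_const * b ^+ 3)); last by field.
apply: (le_trans k1); apply: (le_trans k2); rewrite leeD2l //.
apply: ge0_subset_integral.
- by apply: measurable_tbox => //; exact: measurable_sqball.
- by apply: measurable_tbox => //; exact: measurable_sqball.
- apply/measurable_EFinP; apply: (@measurable_jcont _ _ (fun y s => gam (t - s) (sqnorm (y - x)) *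
       (b ^+ 3 * heat_op u y s + 72 * b ^+ 2 * u y s))).
    by apply: measurable_tbox => //; exact: measurable_sqball.
  move=> s y [/=]; rewrite in_itv /= => /andP[a1 a2] _.
  have s_in : 0 < s < 16 by rewrite (lt_le_trans s0_gt0) //= (lt_trans a2).
  apply: jcontM; first exact/jcont_gam.
  by apply: jcontD; apply: jcontM; [exact: jcont_cst|exact: jcont_heat_op s_in
    |exact: jcont_cst|exact: C21_jcont s_in].
- move=> [s y] [/=]; rewrite in_itv /= => /andP[a1 a2] qb; rewrite lee_fin g0 //.
  by rewrite (lt_le_trans s0_gt0) //= (lt_trans a2).
- move=> [s y] [/=]; rewrite !in_itv /= => /andP[a1 a2] qb; split => //=.
  by rewrite in_itv /= a1 (le_lt_trans a2).
Qed.

End pole.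

(** * Mass of the solution and of its source near time 0 *)

Section mass.
Context {R : realType} {n : nat}.
Local Notation leb := (@lebesgue_measure R).
Local Notation mR := (measurableTypeR R).
Local Notation rv := (@lebesgue_rv R n).
Local Notation st := (leb \x rv)%E.

(** Squared radii 9 < 12 < 16: the weight with [b = 12] is supported where the source is nonnegative
    and is bounded below on this ball. *)
Definition ball3 : set 'rV[R]_n := [set y | sqnorm y <= 9].

Lemma measurable_ball3 : measurable ball3.
Proof.
rewrite (_ : ball3 = [set y | sqnorm (y - 0) <= 9]); first exact: measurable_sqcball.
by apply/seteqP; split => y; rewrite /ball3 /= subr0.
Qed.

Let m : R := n%:R / 2 + (n%:R + 4) ^+ 2 / 16.

(** Put [z = 12 - r]. As [tau <= 2], the first term is at least [(n + 4)^2 z^3 / 32]; together with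
    [24 r z - 6 n z^2] this makes [z ((n + 4) z - 96)^2 / 32]. The value of [m] is the one that
    completes this square. *)
Lemma mass_remainder_ge0 (tau r : R) : 0 < tau -> tau <= 2 -> 0 <= r ->
  0 <= testfun_remainder n 12 m tau r.
Proof.
move=> t0 t2 r0; rewrite /testfun_remainder mulr_ge0 ?gk_ge0 //.
have [h|h] := leP r 12; last by rewrite pos_eq0 ?expr0n /=; lra.
rewrite pos_id; last by lra.
set z := 12 - r; have z0 : 0 <= z by rewrite /z; lra.
have rE : r = 12 - z by rewrite /z; ring.
have mE : m - n%:R / 2 = (n%:R + 4) ^+ 2 / 16 by rewrite /m; ring.
have K : (n%:R + 4) ^+ 2 / 32 <= (m - n%:R / 2) / tau.
  rewrite mE ler_pdivlMr //.
  have := ler_wpM2l (sqr_ge0 (n%:R + 4 : R)) t2; lra.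
have e1 : 0 <= 6 * r * z ^+ 2 / tau.
  by rewrite !mulr_ge0 ?exprn_ge0 ?invr_ge0 // ltW.
have e2 : (n%:R + 4) ^+ 2 / 32 * z ^+ 3 <= (m - n%:R / 2) / tau * z ^+ 3.
  by rewrite ler_wpM2r // exprn_ge0.
have e3 : 0 <= z * (((n%:R + 4) * z - 96) ^+ 2 / 32).
  by rewrite mulr_ge0 // divr_ge0 // sqr_ge0.
have e4 : z * (((n%:R + 4) * z - 96) ^+ 2 / 32) =
   (n%:R + 4) ^+ 2 / 32 * z ^+ 3 + 24 * r * z - 6 * n%:R * z ^+ 2.
  by rewrite rE; field.
lra.
Qed.

(** On [ball3] the truncation is at least [(12 - 9)^3 = 27]; with the pole at time 2 and times in
    [[0, 1]], [tau] lies between 1 and 2. *)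
Definition mass_const : R := 27 * (2 `^ (- m) * expR (- (9 / 4))).

Lemma mass_const_gt0 : 0 < mass_const.
Proof. by rewrite !mulr_gt0 ?powR_gt0 ?expR_gt0. Qed.

Lemma mass_testfun_ge (y : 'rV[R]_n) s : 0 <= s <= 1 -> ball3 y ->
  mass_const <= testfun 0 12 2 m y s.
Proof.
move=> /andP[s0 s1] By; rewrite /testfun subr0.
have q0 := sqnorm_ge0 y; have q9 : sqnorm y <= 9 := By.
have t1 : 1 <= 2 - s by lra.
have t2 : 2 - s <= 2 by lra.
have t0 : 0 < 2 - s by lra.
have m0 : 0 <= m by rewrite /m addr_ge0 // divr_ge0 // sqr_ge0.
apply: ler_pM => //.
  rewrite pos_id; last by lra.
  rewrite (_ : 27 = 3 ^+ 3 :> R); last by ring.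
  by rewrite lerXn2r // ?nnegrE; lra.
apply: ler_pM; rewrite ?powR_ge0 ?expR_ge0 //.
  rewrite !powRN lef_pV2 ?posrE ?powR_gt0 //.
  by apply: ge0_ler_powR; rewrite ?nnegrE // ltW.
rewrite ler_expR lerN2 ler_pdivrMr ?mulr_gt0 //; lra.
Qed.

Variable u : 'rV[R]_n -> R -> R.
Hypothesis Cu : C21 16 u.
Hypothesis u_ge0 : forall x t, 0 < t < 16 -> 0 <= u x t.
Hypothesis f_ge0 : forall x t, sqnorm x < 16 -> 0 < t < 16 -> 0 <= heat_op u x t.

Lemma measurable_heat_op (A : set mR) (B : set 'rV[R]_n) :
  measurable A -> measurable B -> (forall s : R, A s -> 0 < s < 16) ->
  measurable_fun (tbox A B) (fun p => heat_op u p.2 p.1 : mR).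
Proof.
move=> mA mB A16; apply: measurable_jcont; first exact: measurable_tbox.
by move=> s y [/= /A16 h _]; exact: jcont_heat_op h.
Qed.

Lemma measurable_u (A : set mR) (B : set 'rV[R]_n) :
  measurable A -> measurable B -> (forall s : R, A s -> 0 < s < 16) ->
  measurable_fun (tbox A B) (fun p => u p.2 p.1 : mR).
Proof.
move=> mA mB A16; apply: measurable_jcont; first exact: measurable_tbox.
by move=> s y [/= /A16 h _]; exact: C21_jcont h.
Qed.

Lemma measurable_u_slice s : 0 < s < 16 -> measurable_fun setT (fun y : 'rV[R]_n => u y s).
Proof. by move=> hs; apply: measurable_slice => y; exact: C21_jcont hs. Qed.

Definition energy (s : R) : \bar R :=
  (\int[rv]_y (u y s * testfun 0 12 2 m y s)%:E)%E.

Lemma energy_ge0 s : 0 < s <= 1 -> (0 <= energy s)%E.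
Proof.
move=> /andP[s0 s1]; apply: integral_ge0 => y _.
by rewrite lee_fin mulr_ge0 ?testfun_ge0 // u_ge0 // s0; lra.
Qed.

Lemma energy_fin s : 0 < s <= 1 -> energy s \is a fin_num.
Proof.
move=> /andP[s0 s1]; apply: integrable_fin_num => //.
have L0 : 0 < `|0 : 'rV[R]_n| + 12 + 1 by rewrite normr0; lra.
apply: (@integrable_slice _ _ (fun y s => u y s * testfun 0 12 2 m y s) _ s L0).
  move=> y; apply: jcontM; last by apply: jcont_testfun; lra.
  by apply: (C21_jcont Cu); rewrite s0; lra.
by move=> y yL; rewrite /testfun testfun_support // expr0n /= mul0r mulr0.
Qed.

(** The choice of [m] makes the contribution of [u] to the Green identity nonnegative; the source is
    nonnegative on the support of the weight, and only its part on [ball3] is kept. *)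
Lemma energy_mono s0 s1 : 0 < s0 -> s0 < s1 -> s1 <= 1 ->
  (energy s0 + mass_const%:E * \int[st]_(p in tbox `[s0, s1] ball3) (heat_op u p.2 p.1)%:E
    <= energy s1)%E.
Proof.
move=> s0_gt0 s01 s1_le.
have h12 : 0 < 12 :> R by [].
have s116 : s1 < 16 by lra.
have s12 : s1 < 2 by lra.
have st16 s : s0 <= s <= s1 -> 0 < s < 16.
  by case/andP => h1 h2; rewrite (lt_le_trans s0_gt0) //= (le_lt_trans h2).
have [E iG] := integral_green_slab Cu 0 m h12 s0_gt0 s01 s116 s12.
rewrite {2}/energy E leeD2l //.
have mT : measurable (tbox `[s0, s1] (setT : set 'rV[R]_n)) by exact: measurable_tbox.
have mD : measurable (tbox `[s0, s1] ball3) by apply: measurable_tbox => //; exact: measurable_ball3.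
have A16 (s : R) : `[s0, s1]%classic s -> 0 < s < 16 by rewrite /= in_itv; exact: st16.
have mf : measurable_fun (tbox `[s0, s1] ball3) (fun p => heat_op u p.2 p.1 : mR).
  by apply: measurable_heat_op => //; exact: measurable_ball3.
have fB y s : ball3 y -> s0 <= s <= s1 -> 0 <= heat_op u y s.
  by move=> By hs; rewrite f_ge0 ?st16 // (le_lt_trans By) //; lra.
have rem0 y s : s0 <= s <= s1 ->
    0 <= u y s * testfun_remainder n 12 m (2 - s) (sqnorm (y - 0)).
  move=> hs; rewrite mulr_ge0 ?u_ge0 ?st16 // mass_remainder_ge0 ?sqnorm_ge0 //.
    by case/andP : hs => ? ?; lra.
  by case/andP : hs => ? ?; lra.
have tf0 y s : s0 <= s <= s1 -> 0 <= testfun 0 12 2 m y s * heat_op u y s.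
  move=> hs; have [h|h] := leP 12 (sqnorm (y - 0)); first by rewrite testfun_out // mul0r.
  by rewrite mulr_ge0 ?testfun_ge0 // f_ge0 ?st16 //; move: h; rewrite subr0; lra.
rewrite -ge0_integralZl //; last 3 first.
- exact/measurable_EFinP.
- by move=> [s y] [/=]; rewrite in_itv /= lee_fin => hs By; exact: fB.
- by rewrite lee_fin ltW // mass_const_gt0.
rewrite integral_mkcond [leRHS]integral_mkcond; apply: ge0_le_integral => //.
- move=> [s y] _; rewrite patchE; case: ifPn => //; rewrite inE => -[/=].
  by rewrite in_itv /= => hs By; rewrite mule_ge0 // lee_fin ?fB // ltW // mass_const_gt0.
- apply/(measurable_restrictT _ mD); apply: emeasurable_funM => //.
  exact/measurable_EFinP.
- by apply/(measurable_restrictT _ mT); case/integrableP : iG.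
- move=> [s y] _; rewrite !patchE; case: ifPn.
    rewrite inE => -[/=]; rewrite in_itv /= => hs By.
    rewrite mem_set; last by split => //=; rewrite in_itv.
    rewrite -EFinM lee_fin /= -[leLHS]addr0 lerD ?rem0 // ler_wpM2r ?fB //.
    by apply: mass_testfun_ge => //; case/andP : hs => ? ?; apply/andP; split; lra.
  move=> _; case: ifPn => //; rewrite inE => -[/=]; rewrite in_itv /= => hs _.
  by rewrite lee_fin addr_ge0 ?rem0 ?tf0.
Qed.

Lemma slab_mass_ge0 s0 s1 : 0 < s0 -> s1 <= 1 ->
  (0 <= \int[st]_(p in tbox `[s0, s1] ball3) (heat_op u p.2 p.1)%:E)%E.
Proof.
move=> s0_gt0 s1_le; apply: integral_ge0 => -[s y] [/=]; rewrite in_itv /= => /andP[h1 h2] By.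
rewrite lee_fin f_ge0 //; first by rewrite (le_lt_trans By) //; lra.
by apply/andP; split; lra.
Qed.

Lemma energy_le s : 0 < s <= 1 -> (energy s <= energy 1)%E.
Proof.
move=> /andP[s0]; rewrite le_eqVlt => /orP[/eqP -> //|s1].
apply: le_trans (energy_mono s0 s1 (lexx _)).
by rewrite leeDl // mule_ge0 ?slab_mass_ge0 // lee_fin ltW // mass_const_gt0.
Qed.

Lemma lee_div (c e : R) (X : \bar R) : 0 < c -> (c%:E * X <= e%:E)%E -> (X <= (e / c)%:E)%E.
Proof. by move=> c0 h; rewrite mulrC EFinM lee_pdivlMl. Qed.

Lemma lee_fine_sub (E0 E1 X : \bar R) : E0 \is a fin_num -> E1 \is a fin_num ->
  (E0 + X <= E1)%E -> (X <= (fine E1 - fine E0)%:E)%E.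
Proof.
move: E0 E1 => [a||] [b||] // _ _; case: X => [x||] //=; last by move=> _; exact: leNye.
by rewrite -EFinD !lee_fin => h; lra.
Qed.

(** The energy does not decrease, so its value at time 1, finite by continuity of [u] there,
    controls all earlier times; no information at time 0 enters. *)
Lemma mass_u_bound : exists2 M, 0 <= M & forall s, 0 < s <= 1 ->
  (\int[rv]_(y in ball3) (u y s)%:E <= M%:E)%E.
Proof.
have c0 := mass_const_gt0.
have h11 : 0 < (1 : R) <= 1 by rewrite ltr01 lexx.
exists (fine (energy 1) / mass_const).
  by rewrite divr_ge0 ?(ltW c0) // fine_ge0 // energy_ge0.
move=> s hs; have [s0 s1] := andP hs.
have s16 : 0 < s < 16 by rewrite s0; lra.
have mus := measurable_u_slice s16.
apply: lee_div => //; rewrite fineK ?energy_fin //.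
apply: le_trans (energy_le hs).
rewrite -ge0_integralZl //; last 4 first.
- exact: measurable_ball3.
- by apply/measurable_EFinP; exact: measurable_funTS.
- by move=> y _; rewrite lee_fin u_ge0.
- by rewrite lee_fin ltW.
rewrite integral_mkcond; apply: ge0_le_integral => //.
- move=> y _; rewrite patchE; case: ifPn => // _.
  by rewrite mule_ge0 // lee_fin ?u_ge0 // ltW.
- apply/(measurable_restrictT _ measurable_ball3); apply: emeasurable_funM => //.
  by apply/measurable_EFinP; exact: measurable_funTS.
- apply/measurable_EFinP; apply: measurable_funM => //.
  by apply: measurable_slice => y; apply: jcont_testfun; lra.
- move=> y _; rewrite patchE; case: ifPn.
    rewrite inE => By; rewrite -EFinM lee_fin mulrC ler_wpM2l ?u_ge0 //.
    by apply: mass_testfun_ge => //; apply/andP; split; lra.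
  by move=> _; rewrite lee_fin mulr_ge0 ?u_ge0 ?testfun_ge0.
Qed.

Lemma mass_f_slab s0 s1 : 0 < s0 -> s0 < s1 -> s1 <= 1 ->
  (\int[st]_(p in tbox `[s0, s1] ball3) (heat_op u p.2 p.1)%:E <=
   ((fine (energy s1) - fine (energy s0)) / mass_const)%:E)%E.
Proof.
move=> s0_gt0 s01 s1_le; apply: lee_div; first exact: mass_const_gt0.
have e0 : energy s0 \is a fin_num by rewrite energy_fin // s0_gt0 (le_trans (ltW s01)).
have e1 : energy s1 \is a fin_num by rewrite energy_fin // (lt_trans s0_gt0).
exact: lee_fine_sub (energy_mono s0_gt0 s01 s1_le).
Qed.

Lemma mass_f_small (e : R) : 0 < e -> exists2 d, 0 < d <= 1 &
  forall s0 s1, 0 < s0 -> s0 < s1 -> s1 <= d ->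
  (\int[st]_(p in tbox `[s0, s1] ball3) (heat_op u p.2 p.1)%:E <= e%:E)%E.
Proof.
move=> e0; have c0 := mass_const_gt0.
pose A := [set fine (energy s) | s in [set s : R | 0 < s <= 1]].
have hA : has_inf A.
  split; first by exists (fine (energy 1)); exists 1 => //=; rewrite ltr01 lexx.
  by exists 0 => _ [s hs <-]; rewrite fine_ge0 // energy_ge0.
have ec : 0 < e * mass_const by rewrite mulr_gt0.
have [_ [d hd <-] hdA] := inf_adherent ec hA.
exists d => // s0 s1 s0_gt0 s01 s1d.
have [d0 d1] := andP hd.
have s1_le : s1 <= 1 by exact: le_trans d1.
have h0 : 0 < s0 <= 1 by rewrite s0_gt0 (le_trans (ltW s01)).
have h1 : 0 < s1 <= 1 by rewrite (lt_trans s0_gt0).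
apply: (le_trans (mass_f_slab s0_gt0 s01 s1_le)); rewrite lee_fin ler_pdivrMr //.
have i0 : inf A <= fine (energy s0) by apply: ge_inf; [case: hA|exists s0].
have i1 : fine (energy s1) <= fine (energy d).
  apply: fine_le; rewrite ?energy_fin //.
  move: s1d; rewrite le_eqVlt => /orP[/eqP -> //|s1d].
  have s10 : 0 < s1 by case/andP : h1.
  apply: le_trans (energy_mono s10 s1d d1).
  by rewrite leeDl // mule_ge0 ?slab_mass_ge0 // lee_fin ltW.
by rewrite lerBlDr (le_trans i1) // (le_trans (ltW hdA)) // addrC lerD2l.
Qed.

Lemma mass_f_bound : exists2 M, 0 <= M &
  (\int[st]_(p in tbox `]0%R, 1%R] ball3) (heat_op u p.2 p.1)%:E <= M%:E)%E.
Proof.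
have c0 := mass_const_gt0.
have h11 : 0 < (1 : R) <= 1 by rewrite ltr01 lexx.
exists (fine (energy 1) / mass_const).
  by rewrite divr_ge0 ?(ltW c0) // fine_ge0 // energy_ge0.
(* The shift by 2 keeps the left end strictly below 1, as [mass_f_slab] requires. *)
pose F (k : nat) := tbox `[k.+2%:R^-1, 1] ball3.
have -> : tbox `]0, 1] ball3 = \bigcup_k F k.
  apply/seteqP; split => -[s y].
    move=> [/=]; rewrite in_itv /= => /andP[s0 s1] By.
    have [k _ hk] := near_infty_natSinv_lt (PosNum s0).
    exists k => //; split => //=; rewrite in_itv /= s1 andbT ltW //.
    by apply: le_lt_trans (hk k (leqnn _)); rewrite lef_pV2 ?posrE ?ltr0n // ler_nat.
  move=> [k _ [/=]]; rewrite in_itv /= => /andP[s0 s1] By; split => //=.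
  by rewrite in_itv /= s1 andbT (lt_le_trans _ s0) // invr_gt0 ltr0n.
have ndF : {homo F : a b / (a <= b)%N >-> (a <= b)%O}.
  move=> a b ab; apply/subsetPset => -[s y] [/=]; rewrite in_itv /= => /andP[h1 h2] By.
  split => //=; rewrite in_itv /= h2 andbT (le_trans _ h1) // lef_pV2 ?posrE ?ltr0n //.
  by rewrite ler_nat !ltnS.
have s16 k (s : R) : `[k.+2%:R^-1, 1]%classic s -> 0 < s < 16.
  rewrite /= in_itv /= => /andP[h1 h2]; apply/andP; split; last by lra.
  by rewrite (lt_le_trans _ h1) // invr_gt0 ltr0n.
have mF k : measurable (F k) by apply: measurable_tbox => //; exact: measurable_ball3.
have mf k : measurable_fun (F k) (fun p => (heat_op u p.2 p.1)%:E).
  apply/measurable_EFinP; apply: measurable_heat_op => //; first exact: measurable_ball3.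
  exact: s16.
have f0 k p : F k p -> (0 <= (heat_op u p.2 p.1)%:E)%E.
  case: p => s y [/= /s16 hs By]; rewrite lee_fin f_ge0 // (le_lt_trans By) //; lra.
have cv := ge0_nondecreasing_set_cvg_integral (mu := st) ndF mF mf f0.
rewrite -(cvg_lim _ cv) //; apply: lime_le; first by apply/cvg_ex; eexists; exact: cv.
near=> k; have k0 : 0 < k.+2%:R^-1 :> R by rewrite invr_gt0 ltr0n.
apply: (le_trans (mass_f_slab k0 _ (lexx _))).
  by rewrite invf_lt1 ?ltr0n // ltr1n.
rewrite lee_fin ler_wpM2r ?invr_ge0 ?(ltW c0) // gerBl fine_ge0 // energy_ge0 // k0.
by rewrite invf_le1 ?ltr0n // ler1n.
Unshelve. all: by end_near. Qed.

End mass.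

(** * Mass of the solution in small balls *)

Section local_mass.
Context {R : realType} {n : nat}.
Local Notation leb := (@lebesgue_measure R).
Local Notation mR := (measurableTypeR R).
Local Notation rv := (@lebesgue_rv R n).
Local Notation st := (leb \x rv)%E.
Local Notation gam := (@gam R n).
Local Notation ball3 := (@ball3 R n).

Lemma ge0_integral_tbox (A : set mR) (B : set 'rV[R]_n) (F : mR * 'rV[R]_n -> \bar R) :
  measurable A -> measurable B -> measurable_fun (tbox A B) F ->
  (forall p, tbox A B p -> 0 <= F p)%E ->
  (\int[st]_(p in tbox A B) F p = \int[leb]_(s in A) \int[rv]_(y in B) F (s, y))%E.
Proof.
move=> mA mB mF F0; have mAB := measurable_tbox mA mB.
rewrite integral_mkcond fubini_tonelli1; last 2 first.
- exact/(measurable_restrictT _ mAB).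
- by move=> p; rewrite patchE; case: ifPn => //; rewrite inE; exact: F0.
rewrite [RHS]integral_mkcond; apply: eq_integral => s _.
rewrite /fubini_F [RHS]patchE; case: ifPn => hs.
  rewrite [RHS]integral_mkcond; apply: eq_integral => y _; rewrite !patchE.
  congr (if _ then _ else _); rewrite inE in hs.
  by apply/idP/idP; rewrite !inE /=; [case|split].
apply: integral0_eq => y _; rewrite patchE memNset // => -[/= h _].
by move/negP : hs; apply; rewrite inE.
Qed.

Lemma sqnormD_le (eta : R) (x y : 'rV[R]_n) : 0 < eta ->
  sqnorm (x + y) <= (1 + eta) * sqnorm x + (1 + eta^-1) * sqnorm y.
Proof.
move=> e0; rewrite /sqnorm !mulr_sumr -big_split /=; apply: ler_sum => i _.
rewrite mxE; set a := x _ _; set c := y _ _.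
have : 0 <= (eta * a - c) ^+ 2 / eta by rewrite divr_ge0 ?sqr_ge0 // ltW.
rewrite (_ : (eta * a - c) ^+ 2 / eta = eta * a ^+ 2 - 2 * a * c + eta^-1 * c ^+ 2).
  by move=> h; nra.
by field; rewrite gt_eqF.
Qed.

(** The triangle inequality for squared norms. At each use [eta] is chosen so that the ball around
    [x] fits into the prescribed larger ball; the ratio of the two lengths is the optimal value. *)
Lemma sqnorm_near (eta : R) (x y : 'rV[R]_n) : 0 < eta ->
  sqnorm y <= (1 + eta) * sqnorm x + (1 + eta^-1) * sqnorm (y - x).
Proof. by move=> e0; have := sqnormD_le x (y - x) e0; rewrite addrC subrK. Qed.

Lemma sqnormN (x : 'rV[R]_n) : sqnorm (- x) = sqnorm x.
Proof. by apply: eq_bigr => i _; rewrite mxE sqrrN. Qed.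

Lemma sqnormBC (x y : 'rV[R]_n) : sqnorm (x - y) = sqnorm (y - x).
Proof. by rewrite -sqnormN opprB. Qed.

Variable u : 'rV[R]_n -> R -> R.
Hypothesis Cu : C21 16 u.
Hypothesis u_ge0 : forall x t, 0 < t < 16 -> 0 <= u x t.
Hypothesis f_ge0 : forall x t, sqnorm x < 16 -> 0 < t < 16 -> 0 <= heat_op u x t.
Variable M : R.
Hypothesis M_ge0 : 0 <= M.
Hypothesis hM : forall s, 0 < s <= 1 -> (\int[rv]_(y in ball3) (u y s)%:E <= M%:E)%E.

Lemma mass_u_slab s0 s1 : 0 < s0 -> s0 < s1 -> s1 <= 1 ->
  (\int[st]_(p in tbox `[s0, s1] ball3) (u p.2 p.1)%:E <= (M * (s1 - s0))%:E)%E.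
Proof.
move=> s0_gt0 s01 s1_le.
have hs s : s0 <= s <= s1 -> 0 < s <= 1.
  by move=> /andP[h1 h2]; rewrite (lt_le_trans s0_gt0) //= (le_trans h2).
have hs16 (s : R) : `[s0, s1]%classic s -> 0 < s < 16.
  by rewrite /= in_itv /= => /hs /andP[-> ?]; lra.
have mD : measurable (tbox `[s0, s1] ball3) by apply: measurable_tbox => //; exact: measurable_ball3.
have mu : measurable_fun (tbox `[s0, s1] ball3) (fun p => (u p.2 p.1)%:E).
  by apply/measurable_EFinP; apply: measurable_u => //; exact: measurable_ball3.
have u0 p : tbox `[s0, s1] ball3 p -> (0 <= (u p.2 p.1)%:E)%E.
  by case: p => s y [/= /hs16 h _]; rewrite lee_fin u_ge0.
rewrite ge0_integral_tbox //; last exact: measurable_ball3.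
apply: (@le_trans _ _ (\int[leb]_(s in `[s0, s1]) (cst M%:E) s)%E).
  rewrite integral_mkcond [leRHS]integral_mkcond.
  apply: ge0_le_integral => //.
  - move=> s _; rewrite patchE; case: ifPn => //; rewrite inE => h.
    by apply: integral_ge0 => y _; rewrite lee_fin u_ge0 // hs16.
  - rewrite (_ : _ \_ _ = fubini_F rv ((fun p => (u p.2 p.1)%:E) \_ (tbox `[s0, s1] ball3))).
      apply: measurable_fun_fubini_tonelli_F; first exact/(measurable_restrictT _ mD).
      by move=> p; rewrite patchE; case: ifPn => //; rewrite inE; exact: u0.
    apply/funext => s; rewrite /fubini_F patchE; case: ifPn => h.
      rewrite [LHS]integral_mkcond; apply: eq_integral => y _; rewrite !patchE.
      congr (if _ then _ else _); rewrite inE in h.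
      by apply/idP/idP; rewrite !inE /=; [split|case].
    apply/esym/integral0_eq => y _; rewrite patchE memNset // => -[/= h' _].
    by move/negP : h; apply; rewrite inE.
  - by apply/(measurable_restrictT _ (measurable_itv `[s0, s1])); exact: measurable_cst.
  - move=> s _; rewrite !patchE; case: ifPn => //; rewrite inE /= in_itv /= => h.
    exact/hM/hs.
rewrite integral_cst //= lebesgue_measure_itv /= lte_fin s01 -EFinB -EFinM.
by rewrite lee_fin.
Qed.

(** The pole is at [s1 + kap], with [b = 1]. At time [s1] the kernel is of order [kap^(-n/2)] on the
    ball of squared radius [kap], while on the slice [s0] it is at most [(s1 - s0)^(-n/2)]; the
    quotient weights the old mass. In the source term the kernel is at most [kap^(-n/2)], which
    cancels. The factor 16 is 8 from the truncation, at least 1/2, times 2 from the exponential, at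
    least 3/4. *)
Lemma local_mass (x : 'rV[R]_n) (kap s0 s1 e : R) :
  sqnorm x <= 9 / 4 -> 0 < kap -> kap <= 1 / 2 -> 0 < s0 -> s0 < s1 -> s1 <= 1 ->
  (\int[st]_(p in tbox `[s0, s1] ball3) (heat_op u p.2 p.1)%:E <= e%:E)%E ->
  (\int[rv]_(y in [set y : 'rV[R]_n | (sqnorm (y - x) <= kap)%R]) (u y s1)%:E <=
    (16 * ((kap / (s1 - s0)) `^ (n%:R / 2) * M + (e + 72 * M * (s1 - s0))))%:E)%E.
Proof.
move=> x94 k0 k12 s0_gt0 s01 s1_le he.
have bB (y : 'rV[R]_n) : sqnorm (y - x) < 1 -> ball3 y.
  move=> h; rewrite /ball3 /=; have h23 : 0 < 2 / 3 :> R by lra.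
  have := sqnorm_near x y h23; rewrite invf_div; lra.
have bB16 (y : 'rV[R]_n) : sqnorm (y - x) < 1 -> sqnorm y < 16.
  by move=> /bB; rewrite /ball3 /=; lra.
have s1T : s1 < s1 + kap by rewrite ltrDl.
have s116 : s1 < 16 by lra.
have s1_in : 0 < s1 < 16 by rewrite (lt_trans s0_gt0).
have s0_in : 0 < s0 < 16 by rewrite s0_gt0 (lt_trans s01).
have hs16 (s : R) : `[s0, s1]%classic s -> 0 < s < 16.
  by rewrite /= in_itv /= => /andP[h1 h2]; apply/andP; split; lra.
have G := green_ineq Cu u_ge0 f_ge0 ltr01 bB16 s0_gt0 s01 s116 s1T.
set kk := kap `^ (- (n%:R / 2)).
have kk0 : 0 < kk by rewrite powR_gt0.
have mB := measurable_sqball x 1.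
have mBk := measurable_sqcball x kap.
have mD : measurable (tbox `[s0, s1] ball3) by apply: measurable_tbox => //; exact: measurable_ball3.
have mD1 : measurable (tbox `[s0, s1] [set y : 'rV[R]_n | sqnorm (y - x) < 1]).
  exact: measurable_tbox.
have us1 := measurable_u_slice Cu s1_in.
have us0 := measurable_u_slice Cu s0_in.
have L1 : ((kk / 16)%:E * \int[rv]_(y in [set y : 'rV[R]_n | (sqnorm (y - x) <= kap)%R]) (u y s1)%:E <=
    \int[rv]_y (u y s1 * testfun x 1 (s1 + kap) (n%:R / 2) y s1)%:E)%E.
  rewrite -ge0_integralZl //; last 3 first.
  - by apply/measurable_EFinP; exact: measurable_funTS.
  - by move=> y _; rewrite lee_fin u_ge0.
  - by rewrite lee_fin divr_ge0 // ltW.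
  rewrite integral_mkcond; apply: ge0_le_integral => //.
  - move=> y _; rewrite patchE; case: ifPn => // _.
    by rewrite -EFinM lee_fin mulr_ge0 ?u_ge0 // divr_ge0 // ltW.
  - apply/(measurable_restrictT _ mBk); apply: emeasurable_funM => //.
    by apply/measurable_EFinP; exact: measurable_funTS.
  - apply/measurable_EFinP; apply: measurable_funM => //.
    by apply: measurable_slice => y; exact: jcont_testfun.
  move=> y _; rewrite patchE; case: ifPn => [|_]; last first.
    by rewrite lee_fin mulr_ge0 ?u_ge0 ?testfun_ge0.
  rewrite inE /= => hy; rewrite -EFinM lee_fin mulrC ler_wpM2l ?u_ge0 //.
  have q0 := sqnorm_ge0 (y - x).
  rewrite /testfun /gk (_ : s1 + kap - s1 = kap); last by ring.
  rewrite -/kk mulrCA ler_pM2l // (_ : 16^-1 = 8^-1 / 2 :> R); last by field.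
  apply: ler_pM => //.
    rewrite pos_id; last by lra.
    rewrite (_ : 8^-1 = (1 / 2) ^+ 3 :> R); last by field.
    by rewrite lerXn2r ?nnegrE; lra.
  apply: (le_trans _ (expR_ge1Dx _)).
  have : sqnorm (y - x) / (4 * kap) <= 1 / 4.
    by rewrite ler_pdivrMr ?mulr_gt0 //; lra.
  lra.
have L2 : (\int[rv]_(y in [set y : 'rV[R]_n | (sqnorm (y - x) < 1)%R])
     (1 ^+ 3 * (gam (s1 + kap - s0) (sqnorm (y - x)) * u y s0))%:E <=
     ((s1 - s0) `^ (- (n%:R / 2)) * M)%:E)%E.
  have d0 : 0 < s1 - s0 by rewrite subr_gt0.
  rewrite EFinM; apply: (@le_trans _ _ (((s1 - s0) `^ (- (n%:R / 2)))%:E *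
    \int[rv]_(y in ball3) (u y s0)%:E)%E); last first.
    by rewrite lee_wpmul2l ?lee_fin ?powR_ge0 // hM // s0_gt0 (le_trans (ltW s01)).
  rewrite -ge0_integralZl //; last 4 first.
  - exact: measurable_ball3.
  - by apply/measurable_EFinP; exact: measurable_funTS.
  - by move=> y _; rewrite lee_fin u_ge0.
  - by rewrite lee_fin powR_ge0.
  apply: (@le_trans _ _ (\int[rv]_(y in [set y : 'rV[R]_n | (sqnorm (y - x) < 1)%R])
     (((s1 - s0) `^ (- (n%:R / 2)))%:E * (u y s0)%:E))%E).
    apply: ge0_le_integral => //.
    - by move=> y _; rewrite lee_fin expr1n mul1r mulr_ge0 ?gam_ge0 ?u_ge0.
    - apply/measurable_EFinP; apply: measurable_funTS.
      apply: (@measurable_slice _ _ (fun y s => 1 ^+ 3 * (gam (s1 + kap - s) (sqnorm (y - x)) * u y s))) => y.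
      apply: jcontM; first exact: jcont_cst.
      by apply: jcontM; [apply: jcont_gam; lra|exact: C21_jcont s0_in].
    - by apply: emeasurable_funM => //; apply/measurable_EFinP; exact: measurable_funTS.
    - move=> y _; rewrite -EFinM lee_fin expr1n mul1r ler_wpM2r ?u_ge0 //.
      have t0 : 0 < s1 + kap - s0 by lra.
      apply: (le_trans (gam_le t0 (sqnorm_ge0 _))).
      rewrite !powRN lef_pV2 ?posrE ?powR_gt0 //.
      by apply: ge0_ler_powR; rewrite ?nnegrE ?divr_ge0 //; lra.
  apply: ge0_subset_integral => //.
  - exact: measurable_ball3.
  - by apply: emeasurable_funM => //; apply/measurable_EFinP; exact: measurable_funTS.
  - by move=> y _; rewrite -EFinM lee_fin mulr_ge0 ?powR_ge0 ?u_ge0.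
have fB y s : ball3 y -> 0 < s < 16 -> 0 <= heat_op u y s.
  by move=> By hs; rewrite f_ge0 // (le_lt_trans By) //; lra.
have mf9 : measurable_fun (tbox `[s0, s1] ball3) (fun p => heat_op u p.2 p.1 : mR).
  by apply: measurable_heat_op => //; exact: measurable_ball3.
have mu9 : measurable_fun (tbox `[s0, s1] ball3) (fun p => u p.2 p.1 : mR).
  by apply: measurable_u => //; exact: measurable_ball3.
have L3 : (\int[st]_(p in tbox `[s0, s1] [set y : 'rV[R]_n | (sqnorm (y - x) < 1)%R])
     (gam (s1 + kap - p.1) (sqnorm (p.2 - x)) *
       (1 ^+ 3 * heat_op u p.2 p.1 + 72 * 1 ^+ 2 * u p.2 p.1))%:E <=
     (kk * (e + 72 * M * (s1 - s0)))%:E)%E.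
  apply: (@le_trans _ _ (\int[st]_(p in tbox `[s0, s1] ball3)
      (kk%:E * ((heat_op u p.2 p.1)%:E + 72%:E * (u p.2 p.1)%:E)))%E); last first.
    rewrite ge0_integralZl //; last 3 first.
    - apply: emeasurable_funD; first exact/measurable_EFinP.
      by apply: emeasurable_funM => //; exact/measurable_EFinP.
    - move=> [s y] [/= /hs16 hs By]; rewrite -EFinM -EFinD lee_fin addr_ge0 ?fB //.
      by rewrite mulr_ge0 ?u_ge0.
    - by rewrite lee_fin ltW.
    rewrite EFinM lee_wpmul2l ?lee_fin ?(ltW kk0) //.
    rewrite ge0_integralD //; last 4 first.
    - by move=> [s y] [/= /hs16 hs By]; rewrite lee_fin fB.
    - exact/measurable_EFinP.
    - by move=> [s y] [/= /hs16 hs By]; rewrite -EFinM lee_fin mulr_ge0 ?u_ge0.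
    - by apply: emeasurable_funM => //; exact/measurable_EFinP.
    rewrite [leRHS]EFinD; apply: leeD => //; rewrite ge0_integralZl //; last 2 first.
    - exact/measurable_EFinP.
    - by move=> [s y] [/= /hs16 hs By]; rewrite lee_fin u_ge0.
    by rewrite -mulrA EFinM lee_wpmul2l // mass_u_slab.
  apply: (@le_trans _ _ (\int[st]_(p in tbox `[s0, s1] [set y : 'rV[R]_n | (sqnorm (y - x) < 1)%R])
      (kk%:E * ((heat_op u p.2 p.1)%:E + 72%:E * (u p.2 p.1)%:E)))%E).
    apply: ge0_le_integral => //.
    - move=> [s y] [/= /hs16 hs /bB By]; rewrite lee_fin !expr1n mul1r mulr1.
      by rewrite mulr_ge0 ?gam_ge0 // addr_ge0 ?fB // mulr_ge0 ?u_ge0.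
    - apply/measurable_EFinP; apply: (@measurable_jcont _ _ (fun y s => gam (s1 + kap - s) (sqnorm (y - x)) *
       (1 ^+ 3 * heat_op u y s + 72 * 1 ^+ 2 * u y s))) => //.
      move=> s y [/= hs _]; have hs' := hs16 _ hs.
      apply: jcontM; first by apply: jcont_gam; move: hs; rewrite in_itv /= => /andP[_ ?]; lra.
      by apply: jcontD; apply: jcontM; [exact: jcont_cst|exact: jcont_heat_op hs'
        |exact: jcont_cst|exact: C21_jcont hs'].
    - apply: emeasurable_funM => //; apply: emeasurable_funD.
        by apply/measurable_EFinP; exact: measurable_heat_op.
      by apply: emeasurable_funM => //; apply/measurable_EFinP; exact: measurable_u.
    - move=> [s y] [/= hs /bB By]; have hs' := hs16 _ hs.
      rewrite -!EFinM lee_fin !expr1n mul1r mulr1.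
      apply: ler_wpM2r; first by rewrite addr_ge0 ?fB // mulr_ge0 ?u_ge0.
      have t0 : 0 < s1 + kap - s by move: hs; rewrite in_itv /= => /andP[_ ?]; lra.
      apply: (le_trans (gam_le t0 (sqnorm_ge0 _))).
      rewrite /kk !powRN lef_pV2 ?posrE ?powR_gt0 //.
      apply: ge0_ler_powR; rewrite ?nnegrE ?divr_ge0 ?(ltW k0) ?(ltW t0) //.
      by move: hs; rewrite in_itv /= => /andP[_ ?]; lra.
  apply: ge0_subset_integral => //.
  - apply: emeasurable_funM => //; apply: emeasurable_funD; first exact/measurable_EFinP.
    by apply: emeasurable_funM => //; exact/measurable_EFinP.
  - move=> [s y] [/= /hs16 hs By]; rewrite -!EFinM lee_fin.
    by rewrite mulr_ge0 ?(ltW kk0) // addr_ge0 ?fB // mulr_ge0 ?u_ge0.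
  - by move=> [s y] [/= hs /bB By]; split.
have := le_trans L1 (le_trans G (leeD L2 L3)); rewrite -EFinD.
have kk16 : 0 < kk / 16 by rewrite divr_gt0.
move=> /(lee_div kk16) /le_trans; apply; rewrite lee_fin.
have -> : (kap / (s1 - s0)) `^ (n%:R / 2) = (s1 - s0) `^ (- (n%:R / 2)) / kk.
  have d0 : 0 <= s1 - s0 by rewrite subr_ge0 ltW.
  rewrite powRM ?invr_ge0 ?(ltW k0) // /kk !powRN invrK mulrC; congr (_ * _).
  by rewrite -powRN -powR_inv1 // -powRrM mulN1r.
by rewrite le_eqVlt; apply/orP; left; apply/eqP; field; rewrite gt_eqF.
Qed.

End local_mass.

(** * Singular integrals in time *)

Section kernel_integrals.
Context {R : realType}.
Local Notation leb := (@lebesgue_measure R).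
Local Notation mR := (measurableTypeR R).

Lemma measurable_invr : measurable_fun setT (@GRing.inv R).
Proof.
rewrite (_ : @GRing.inv R = (fun x => if 0 <= x then x `^ (- 1) else - ((- x) `^ (- 1)))).
  apply: measurable_fun_ifT.
  - by apply: measurable_fun_ler => //; exact: measurable_id.
  - exact: measurable_powR.
  - apply: measurableT_comp => //.
    by apply: (measurableT_comp (measurable_powR (- 1))).
apply/funext => x; case: ifPn => [x0|]; first by rewrite powR_inv1.
by rewrite -ltNge => x0; rewrite powR_inv1 ?oppr_ge0 ?ltW // invrN opprK.
Qed.

(** The integrand may be singular at both ends: the interval is exhausted by closed subintervals,
    where the fundamental theorem applies and the increment of the primitive is at most [K]. *)
Lemma ge0_integral_primitive_le (f F : R -> R) (a b K : R) : a < b ->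
  (forall s, a < s < b -> is_derive s 1 F (f s)) ->
  (forall s, a < s < b -> {for s, continuous f}) ->
  (forall s, a < s < b -> 0 <= f s) ->
  (forall c d, a < c -> c < d -> d < b -> F d - F c <= K) ->
  (\int[leb]_(s in `]a, b[) (f s)%:E <= K%:E)%E.
Proof.
move=> ab dF cf f0 FK.
pose e (k : nat) : R := k.+1%:R^-1.
pose A (k : nat) := `[a + e k, b - e k]%classic.
have Aab k (s : R) : A k s -> a < s < b.
  have k0 : 0 < e k by rewrite /e invr_gt0 ltr0n.
  by rewrite /A /= in_itv /= => /andP[h1 h2]; apply/andP; split; lra.
have -> : `]a, b[%classic = \bigcup_k A k.
  apply/seteqP; split => s; last first.
    by move=> [k _ /Aab]; rewrite /= in_itv.
  rewrite /= in_itv /= => /andP[h1 h2].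
  have d0 : 0 < Num.min (s - a) (b - s) by rewrite lt_min !subr_gt0 h1.
  have [k _ hk] := near_infty_natSinv_lt (PosNum d0).
  have := hk k (leqnn _); rewrite /= lt_min => /andP[k1 k2].
  exists k => //; rewrite /A /= in_itv /= -lerBrDl (ltW k1) /=.
  by rewrite lerBrDr -lerBrDl ltW.
have ndA : {homo A : i j / (i <= j)%N >-> (i <= j)%O}.
  move=> i j ij; apply/subsetPset => s; rewrite /A /= !in_itv /= => /andP[h1 h2].
  have : e j <= e i by rewrite /e lef_pV2 ?posrE ?ltr0n // ler_nat ltnS.
  by move=> h; apply/andP; split; lra.
have mA k : measurable (A k) by exact: measurable_itv.
have mf k : measurable_fun (A k) (fun s => (f s)%:E).
  apply/measurable_EFinP; apply: subspace_continuous_measurable_fun => //.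
  by apply: continuous_in_subspaceT => s; rewrite inE => /Aab /cf.
have fA k s : A k s -> (0 <= (f s)%:E)%E by move=> /Aab /f0; rewrite lee_fin.
have cv := ge0_nondecreasing_set_cvg_integral (mu := leb) ndA mA mf fA.
rewrite -(cvg_lim _ cv) //; apply: lime_le; first by apply/cvg_ex; eexists; exact: cv.
have ab2 : 0 < (b - a) / 2 by rewrite divr_gt0 // subr_gt0.
near=> k; have k0 : 0 < e k by rewrite /e invr_gt0 ltr0n.
have h : a + e k < b - e k.
  have : e k < (b - a) / 2 by near: k; exact: (near_infty_natSinv_lt (PosNum ab2)).
  lra.
have Ain s : a + e k <= s <= b - e k -> a < s < b.
  by move=> hs; apply: (Aab k); rewrite /A /= in_itv.
rewrite (FTC2_cont h (fun s hs => dF s (Ain s hs)) (fun s hs => cf s (Ain s hs))).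
by rewrite -EFinB lee_fin FK //; lra.
Unshelve. all: by end_near. Qed.

Lemma continuous_powR_pos (p x : R) : 0 < x -> {for x, continuous ((@powR R)^~ p)}.
Proof.
move=> x0; apply: differentiable_continuous; apply/derivable1_diffP.
by case: (is_derive1_powR p x0).
Qed.

Lemma is_derive_powR_primitive (p x : R) : -1 < p -> 0 < x ->
  is_derive x 1 (fun z => (p + 1)^-1 * z `^ (p + 1)) (x `^ p).
Proof.
move=> p1 x0; have p10 : p + 1 != 0 by rewrite gt_eqF //; lra.
have H := is_derive_mul (is_derive_const (p + 1)^-1 x 1) (is_derive1_powR (p + 1) x0).
by apply: (is_derive_eq H); rewrite addrK mul0r addr0 mulrA mulVf // mul1r.
Qed.

Lemma integral_powR_left (p a b : R) : -1 < p -> a < b -> b - a <= 1 ->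
  (\int[leb]_(s in `]a, b[) ((s - a) `^ p)%:E <= ((p + 1)^-1)%:E)%E.
Proof.
move=> p1 ab ba1; have p10 : 0 < p + 1 by lra.
have dl (s : R) : is_derive s 1 (fun s => s - a) 1.
  have H := is_derive_add (is_derive_var s) (is_derive_const (- a) s 1).
  by apply: (is_derive_eq H); rewrite addr0.
apply: (@ge0_integral_primitive_le _ (fun s => (p + 1)^-1 * (s - a) `^ (p + 1)) _ _ _ ab).
- move=> s /andP[sa sb]; have sa0 : 0 < s - a by lra.
  have H := is_derive1_comp (g := fun s => s - a) (is_derive_powR_primitive p1 sa0) (dl s).
  by apply: (is_derive_eq H); rewrite mulr1.
- move=> s /andP[sa sb]; have sa0 : 0 < s - a by lra.
  have h : (z - a) @[z --> s] --> s - a by apply: cvgB; [exact: cvg_id|exact: cvg_cst].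
  exact: (cvg_comp _ _ h (continuous_powR_pos sa0)).
- by move=> s _; exact: powR_ge0.
- move=> c d ac cd db; rewrite -mulrBr ler_piMr ?invr_ge0 ?(ltW p10) //.
  have : 0 <= (c - a) `^ (p + 1) by exact: powR_ge0.
  have : (d - a) `^ (p + 1) <= 1.
    apply: (@le_trans _ _ (1 `^ (p + 1))); last by rewrite powR1.
    by apply: ge0_ler_powR; rewrite ?nnegrE; lra.
  lra.
Qed.

Lemma integral_powR_right (p a b : R) : -1 < p -> a < b -> b - a <= 1 ->
  (\int[leb]_(s in `]a, b[) ((b - s) `^ p)%:E <= ((p + 1)^-1)%:E)%E.
Proof.
move=> p1 ab ba1; have p10 : 0 < p + 1 by lra.
have dl (s : R) : is_derive s 1 (fun s => b - s) (- 1).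
  have H := is_derive_add (is_derive_const b s 1)
    (is_derive_mul (is_derive_const (- 1) s 1) (is_derive_var s)).
  rewrite (_ : (fun s => b - s) = (fun s => b + - 1 * s)); last first.
    by apply/funext => r; rewrite mulN1r.
  by apply: (is_derive_eq H); ring.
apply: (@ge0_integral_primitive_le _ (fun s => - 1 * ((p + 1)^-1 * (b - s) `^ (p + 1))) _ _ _ ab).
- move=> s /andP[sa sb]; have sb0 : 0 < b - s by lra.
  have H := is_derive_mul (is_derive_const (- 1) s 1)
    (is_derive1_comp (g := fun s => b - s) (is_derive_powR_primitive p1 sb0) (dl s)).
  by apply: (is_derive_eq H); ring.
- move=> s /andP[sa sb]; have sb0 : 0 < b - s by lra.
  have h : (b - z) @[z --> s] --> b - s by apply: cvgB; [exact: cvg_cst|exact: cvg_id].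
  exact: (cvg_comp _ _ h (continuous_powR_pos sb0)).
- by move=> s _; exact: powR_ge0.
- move=> c d ac cd db; rewrite !mulN1r opprK addrC -mulrBr ler_piMr ?invr_ge0 ?(ltW p10) //.
  have : 0 <= (b - d) `^ (p + 1) by exact: powR_ge0.
  have : (b - c) `^ (p + 1) <= 1.
    apply: (@le_trans _ _ (1 `^ (p + 1))); last by rewrite powR1.
    by apply: ge0_ler_powR; rewrite ?nnegrE; lra.
  lra.
Qed.

Lemma measurable_powR_left (p a : R) : measurable_fun setT (fun s : R => (s - a) `^ p).
Proof.
by apply: (measurableT_comp (measurable_powR p)); apply: measurable_funB.
Qed.

Lemma measurable_powR_right (p b : R) : measurable_fun setT (fun s : R => (b - s) `^ p).
Proof.
by apply: (measurableT_comp (measurable_powR p)); apply: measurable_funB.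
Qed.

(* The product is at most the sum of the two one-sided kernels of exponent a + c. *)
Lemma integral_beta_le (a c s0 s1 : R) : 0 <= a -> 0 <= c -> a + c < 1 ->
  s0 < s1 -> s1 - s0 <= 1 ->
  (\int[leb]_(s in `]s0, s1[) ((s1 - s) `^ (- a) * (s - s0) `^ (- c))%:E <=
   (2 / (1 - (a + c)))%:E)%E.
Proof.
move=> a0 c0 ac1 s01 s011.
have p1 : -1 < - (a + c) by lra.
have mI : measurable (`]s0, s1[%classic : set mR) by exact: measurable_itv.
have m1 : measurable_fun (`]s0, s1[%classic : set mR) (fun s => ((s1 - s) `^ (- (a + c)))%:E).
  by apply/measurable_EFinP; apply: measurable_funTS; exact: measurable_powR_right.
have m2 : measurable_fun (`]s0, s1[%classic : set mR) (fun s => ((s - s0) `^ (- (a + c)))%:E).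
  by apply/measurable_EFinP; apply: measurable_funTS; exact: measurable_powR_left.
apply: (@le_trans _ _ (\int[leb]_(s in `]s0, s1[)
    (((s1 - s) `^ (- (a + c)))%:E + ((s - s0) `^ (- (a + c)))%:E))%E).
  apply: ge0_le_integral => //.
  - by move=> s _; rewrite lee_fin mulr_ge0 ?powR_ge0.
  - apply/measurable_EFinP; apply: measurable_funTS; apply: measurable_funM.
      exact: measurable_powR_right.
    exact: measurable_powR_left.
  - exact: emeasurable_funD.
  move=> s; rewrite /= in_itv /= => /andP[h1 h2]; rewrite -EFinD lee_fin.
  have d1 : 0 < s1 - s by lra.
  have d2 : 0 < s - s0 by lra.
  have key (x y : R) : 0 < x -> x <= y -> x `^ (- a) * y `^ (- c) <= x `^ (- (a + c)) /\
      y `^ (- a) * x `^ (- c) <= x `^ (- (a + c)).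
    move=> x0 xy; have y0 : 0 < y by exact: lt_le_trans xy.
    have le p : 0 <= p -> y `^ (- p) <= x `^ (- p).
      move=> p0; rewrite !powRN lef_pV2 ?posrE ?powR_gt0 //.
      by apply: ge0_ler_powR; rewrite ?nnegrE // ltW.
    have xD : x `^ (- (a + c)) = x `^ (- a) * x `^ (- c).
      by rewrite opprD powRD // (gt_eqF x0) implybT.
    by rewrite xD; split; [rewrite ler_wpM2l ?powR_ge0 ?le|rewrite ler_wpM2r ?powR_ge0 ?le].
  have [h|/ltW h] := leP (s1 - s) (s - s0).
    by have [k _] := key _ _ d1 h; rewrite (le_trans k) // lerDl powR_ge0.
  by have [_ k] := key _ _ d2 h; rewrite (le_trans k) // lerDr powR_ge0.
rewrite ge0_integralD //; last 2 first.
- by move=> s _; rewrite lee_fin powR_ge0.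
- by move=> s _; rewrite lee_fin powR_ge0.
have -> : 2 / (1 - (a + c)) = (- (a + c) + 1)^-1 + (- (a + c) + 1)^-1.
  by field; rewrite gt_eqF //; lra.
rewrite EFinD; apply: leeD; [exact: integral_powR_right|exact: integral_powR_left].
Qed.

End kernel_integrals.

(** * Kernel of the potential and reduction to times before [t] *)

Section potential.
Context {R : realType} {n : nat}.
Local Notation leb := (@lebesgue_measure R).
Local Notation mR := (measurableTypeR R).
Local Notation rv := (@lebesgue_rv R n).
Local Notation st := (leb \x rv)%E.

Variables alpha lambda : R.
Hypothesis n_gt0 : (0 < n)%N.
Hypothesis alpha_gt0 : 0 < alpha.
Hypothesis lambda_gt0 : 0 < lambda.

Let n0 : 0 < n%:R :> R. Proof. by rewrite ltr0n. Qed.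

Let beta : R := alpha / (4 * n%:R).

Let beta_gt0 : 0 < beta. Proof. by rewrite divr_gt0 // mulr_gt0. Qed.

(* Majorant of the power [alpha / n] of the heat kernel. *)
Definition kp (tau q : R) : R := tau `^ (- (alpha / 2)) * expR (- (beta * q / tau)).

Lemma kp_ge0 tau q : 0 <= kp tau q.
Proof. by rewrite mulr_ge0 ?powR_ge0 ?expR_ge0. Qed.

Lemma heat_kernel_pow_le (z : 'rV[R]_n) (tau : R) : 0 < tau ->
  heat_kernel z tau `^ (alpha / n%:R) <= kp tau (sqnorm z).
Proof.
move=> t0; rewrite /heat_kernel t0 powRM ?powR_ge0 ?expR_ge0 //.
have p1 : 1 <= 4 * pi :> R by have := pi_ge2 R; lra.
have pt : 0 < 4 * pi * tau by rewrite mulr_gt0 //; lra.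
apply: ler_pM; rewrite ?powR_ge0 //.
  rewrite -powRrM (_ : - (n%:R / 2) * (alpha / n%:R) = - (alpha / 2)); last first.
    by field; rewrite gt_eqF.
  rewrite !powRN lef_pV2 ?posrE ?powR_gt0 //.
  apply: ge0_ler_powR; rewrite ?nnegrE ?divr_ge0 // ?(ltW t0) ?(ltW alpha_gt0) ?(ltW pt) //.
  by rewrite ler_peMl // ltW.
rewrite -expRM ler_expR /beta le_eqVlt; apply/orP; left; apply/eqP.
by field; rewrite !gt_eqF.
Qed.

(** The inequality [z <= exp z] at [z = c / (tau a)], raised to the power [a], shows that the
    exponential beats [tau^(-a)] with a constant independent of [tau]. *)
Lemma kp_far (tau q : R) : 0 < tau -> 1 / 4 <= q ->
  kp tau q <= (alpha / 2 / (beta / 4)) `^ (alpha / 2).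
Proof.
move=> t0 q4; set a := alpha / 2; set c := beta / 4.
have a0 : 0 < a by rewrite /a divr_gt0.
have c0 : 0 < c by rewrite /c divr_gt0.
have e1 : expR (- (beta * q / tau)) <= expR (- (c / tau)).
  rewrite ler_expR lerN2 ler_pM2r ?invr_gt0 //.
  by have := ler_wpM2l (ltW beta_gt0) q4; rewrite /c; lra.
apply: (@le_trans _ _ (tau `^ (- a) * expR (- (c / tau)))).
  by rewrite ler_wpM2l ?powR_ge0.
have e2 : (c / tau / a) `^ a <= expR (c / tau).
  rewrite (_ : c / tau = c / tau / a * a); last by field; rewrite !gt_eqF.
  rewrite expRM mulfK ?gt_eqF //; apply: ge0_ler_powR.
  - exact: ltW.
  - by rewrite nnegrE !divr_ge0 // ltW.
  - by rewrite nnegrE expR_ge0.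
  by apply: le_trans (expR_ge1Dx _); rewrite lerDr.
rewrite expRN ler_pdivrMr ?expR_gt0 //.
apply: le_trans (ler_wpM2l (powR_ge0 _ _) e2).
have z1 : 0 <= a / c by rewrite divr_ge0 // ltW.
have z2 : 0 <= c / tau / a by rewrite !divr_ge0 // ltW.
rewrite -powRM //.
rewrite (_ : a / c * (c / tau / a) = tau^-1); last by field; rewrite !gt_eqF.
by rewrite -powR_inv1 ?(ltW t0) // -powRrM mulN1r.
Qed.

Lemma measurable_heat_kernel d (T : measurableType d) (f : T -> 'rV[R]_n) (g : T -> mR) x (t : R) :
  measurable_fun setT f -> measurable_fun setT g ->
  measurable_fun setT (fun p => heat_kernel (x - f p) (t - g p) `^ (alpha / n%:R) : mR).
Proof.
move=> mf mg; apply: (measurableT_comp (measurable_powR _)).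
have mt : measurable_fun setT (fun p => t - (g p : R)) by apply: measurable_funB.
apply: measurable_fun_ifT => //.
  by apply: measurable_fun_ltr.
apply: measurable_funM.
  by apply: (measurableT_comp (measurable_powR _)); apply: measurable_funM.
apply: measurableT_comp => //; apply: measurableT_comp => //.
apply: measurable_funM; first exact: measurable_sqnormB.
by apply: (measurableT_comp measurable_invr); apply: measurable_funM.
Qed.

Lemma measurable_kp d (T : measurableType d) (f g : T -> mR) :
  measurable_fun setT f -> measurable_fun setT g ->
  measurable_fun setT (fun p => kp (f p) (g p) : mR).
Proof.
move=> mf mg; apply: measurable_funM; first exact: (measurableT_comp (measurable_powR _)).
apply: measurableT_comp => //; apply: measurableT_comp => //.
apply: measurable_funM; first exact: measurable_funM.
exact: (measurableT_comp measurable_invr).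
Qed.

Variable u : 'rV[R]_n -> R -> R.
Hypothesis Cu : C21 16 u.
Hypothesis u_ge0 : forall x t, 0 < t < 16 -> 0 <= u x t.

Lemma measurable_upow (A : set mR) (B : set 'rV[R]_n) :
  measurable A -> measurable B -> (forall s : R, A s -> 0 < s < 16) ->
  measurable_fun (tbox A B) (fun p => u p.2 p.1 `^ lambda : mR).
Proof.
move=> mA mB h; apply: (measurableT_comp (measurable_powR lambda)).
exact: measurable_u.
Qed.

Lemma int_strip_upow :
  int_strip 16 (fun y s => (u y s `^ lambda)%:E) =
  (\int[st]_(p in tbox `]0%R, 16%R[ setT) (u p.2 p.1 `^ lambda)%:E)%E.
Proof.
have h16 (s : R) : `]0, 16[%classic s -> 0 < s < 16 by rewrite /= in_itv.
rewrite ge0_integral_tbox //.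
- rewrite /int_strip (_ : [set s | _] = `]0, 16[%classic); last first.
    by apply/seteqP; split => s; rewrite /= in_itv.
  apply: eq_integral => s; rewrite inE => /h16 hs; rewrite intRnE //.
    apply/measurable_EFinP; apply: (measurableT_comp (measurable_powR lambda)).
    exact: measurable_u_slice.
  by move=> y; rewrite lee_fin powR_ge0.
- by apply/measurable_EFinP; exact: measurable_upow.
- by move=> p _; rewrite lee_fin powR_ge0.
Qed.

Lemma int_strip_potential_le (x : 'rV[R]_n) (t : R) : 0 < t < 16 ->
  (int_strip 16 (fun y s =>
     (heat_kernel (x - y) (t - s) `^ (alpha / n%:R) * u y s `^ lambda)%:E) <=
   \int[st]_(p in tbox `]0%R, t[ setT)
     (kp (t - p.1) (sqnorm (p.2 - x)) * u p.2 p.1 `^ lambda)%:E)%E.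
Proof.
move=> /andP[t0 t16].
have h16 (s : R) : `]0, t[%classic s -> 0 < s < 16.
  by rewrite /= in_itv /= => /andP[-> h]; exact: lt_trans h t16.
pose K (p : mR * 'rV[R]_n) : R :=
  heat_kernel (x - p.2) (t - p.1) `^ (alpha / n%:R) * u p.2 p.1 `^ lambda.
have mK : measurable_fun (tbox `]0, t[ (setT : set 'rV[R]_n)) (fun p => (K p)%:E).
  apply/measurable_EFinP; apply: measurable_funM; last exact: measurable_upow.
  by apply: measurable_funTS; apply: measurable_heat_kernel.
have K0 p : (0 <= (K p)%:E)%E by rewrite lee_fin mulr_ge0 ?powR_ge0.
have sliceK s : 0 < s < 16 -> measurable_fun setT (fun y => (K (s, y))%:E).
  move=> hs; apply/measurable_EFinP; apply: measurable_funM.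
    by apply: (@measurable_heat_kernel _ _ id (fun=> s)) => //; exact: measurable_id.
  apply: (measurableT_comp (measurable_powR lambda)); exact: measurable_u_slice.
have -> : int_strip 16 (fun y s =>
     (heat_kernel (x - y) (t - s) `^ (alpha / n%:R) * u y s `^ lambda)%:E) =
   (\int[st]_(p in tbox `]0%R, t[ setT) (K p)%:E)%E.
  rewrite ge0_integral_tbox // /int_strip integral_mkcond [RHS]integral_mkcond.
  apply: eq_integral => s _; rewrite !patchE; case: ifPn; last first.
    rewrite notin_setE /= => hs; rewrite memNset //= in_itv /= => /andP[s0 st'].
    by apply: hs; rewrite s0 (lt_trans st').
  rewrite inE /= => hs; rewrite intRnE; last 2 first.
  - exact: (sliceK s hs).
  - by move=> y; exact: (K0 (s, y)).
  case: ifPn; first by [].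
  rewrite notin_setE /= in_itv /= => /negP; rewrite negb_and -!leNgt => h.
  have ts : t <= s by case/andP : hs => s0 _; case/orP : h => //; lra.
  apply: integral0_eq => y _; rewrite /heat_kernel ifF; last first.
    by apply/negbTE; rewrite -leNgt subr_le0.
  (* The heat kernel vanishes for [s >= t], and so does its power because [alpha / n] is nonzero;
     [powR] takes the value 1 at exponent 0. *)
  by rewrite powR0 ?mul0r // mulf_neq0 ?invr_eq0 // gt_eqF.
apply: ge0_le_integral => //.
- exact: measurable_tbox.
- apply/measurable_EFinP; apply: measurable_funM; last exact: measurable_upow.
  apply: measurable_funTS; apply: measurable_kp; first by apply: measurable_funB.
  by apply: measurable_sqnormB.
- move=> [s y] [/=]; rewrite in_itv /= => /andP[s0 st'] _; rewrite lee_fin.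
  rewrite ler_wpM2r ?powR_ge0 // sqnormBC; apply: heat_kernel_pow_le.
  by rewrite subr_gt0.
Qed.

End potential.

(** * Near part of the potential for [lambda < 1] *)

Section near_sublinear.
Context {R : realType} {n : nat}.
Local Notation leb := (@lebesgue_measure R).
Local Notation mR := (measurableTypeR R).
Local Notation rv := (@lebesgue_rv R n).
Local Notation st := (leb \x rv)%E.
Local Notation ball3 := (@ball3 R n).

Lemma measurable_tbox_slice (A : set mR) (B : set 'rV[R]_n) (F : mR * 'rV[R]_n -> \bar R) :
  measurable A -> measurable B -> measurable_fun (tbox A B) F ->
  (forall p, tbox A B p -> 0 <= F p)%E ->
  measurable_fun A (fun s => \int[rv]_(y in B) F (s, y))%E.
Proof.
move=> mA mB mF F0; have mAB := measurable_tbox mA mB.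
have mG : measurable_fun setT (fubini_F rv (F \_ (tbox A B))).
  apply: measurable_fun_fubini_tonelli_F; first exact/(measurable_restrictT _ mAB).
  by move=> p; rewrite patchE; case: ifPn => //; rewrite inE; exact: F0.
apply: (eq_measurable_fun (fubini_F rv (F \_ (tbox A B)))); last exact: measurable_funTS.
move=> s; rewrite inE => hs; rewrite /fubini_F [RHS]integral_mkcond.
apply: eq_integral => y _; rewrite !patchE.
congr (if _ then _ else _).
by apply/idP/idP; rewrite !inE /=; [case|split].
Qed.

Lemma integral_tbox_le (A : set mR) (B : set 'rV[R]_n) (F : mR * 'rV[R]_n -> \bar R)
    (G : mR -> \bar R) :
  measurable A -> measurable B -> measurable_fun (tbox A B) F ->
  (forall p, tbox A B p -> 0 <= F p)%E -> measurable_fun A G ->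
  (forall s, A s -> \int[rv]_(y in B) F (s, y) <= G s)%E ->
  (\int[st]_(p in tbox A B) F p <= \int[leb]_(s in A) G s)%E.
Proof.
move=> mA mB mF F0 mG FG; rewrite ge0_integral_tbox //; apply: ge0_le_integral => //.
  by move=> s As; apply: integral_ge0 => y By; apply: F0.
exact: measurable_tbox_slice.
Qed.

(** Young's inequality by cases: [(k / A)^(1 / (1 - l))] is the value of [v] at which [A v] equals
    [k v^l], and on either side one term of the right-hand side suffices. *)
Lemma young_powR (l k A v : R) : 0 < l < 1 -> 0 <= k -> 0 < A -> 0 <= v ->
  k * v `^ l <= A * v + k * (k / A) `^ (l / (1 - l)).
Proof.
move=> /andP[l0 l1] k0 A0 v0; have l10 : 0 < 1 - l by lra.
have kA0 : 0 <= k / A by rewrite divr_ge0 // ltW.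
have [h|h] := leP v ((k / A) `^ (1 - l)^-1).
  apply: (@le_trans _ _ (k * (k / A) `^ (l / (1 - l)))); last first.
    by rewrite lerDr mulr_ge0 // ltW.
  rewrite ler_wpM2l // [l / _]mulrC powRrM.
  by apply: ge0_ler_powR; rewrite ?nnegrE ?powR_ge0 // ltW.
have vp : 0 < v by apply: le_lt_trans h; exact: powR_ge0.
apply: (@le_trans _ _ (A * v)); last by rewrite lerDl mulr_ge0 ?powR_ge0.
have e1 : k / A <= v `^ (1 - l).
  rewrite -[leLHS]powRr1 // -[X in _ `^ X](@mulVf _ (1 - l)) ?gt_eqF // powRrM.
  by apply: ge0_ler_powR; rewrite ?nnegrE ?powR_ge0 ?(ltW l10) ?(ltW h).
have e2 : k <= v `^ (1 - l) * A by rewrite -ler_pdivrMr.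
apply: (le_trans (ler_wpM2r (powR_ge0 _ _) e2)).
rewrite mulrAC -powRD; last by rewrite (gt_eqF vp) implybT.
by rewrite subrK powRr1 // mulrC.
Qed.

Lemma expR_powR (x p : R) : expR x `^ p = expR (x * p).
Proof. by rewrite expRM. Qed.

(** Radius 5/2 leaves a gap 1/2 on both sides: outside it the kernel is bounded for centres in the
    ball of radius 2, and balls of radius 1/2 about its points stay in [ball3], where masses are
    controlled. *)
Definition ball52 : set 'rV[R]_n := [set y | sqnorm y <= 25 / 4].

Lemma measurable_ball52 : measurable ball52.
Proof.
rewrite (_ : ball52 = [set y | sqnorm (y - 0) <= 25 / 4]); first exact: measurable_sqcball.
by apply/seteqP; split => y; rewrite /ball52 /= subr0.
Qed.

Lemma ball52_ball3 : ball52 `<=` ball3.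
Proof. by move=> y; rewrite /ball52 /ball3 /=; lra. Qed.

Lemma integral_gauss_tau (c tau : R) (x : 'rV[R]_n) : 0 < c -> 0 < tau ->
  (\int[rv]_y (expR (- (c * sqnorm (y - x) / tau)))%:E =
   (Num.sqrt (pi / c) ^+ n * tau `^ (n%:R / 2))%:E)%E.
Proof.
move=> c0 t0.
rewrite (eq_integral (fun y : 'rV[R]_n => (expR (- (c / tau) * sqnorm (y - x)))%:E)); last first.
  by move=> y _; rewrite mulNr mulrAC.
rewrite integral_gauss_rv ?divr_gt0 //; congr EFin.
rewrite (_ : pi / (c / tau) = pi / c * tau); last by field; rewrite !gt_eqF.
rewrite sqrtrM ?divr_ge0 ?pi_ge0 ?(ltW c0) // exprMn; congr (_ * _).
rewrite -powR12_sqrt ?(ltW t0) // -powR_mulrn ?powR_ge0 // -powRrM; congr (_ `^ _).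
by rewrite mulrC.
Qed.

Variables alpha lambda : R.
Hypothesis n_gt0 : (0 < n)%N.
Hypothesis alpha_gt0 : 0 < alpha.
Hypothesis lambda_gt0 : 0 < lambda.
Variable u : 'rV[R]_n -> R -> R.
Hypothesis Cu : C21 16 u.
Hypothesis u_ge0 : forall x t, 0 < t < 16 -> 0 <= u x t.
Variable M : R.
Hypothesis M_ge0 : 0 <= M.
Hypothesis hM : forall s, 0 < s <= 1 -> (\int[rv]_(y in ball3) (u y s)%:E <= M%:E)%E.
Local Notation kp := (@kp R n alpha).

(** Young's inequality with [A = tau^(-nu)] splits the integrand into [tau^(-nu) u], integrable by
    the mass bound when [nu < 1], and a power of [tau] times a Gaussian, whose integral in space is
    of order [tau^(p0 + n/2)]. *)
Lemma near_sublinear : lambda < 1 -> alpha + n%:R * lambda < n%:R + 2 ->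
  exists C, forall (x : 'rV[R]_n) t, 0 < t <= 1 ->
  (\int[st]_(p in tbox `]0%R, t[ ball52)
     (kp (t - p.1) (sqnorm (p.2 - x)) * u p.2 p.1 `^ lambda)%:E <= C%:E)%E.
Proof.
move=> l1 al.
have n0 : 0 < n%:R :> R by rewrite ltr0n.
have l10 : 0 < 1 - lambda by lra.
have ln0 : 1 - lambda != 0 by rewrite gt_eqF.
pose beta := alpha / (4 * n%:R); have beta0 : 0 < beta by rewrite divr_gt0 // mulr_gt0.
(* At [nu = 1] the number [(p0 + n/2 + 1)(1 - lambda)] equals [D], half the gap in the subcritical
   condition; lowering [nu] by [D/2] costs only [lambda D / 2] and leaves both exponents
   integrable. *)
pose D := (n%:R + 2 - alpha - n%:R * lambda) / 2.
have D0 : 0 < D by rewrite /D; lra.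
pose nu := 1 - D / 2; have nu1 : nu < 1 by rewrite /nu; lra.
pose c := beta / (1 - lambda); have c0 : 0 < c by rewrite divr_gt0.
pose p0 := (nu * lambda - alpha / 2) / (1 - lambda).
have p1 : -1 < p0 + n%:R / 2.
  have h : (p0 + n%:R / 2 + 1) * (1 - lambda) = D - lambda * D / 2.
    by rewrite /p0 /nu /D; field.
  have h2 : 0 < (p0 + n%:R / 2 + 1) * (1 - lambda).
    by rewrite h; have : lambda * D < D by [rewrite gtr_pMl]; lra.
  by move: h2; rewrite pmulr_lgt0 // => h2; lra.
have pw (tau q v : R) : 0 < tau -> 0 <= v ->
    kp tau q * v `^ lambda <= tau `^ (- nu) * v + tau `^ p0 * expR (- (c * q / tau)).
  move=> t0 v0; have tn0 : tau != 0 by rewrite gt_eqF.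
  have A0 : 0 < tau `^ (- nu) by rewrite powR_gt0.
  have l01 : 0 < lambda < 1 by rewrite lambda_gt0.
  apply: (le_trans (young_powR l01 (kp_ge0 _ _ _) A0 v0)).
  rewrite lerD2l le_eqVlt; apply/orP; left; apply/eqP.
  rewrite /kp -/beta.
  have -> : tau `^ (- (alpha / 2)) * expR (- (beta * q / tau)) / tau `^ (- nu) =
     tau `^ (nu - alpha / 2) * expR (- (beta * q / tau)).
    rewrite mulrAC; congr (_ * _); rewrite -powRN -powRD ?tn0 ?implybT //.
    by rewrite opprK addrC.
  rewrite powRM ?powR_ge0 ?expR_ge0 // expR_powR -powRrM.
  rewrite mulrACA -powRD ?tn0 ?implybT // -expRD; congr (_ `^ _ * expR _).
    by rewrite /p0; field.
  by rewrite /c; field; rewrite ln0 tn0.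
exists (M * (1 - nu)^-1 + Num.sqrt (pi / c) ^+ n * (p0 + n%:R / 2 + 1)^-1) => x t /andP[t0 t1].
have h16 (s : R) : `]0, t[%classic s -> 0 < s < 16.
  by rewrite /= in_itv /= => /andP[-> h]; lra.
have mN := measurable_ball52.
have mA : measurable (`]0, t[%classic : set mR) by exact: measurable_itv.
have mAN : measurable (tbox `]0, t[ ball52) by exact: measurable_tbox.
have mtau : measurable_fun setT (fun p : mR * 'rV[R]_n => t - p.1 : mR) by apply: measurable_funB.
have msq : measurable_fun setT (fun p : mR * 'rV[R]_n => sqnorm (p.2 - x) : mR).
  by apply: measurable_sqnormB.
have m1 : measurable_fun (tbox `]0, t[ ball52)
    (fun p => ((t - p.1) `^ (- nu) * u p.2 p.1)%:E).
  apply/measurable_EFinP; apply: measurable_funM.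
    by apply: measurable_funTS; exact: (measurableT_comp (measurable_powR _) mtau).
  exact: measurable_u.
have m2T : measurable_fun setT (fun p : mR * 'rV[R]_n =>
    ((t - p.1) `^ p0 * expR (- (c * sqnorm (p.2 - x) / (t - p.1))))%:E).
  apply/measurable_EFinP; apply: measurable_funM.
    exact: (measurableT_comp (measurable_powR _) mtau).
  apply: measurableT_comp => //; apply: measurableT_comp => //.
  apply: measurable_funM; first exact: measurable_funM.
  exact: (measurableT_comp measurable_invr mtau).
have m2 D' : measurable D' -> measurable_fun D' (fun p : mR * 'rV[R]_n =>
    ((t - p.1) `^ p0 * expR (- (c * sqnorm (p.2 - x) / (t - p.1))))%:E).
  by move=> mD'; apply: measurable_funTS.
apply: (@le_trans _ _ (\int[st]_(p in tbox `]0%R, t[ ball52)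
   (((t - p.1) `^ (- nu) * u p.2 p.1)%:E +
    ((t - p.1) `^ p0 * expR (- (c * sqnorm (p.2 - x) / (t - p.1))))%:E))%E).
  apply: ge0_le_integral => //.
  - by move=> [s y] _; rewrite lee_fin mulr_ge0 ?kp_ge0 ?powR_ge0.
  - apply/measurable_EFinP; apply: measurable_funM; last exact: measurable_upow.
    by apply: measurable_funTS; apply: measurable_kp.
  - by apply: emeasurable_funD => //; exact: m2.
  - move=> [s y] [/= hs Ny]; rewrite -EFinD lee_fin; apply: pw.
      by move: hs; rewrite in_itv /= => /andP[_ ?]; rewrite subr_gt0.
    by rewrite u_ge0 // h16.
rewrite ge0_integralD //; last 3 first.
- move=> [s y] [/= hs Ny]; rewrite lee_fin mulr_ge0 ?powR_ge0 // u_ge0 //; exact: h16.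
- by move=> [s y] _; rewrite lee_fin mulr_ge0 ?powR_ge0 ?expR_ge0.
- exact: m2.
rewrite EFinD; apply: leeD.
  apply: (@le_trans _ _ (\int[leb]_(s in `]0%R, t[) (M%:E * ((t - s) `^ (- nu))%:E))%E).
    apply: integral_tbox_le => //.
    - move=> [s y] [/= hs Ny]; rewrite lee_fin mulr_ge0 ?powR_ge0 // u_ge0 //; exact: h16.
    - apply: emeasurable_funM => //; apply/measurable_EFinP; apply: measurable_funTS.
      exact: measurable_powR_right.
    move=> s hs; have hs16 := h16 _ hs; have us := measurable_u_slice Cu hs16.
    rewrite (eq_integral (fun y => ((t - s) `^ (- nu))%:E * (u y s)%:E)%E) //.
    rewrite ge0_integralZl //=; last 3 first.
    - by apply/measurable_EFinP; exact: measurable_funTS.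
    - by move=> y _; rewrite lee_fin u_ge0.
    - by rewrite lee_fin powR_ge0.
    rewrite muleC lee_wpmul2r ?lee_fin ?powR_ge0 //.
    apply: (@le_trans _ _ (\int[rv]_(y in ball3) (u y s)%:E)%E); last first.
      by apply: hM; move: hs; rewrite /= in_itv /= => /andP[-> ?]; lra.
    apply: ge0_subset_integral => //.
    - exact: measurable_ball3.
    - by apply/measurable_EFinP; exact: measurable_funTS.
    - by move=> y _; rewrite lee_fin u_ge0.
    - exact: ball52_ball3.
  rewrite ge0_integralZl //; last 2 first.
  - by apply/measurable_EFinP; apply: measurable_funTS; exact: measurable_powR_right.
  - by move=> s _; rewrite lee_fin powR_ge0.
  rewrite EFinM lee_wpmul2l ?lee_fin // [1 - nu]addrC.
  by apply: integral_powR_right => //; lra.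
apply: (@le_trans _ _ (\int[st]_(p in tbox `]0%R, t[ setT)
    ((t - p.1) `^ p0 * expR (- (c * sqnorm (p.2 - x) / (t - p.1))))%:E)%E).
  apply: ge0_subset_integral => //.
  - exact: measurable_tbox.
  - by apply: m2; exact: measurable_tbox.
  - by move=> [s y] _; rewrite lee_fin mulr_ge0 ?powR_ge0 ?expR_ge0.
  - by move=> [s y] [/= hs _]; split.
apply: (@le_trans _ _ (\int[leb]_(s in `]0%R, t[)
    ((Num.sqrt (pi / c) ^+ n)%:E * ((t - s) `^ (p0 + n%:R / 2))%:E))%E).
  apply: integral_tbox_le => //.
  - by apply: m2; exact: measurable_tbox.
  - by move=> [s y] _; rewrite lee_fin mulr_ge0 ?powR_ge0 ?expR_ge0.
  - apply: emeasurable_funM => //; apply/measurable_EFinP; apply: measurable_funTS.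
    exact: measurable_powR_right.
  move=> s; rewrite /= in_itv /= => /andP[s0 st'].
  have t0' : 0 < t - s by rewrite subr_gt0.
  rewrite (eq_integral (fun y : 'rV[R]_n => ((t - s) `^ p0)%:E *
    (expR (- (c * sqnorm (y - x) / (t - s))))%:E)%E) //.
  rewrite ge0_integralZl //=; last 2 first.
  - apply/measurable_EFinP; apply: measurableT_comp => //; apply: measurableT_comp => //.
    apply: measurable_funM => //; apply: measurable_funM => //.
    by apply: measurable_sqnormB => //; exact: measurable_id.
  - by rewrite lee_fin powR_ge0.
  have tn0' : t - s != 0 by rewrite gt_eqF.
  rewrite integral_gauss_tau // -!EFinM lee_fin powRD ?tn0' ?implybT //.
  by rewrite mulrCA.
rewrite ge0_integralZl //; last 2 first.
- by apply/measurable_EFinP; apply: measurable_funTS; exact: measurable_powR_right.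
- by move=> s _; rewrite lee_fin powR_ge0.
rewrite EFinM lee_wpmul2l ?lee_fin ?exprn_ge0 ?sqrtr_ge0 //.
by apply: integral_powR_right => //; lra.
Qed.

End near_sublinear.

(** * Near part of the potential for [lambda >= 1] *)

Section spacetime.
Context {R : realType} (n : nat).

(* A named copy of the product measure, so that it can carry the
   sigma-finiteness required by a further use of Tonelli's theorem. *)
Definition lebesgue_st : set (measurableTypeR R * 'rV[R]_n)%type -> \bar R :=
  (@lebesgue_measure R \x @lebesgue_rv R n)%E.

HB.instance Definition _ := Measure.on lebesgue_st.
HB.instance Definition _ := Measure_isSigmaFinite.Build _ _ _ lebesgue_st
  (sigma_finite_product (@lebesgue_measure R) (@lebesgue_rv R n)).

End spacetime.

Section near_superlinear.
Context {R : realType} {n : nat}.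
Local Notation leb := (@lebesgue_measure R).
Local Notation mR := (measurableTypeR R).
Local Notation rv := (@lebesgue_rv R n).
Local Notation st := (@lebesgue_st R n).
Local Notation ball3 := (@ball3 R n).
Local Notation ball52 := (@ball52 R n).
Local Notation gam := (@gam R n).

(** The extension by 0 turns the source potential into an integral over all of space-time, so that
    Tonelli's theorem applies without a domain depending on the outer variable. *)
Definition gam0 (tau r : R) : R := if 0 < tau then gam tau r else 0.

Lemma gam0_ge0 tau r : 0 <= gam0 tau r.
Proof. by rewrite /gam0; case: ifP => // _; exact: gam_ge0. Qed.

Lemma measurable_gam0 d (T : measurableType d) (f g : T -> mR) :
  measurable_fun setT f -> measurable_fun setT g ->
  measurable_fun setT (fun p => gam0 (f p) (g p) : mR).
Proof.
move=> mf mg; apply: measurable_fun_ifT => //; first by apply: measurable_fun_ltr.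
apply: measurable_funM; first exact: (measurableT_comp (measurable_powR _)).
apply: measurableT_comp => //; apply: measurableT_comp => //.
apply: measurable_funM => //.
by apply: (measurableT_comp measurable_invr); apply: measurable_funM.
Qed.

Lemma integral_gam_pow (l tau : R) (z : 'rV[R]_n) : 0 < l -> 0 < tau ->
  (\int[rv]_y (gam0 tau (sqnorm (z - y)) `^ l)%:E =
   (Num.sqrt (pi / (l / 8)) ^+ n * tau `^ (- (n%:R * (l - 1) / 2)))%:E)%E.
Proof.
move=> l0 t0; have l80 : 0 < l / 8 by rewrite divr_gt0.
rewrite (eq_integral (fun y : 'rV[R]_n => (tau `^ (- (n%:R * l / 2)))%:E *
   (expR (- (l / 8 * sqnorm (y - z) / tau)))%:E)%E); last first.
  move=> y _; rewrite -EFinM /gam0 t0 /gam powRM ?powR_ge0 ?expR_ge0 //.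
  rewrite -powRrM expR_powR; congr (_ `^ _ * expR _)%:E; first by field.
  by rewrite sqnormBC; field; rewrite gt_eqF.
rewrite ge0_integralZl //=; last 2 first.
- apply/measurable_EFinP; apply: measurableT_comp => //; apply: measurableT_comp => //.
  apply: measurable_funM => //; apply: measurable_funM => //.
  by apply: measurable_sqnormB => //; exact: measurable_id.
- by rewrite lee_fin powR_ge0.
rewrite integral_gauss_tau // -EFinM mulrCA -powRD; last by rewrite (gt_eqF t0) implybT.
by congr (_ * _ `^ _)%:E; field.
Qed.

(** If [g > w], then [(g / w)^(l - 1) >= 1]. *)
Lemma threshold_powR (l w g : R) : 1 <= l -> 0 < w -> 0 <= g ->
  g <= w + w `^ (1 - l) * g `^ l.
Proof.
move=> l1 w0 g0; have [h|h] := leP g w.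
  by apply: (le_trans h); rewrite lerDl mulr_ge0 ?powR_ge0.
have gp : 0 < g by exact: lt_trans h.
apply: (@le_trans _ _ (w `^ (1 - l) * g `^ l)); last by rewrite lerDr ltW.
have -> : g `^ l = g * g `^ (l - 1).
  by rewrite -{2}(powRr1 g0) -powRD ?(gt_eqF gp) ?implybT // addrC subrK.
rewrite mulrCA ler_peMr // -[1 - l]opprB powRN mulrC ler_pdivlMr ?powR_gt0 //.
by rewrite mul1r; apply: ge0_ler_powR; rewrite ?nnegrE ?subr_ge0 // ltW.
Qed.

Variables alpha lambda : R.
Hypothesis n_gt0 : (0 < n)%N.
Hypothesis alpha_gt0 : 0 < alpha.
Variable u : 'rV[R]_n -> R -> R.
Hypothesis Cu : C21 16 u.
Hypothesis u_ge0 : forall x t, 0 < t < 16 -> 0 <= u x t.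
Hypothesis f_ge0 : forall x t, sqnorm x < 16 -> 0 < t < 16 -> 0 <= heat_op u x t.
Variables M Mf : R.
Hypothesis M_ge0 : 0 <= M.
Hypothesis Mf_ge0 : 0 <= Mf.
Hypothesis hM : forall s, 0 < s <= 1 -> (\int[rv]_(y in ball3) (u y s)%:E <= M%:E)%E.
Hypothesis hMf :
  (\int[st]_(p in tbox `]0%R, 1%R] ball3) (heat_op u p.2 p.1)%:E <= Mf%:E)%E.

Let D1 : set (mR * 'rV[R]_n) := tbox `]0%R, 1%R] ball3.
Let mD1 : measurable D1.
Proof. by apply: measurable_tbox => //; exact: measurable_ball3. Qed.

Let D1in s y : D1 (s, y) -> 0 < s < 16 /\ ball3 y.
Proof. by move=> [/=]; rewrite in_itv /= => /andP[-> h] By; split => //; lra. Qed.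

Let f9 y s : ball3 y -> 0 < s < 16 -> 0 <= heat_op u y s.
Proof. by move=> By hs; rewrite f_ge0 // (le_lt_trans By) //; lra. Qed.

Definition ub : mR * 'rV[R]_n -> R := (fun p => u p.2 p.1) \_ (tbox `]0%R, 1%R] ball3).
(** For [b = 1/4] the integrand [b^3 f + 72 b^2 u] of [pole_ineq] is [b^3 (f + 72 * 4 u)], and [b^3]
    divides out. *)
Definition gb : mR * 'rV[R]_n -> R :=
  (fun p => heat_op u p.2 p.1 + 72 * 4 * u p.2 p.1) \_ (tbox `]0%R, 1%R] ball3).

Lemma ub_ge0 p : 0 <= ub p.
Proof.
rewrite /ub patchE; case: ifPn => //; rewrite inE; case: p => s y.
by move=> /D1in [hs _]; rewrite u_ge0.
Qed.

Lemma gb_ge0 p : 0 <= gb p.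
Proof.
rewrite /gb patchE; case: ifPn => //; rewrite inE; case: p => s y.
by move=> /D1in [hs By]; rewrite addr_ge0 ?f9 // mulr_ge0 // u_ge0.
Qed.

Let A1 (s : R) : `]0, 1]%classic s -> 0 < s < 16.
Proof. by rewrite /= in_itv /= => /andP[-> h]; lra. Qed.

Lemma measurable_ub : measurable_fun setT (ub : _ -> mR).
Proof.
apply/(measurable_restrictT _ mD1); apply: measurable_u => //.
exact: measurable_ball3.
Qed.

Lemma measurable_gb : measurable_fun setT (gb : _ -> mR).
Proof.
apply/(measurable_restrictT _ mD1); apply: measurable_funD.
  by apply: measurable_heat_op => //; exact: measurable_ball3.
by apply: measurable_funM => //; apply: measurable_u => //; exact: measurable_ball3.
Qed.

Let ge0_288 : 0 <= 72 * 4 :> R. Proof. by rewrite mulr_ge0. Qed.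

(** The summand 1 makes [Mg] positive, since it serves as a divisor. *)
Let Mg : R := Mf + 72 * 4 * M + 1.
Let Mg_gt0 : 0 < Mg. Proof. by rewrite /Mg ltr_wpDl // addr_ge0 // mulr_ge0. Qed.

Lemma integral_gb : (\int[st]_p (gb p)%:E <= Mg%:E)%E.
Proof.
rewrite (_ : (fun p => (gb p)%:E) =
   (fun p => (heat_op u p.2 p.1)%:E + (72 * 4)%:E * (u p.2 p.1)%:E)%E \_ D1); last first.
  by apply/funext => p; rewrite /gb !patchE; case: ifPn.
rewrite -integral_mkcond.
have mf : measurable_fun D1 (fun p => (heat_op u p.2 p.1)%:E).
  by apply/measurable_EFinP; apply: measurable_heat_op => //; exact: measurable_ball3.
have mu : measurable_fun D1 (fun p => (u p.2 p.1)%:E).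
  by apply/measurable_EFinP; apply: measurable_u => //; exact: measurable_ball3.
rewrite ge0_integralD //; last 3 first.
- by move=> [s y] /D1in [hs By]; rewrite lee_fin f9.
- by move=> [s y] /D1in [hs By]; rewrite -EFinM lee_fin mulr_ge0 // u_ge0.
- exact: emeasurable_funM.
apply: (@le_trans _ _ (Mf%:E + (72 * 4 * M)%:E)%E); last by rewrite -EFinD lee_fin /Mg lerDl.
apply: leeD => //; rewrite ge0_integralZl //; last first.
- by move=> [s y] /D1in [hs By]; rewrite lee_fin u_ge0.
rewrite [leRHS]EFinM; apply: lee_wpmul2l; first by rewrite lee_fin.
apply: (@le_trans _ _ (\int[leb]_(s in `]0%R, 1%R]) (cst M%:E) s)%E).
  apply: integral_tbox_le => //.
  - exact: measurable_ball3.
  - by move=> [s y] /D1in [hs By]; rewrite lee_fin u_ge0.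
rewrite integral_cst //= lebesgue_measure_itv /= lte_fin ltr01 -EFinB subr0.
by rewrite mule1.
Qed.

(** Contribution of the slice at time [s/2]: halving the time keeps the kernel below [(s/2)^(-n/2)].
    In [Spot] the exponent 1 gives the source term of the Duhamel inequality, and [lambda] the
    potential that replaces its power. *)
Definition Ppot (p : mR * 'rV[R]_n) : \bar R :=
  (\int[rv]_z (gam0 (p.1 / 2) (sqnorm (z - p.2)) * ub ((p.1 / 2)%R, z))%:E)%E.
Definition Spot (l : R) (p : mR * 'rV[R]_n) : \bar R :=
  (\int[st]_q (gam0 (p.1 - q.1) (sqnorm (q.2 - p.2)) `^ l * gb q)%:E)%E.

Let c := @pole_const R n.
Let c_gt0 : 0 < c. Proof. exact: pole_const_gt0. Qed.

Lemma u_le_PS (y : 'rV[R]_n) s : ball52 y -> 0 < s <= 1 ->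
  ((c * u y s)%:E <= Ppot (s, y) + Spot 1 (s, y))%E.
Proof.
move=> Ny /andP[s0 s1].
have b0 : 0 < 1 / 4 :> R by [].
have bB9 z : sqnorm (z - y) < 1 / 4 -> ball3 z.
  (* [eta = 1/5] is sharp: it turns [5/2 + 1/2] into the radius 3. *)
  move=> h; have h5 : 0 < 1 / 5 :> R by lra.
  have := sqnorm_near y z h5; rewrite invf_div /ball3 /=; move: Ny; rewrite /ball52 /=; lra.
have bB z : sqnorm (z - y) < 1 / 4 -> sqnorm z < 16.
  by move=> /bB9; rewrite /ball3 /=; lra.
have s20 : 0 < s / 2 by lra.
have s2s : s / 2 < s by lra.
have s16 : s < 16 by lra.
have G := pole_ineq Cu u_ge0 f_ge0 b0 bB s20 s2s s16.
set b3 : R := (1 / 4) ^+ 3; have b30 : 0 < b3 by rewrite exprn_gt0.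
rewrite -(@lee_pmul2l _ b3%:E) //.
rewrite -EFinM mulrA [b3 * c]mulrC; apply: (le_trans G).
have P0 : (0 <= Ppot (s, y))%E.
  by apply: integral_ge0 => z _; rewrite lee_fin mulr_ge0 ?gam0_ge0 ?ub_ge0.
have S0 : (0 <= Spot 1 (s, y))%E.
  by apply: integral_ge0 => z _; rewrite lee_fin mulr_ge0 ?powR_ge0 ?gb_ge0.
rewrite ge0_muleDr //; apply: leeD.
  have mP : measurable_fun setT (fun z : 'rV[R]_n =>
      (gam0 (s / 2) (sqnorm (z - y)) * ub ((s / 2)%R, z))%:E).
    apply/measurable_EFinP; apply: measurable_funM.
      by apply: measurable_gam0 => //; apply: measurable_sqnormB => //; exact: measurable_id.
    exact: (measurableT_comp measurable_ub (pair1_measurable (s / 2 : mR))).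
  rewrite -ge0_integralZl //; last 2 first.
  - by move=> z _; rewrite lee_fin mulr_ge0 ?gam0_ge0 ?ub_ge0.
  - by rewrite lee_fin ltW.
  rewrite [leLHS]integral_mkcond; apply: ge0_le_integral => //.
  - move=> z _; rewrite patchE; case: ifPn => // _; rewrite lee_fin.
    rewrite mulr_ge0 ?(ltW b30) // mulr_ge0 ?gam_ge0 // u_ge0 // s20; lra.
  - apply/(measurable_restrictT _ (measurable_sqball y (1 / 4))).
    apply/measurable_EFinP; apply: measurable_funTS.
    apply: (@measurable_slice _ _ (fun z t => (1 / 4) ^+ 3 * (gam (s - t) (sqnorm (z - y)) * u z t))) => z.
    apply: jcontM; first exact: jcont_cst.
    by apply: jcontM; [exact: jcont_gam|apply: (C21_jcont Cu); rewrite s20; lra].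
  - exact: emeasurable_funM.
  - move=> z _; rewrite patchE; case: ifPn; last first.
      by move=> _; rewrite -EFinM lee_fin !mulr_ge0 ?gam0_ge0 ?ub_ge0 // ltW.
    rewrite inE /= => hz; rewrite -EFinM lee_fin -/b3 ler_wpM2l ?(ltW b30) //.
    rewrite /ub patchE mem_set; last first.
      by split => /=; [rewrite in_itv /= s20; lra|exact: bB9].
    by rewrite /gam0 s20 /= (_ : s - s / 2 = s / 2); last by field.
have mS : measurable_fun setT (fun q : mR * 'rV[R]_n =>
    (gam0 (s - q.1) (sqnorm (q.2 - y)) `^ 1 * gb q)%:E).
  apply/measurable_EFinP; apply: measurable_funM; last exact: measurable_gb.
  apply: (measurableT_comp (measurable_powR 1)); apply: measurable_gam0.
    exact: measurable_funB.
  by apply: measurable_sqnormB.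
rewrite -ge0_integralZl //; last 2 first.
- by move=> q _; rewrite lee_fin mulr_ge0 ?powR_ge0 ?gb_ge0.
- by rewrite lee_fin ltW.
have mD : measurable (tbox `[s / 2, s[ [set z : 'rV[R]_n | sqnorm (z - y) < 1 / 4]).
  by apply: measurable_tbox => //; exact: measurable_sqball.
have hD t z : tbox `[s / 2, s[ [set z : 'rV[R]_n | sqnorm (z - y) < 1 / 4] (t, z) ->
    [/\ 0 < t < 16, t < s, t <= 1 & ball3 z].
  by move=> [/=]; rewrite in_itv /= => /andP[h1 h2] /bB9 Bz; split => //; lra.
rewrite [leLHS]integral_mkcond; apply: ge0_le_integral => //.
- move=> [t z] _; rewrite patchE; case: ifPn => //; rewrite inE => /hD [ht _ _ Bz].
  rewrite lee_fin mulr_ge0 ?gam_ge0 // addr_ge0 //.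
    by rewrite mulr_ge0 ?f9 // ltW.
  by rewrite mulr_ge0 ?u_ge0.
- apply/(measurable_restrictT _ mD); apply/measurable_EFinP.
  apply: (@measurable_jcont _ _ (fun z t => gam (s - t) (sqnorm (z - y)) *
    ((1 / 4) ^+ 3 * heat_op u z t + 72 * (1 / 4) ^+ 2 * u z t))) => //.
  move=> t z /hD [ht ts _ _]; apply: jcontM; first exact: jcont_gam.
  by apply: jcontD; apply: jcontM; [exact: jcont_cst|exact: jcont_heat_op ht
        |exact: jcont_cst|exact: C21_jcont ht].
- exact: emeasurable_funM.
- move=> [t z] _; rewrite patchE; case: ifPn; last first.
    by move=> _; rewrite -EFinM lee_fin !mulr_ge0 ?powR_ge0 ?gb_ge0 // ltW.
  rewrite inE => /hD [ht ts t1 Bz]; rewrite -EFinM lee_fin /=.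
  have t0 : 0 < t by case/andP : ht.
  rewrite /gb patchE mem_set; last by split => //=; rewrite in_itv /= t0.
  rewrite /gam0 subr_gt0 ts powRr1 ?gam_ge0 // /b3 le_eqVlt; apply/orP; left; apply/eqP.
  by rewrite /=; field.
Qed.

Lemma integral_ub s : 0 < s <= 1 -> (\int[rv]_z (ub (s, z))%:E <= M%:E)%E.
Proof.
move=> hs; apply: le_trans (hM hs); rewrite [leRHS]integral_mkcond.
rewrite le_eqVlt; apply/orP; left; apply/eqP; apply: eq_integral => z _.
rewrite /ub !patchE; have -> : ((s, z) \in tbox `]0%R, 1%R] ball3) = (z \in ball3).
  by apply/idP/idP; rewrite !inE; [case|split => //=; rewrite in_itv].
by case: ifP.
Qed.

Lemma Ppot_sup s y : 0 < s <= 1 -> (Ppot (s, y) <= ((s / 2) `^ (- (n%:R / 2)) * M)%:E)%E.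
Proof.
move=> /andP[s0 s1]; have s20 : 0 < s / 2 by lra.
have s2 : 0 < s / 2 <= 1 by rewrite s20; lra.
have mub : measurable_fun setT (fun z : 'rV[R]_n => (ub ((s / 2)%R, z))%:E).
  apply/measurable_EFinP.
  exact: (measurableT_comp measurable_ub (pair1_measurable (s / 2 : mR))).
rewrite EFinM; apply: (le_trans _ (lee_wpmul2l _ (integral_ub s2))); last first.
  by rewrite lee_fin powR_ge0.
rewrite -ge0_integralZl //; last 2 first.
- by move=> z _; rewrite lee_fin ub_ge0.
- by rewrite lee_fin powR_ge0.
apply: ge0_le_integral => //.
- by move=> z _; rewrite lee_fin mulr_ge0 ?gam0_ge0 ?ub_ge0.
- apply/measurable_EFinP; apply: measurable_funM; last exact/measurable_EFinP.
  by apply: measurable_gam0 => //; apply: measurable_sqnormB => //; exact: measurable_id.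
- exact: emeasurable_funM.
- move=> z _; rewrite -EFinM lee_fin ler_wpM2r ?ub_ge0 // /gam0 /= s20.
  by apply: gam_le => //; exact: sqnorm_ge0.
Qed.

(** [eps] is the time exponent in [integral_gam_pow] for the power [lambda]. The constants [C2] and
    [C3] belong to the cases where [Ppot], respectively [Spot 1], carries half of [c u]. *)
Let eps : R := n%:R * (lambda - 1) / 2.
Let C2 : R := 2 / c * ((2 / c * M) `^ (lambda - 1) * 2 `^ eps).
Let C3 : R := (c / 4 * (c / (4 * Mg)) `^ (lambda - 1))^-1.

Let C2_ge0 : 0 <= C2.
Proof. by rewrite /C2 !mulr_ge0 ?powR_ge0 // invr_ge0 ltW. Qed.

Let C3_gt0 : 0 < C3.
Proof. by rewrite /C3 invr_gt0 mulr_gt0 ?powR_gt0 ?divr_gt0 // mulr_gt0. Qed.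

(* Either [Ppot] or [Spot 1] dominates in [u_le_PS]. In the second case
   [threshold_powR], at the level [w] that leaves half of [Spot 1], replaces
   Jensen's inequality. *)
Lemma upow_le (y : 'rV[R]_n) s : 1 <= lambda -> ball52 y -> 0 < s <= 1 ->
  ((u y s `^ lambda)%:E <=
    (C2 * s `^ (- eps))%:E * Ppot (s, y) + C3%:E * Spot lambda (s, y))%E.
Proof.
move=> l1 Ny hs; have [s0 s1] := andP hs.
have l10 : 0 <= lambda - 1 by rewrite subr_ge0.
have U0 : 0 <= u y s by rewrite u_ge0 // s0; lra.
have P0 : (0 <= Ppot (s, y))%E.
  by apply: integral_ge0 => z _; rewrite lee_fin mulr_ge0 ?gam0_ge0 ?ub_ge0.
have S0 l : (0 <= Spot l (s, y))%E.
  by apply: integral_ge0 => z _; rewrite lee_fin mulr_ge0 ?powR_ge0 ?gb_ge0.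
have CP0 : (0 <= (C2 * s `^ (- eps))%:E * Ppot (s, y))%E.
  by rewrite mule_ge0 // lee_fin mulr_ge0 ?powR_ge0.
have CS0 : (0 <= C3%:E * Spot lambda (s, y))%E by rewrite mule_ge0 // lee_fin ltW.
have [Uz|Un] := eqVneq (u y s) 0.
  rewrite Uz powR0; first exact: adde_ge0.
  by rewrite gt_eqF // (lt_le_trans ltr01).
have Up : 0 < u y s by rewrite lt_neqAle eq_sym Un.
have UE : u y s `^ lambda = u y s * u y s `^ (lambda - 1).
  by rewrite -{2}(powRr1 U0) -powRD ?(gt_eqF Up) ?implybT // addrC subrK.
have main := u_le_PS Ny hs.
have Psup := Ppot_sup y hs.
have cU4 : 0 < c * u y s / 2 by rewrite divr_gt0 // mulr_gt0.
have [hP|hP] := leP (c * u y s / 2)%:E (Ppot (s, y)).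
  apply: (@le_trans _ _ ((C2 * s `^ (- eps))%:E * Ppot (s, y))%E); last by rewrite leeDl.
  have U1 : u y s <= 2 / c * ((s / 2) `^ (- (n%:R / 2)) * M).
    have := le_trans hP Psup; rewrite lee_fin ler_pdivrMr // mulrC -ler_pdivlMr //.
    by move=> h; rewrite (le_trans h) // le_eqVlt; apply/orP; left; apply/eqP; field; rewrite gt_eqF.
  (* One factor [u] will be bounded by [Ppot] itself and the power [lambda - 1] by the supremum of
     [Ppot], which produces [s^(-eps)]. *)
  have U2 : u y s `^ (lambda - 1) <= (2 / c * M) `^ (lambda - 1) * 2 `^ eps * s `^ (- eps).
    have h20 : 0 <= 2 / c * M by rewrite mulr_ge0 // divr_ge0 // ltW.
    apply: (@le_trans _ _ ((2 / c * ((s / 2) `^ (- (n%:R / 2)) * M)) `^ (lambda - 1))).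
      apply: ge0_ler_powR; rewrite ?nnegrE //.
      by rewrite mulr_ge0 ?divr_ge0 ?(ltW c_gt0) // mulr_ge0 ?powR_ge0.
    rewrite (_ : 2 / c * (_ * M) = (2 / c * M) * (s / 2) `^ (- (n%:R / 2))); last by ring.
    rewrite powRM ?powR_ge0 // -[leRHS]mulrA ler_wpM2l ?powR_ge0 //.
    rewrite -powRrM powRM ?invr_ge0 ?(ltW s0) // mulrC.
    rewrite (_ : - (n%:R / 2) * (lambda - 1) = - eps); last by rewrite /eps; field.
    by rewrite -[2^-1]powR_inv1 // -powRrM mulN1r opprK.
  have U3 : ((u y s)%:E <= (2 / c)%:E * Ppot (s, y))%E.
    rewrite -[2 / c]invf_div lee_pdivlMl ?divr_gt0 // -EFinM.
    by rewrite (_ : c / 2 * u y s = c * u y s / 2) //; ring.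
  rewrite UE mulrC EFinM; apply: (@le_trans _ _
    (((2 / c * M) `^ (lambda - 1) * 2 `^ eps * s `^ (- eps))%:E * ((2 / c)%:E * Ppot (s, y)))%E).
    by apply: lee_pmul => //; rewrite lee_fin ?powR_ge0.
  rewrite muleA -EFinM /C2 le_eqVlt; apply/orP; left; apply/eqP.
  by congr (_%:E * _)%E; ring.
apply: (@le_trans _ _ (C3%:E * Spot lambda (s, y))%E); last by rewrite leeDr.
have hS : ((c * u y s / 2)%:E <= Spot 1 (s, y))%E.
  move: main hP; case: (Ppot (s, y)) P0 => [r||] // r0.
  case: (Spot 1 (s, y)) (S0 1) => [q||] // q0; last by move=> _ _; exact: leey.
  by rewrite -EFinD !lee_fin lte_fin => h1 h2; lra.
pose w := c * u y s / (4 * Mg).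
have w0 : 0 < w by rewrite divr_gt0 // mulr_gt0.
have mgk l : measurable_fun setT (fun q : mR * 'rV[R]_n =>
    (gam0 (s - q.1) (sqnorm (q.2 - y)) `^ l * gb q)%:E).
  apply/measurable_EFinP; apply: measurable_funM; last exact: measurable_gb.
  apply: (measurableT_comp (measurable_powR l)); apply: measurable_gam0.
    exact: measurable_funB.
  by apply: measurable_sqnormB.
have mgb : measurable_fun setT (fun q => (gb q)%:E) by apply/measurable_EFinP; exact: measurable_gb.
have hS2 : (Spot 1 (s, y) <= (c * u y s / 4)%:E + (w `^ (1 - lambda))%:E * Spot lambda (s, y))%E.
  apply: (@le_trans _ _ (w%:E * \int[st]_q (gb q)%:E + (w `^ (1 - lambda))%:E * Spot lambda (s, y))%E).
    rewrite -ge0_integralZl //; last 2 first.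
    - by move=> q _; rewrite lee_fin gb_ge0.
    - by rewrite lee_fin ltW.
    rewrite -ge0_integralZl //; last 2 first.
    - by move=> q _; rewrite lee_fin mulr_ge0 ?powR_ge0 ?gb_ge0.
    - by rewrite lee_fin powR_ge0.
    rewrite -ge0_integralD //; last 4 first.
    - by move=> q _; rewrite -EFinM lee_fin mulr_ge0 ?gb_ge0 // ltW.
    - exact: emeasurable_funM.
    - by move=> q _; rewrite -EFinM lee_fin !mulr_ge0 ?powR_ge0 ?gb_ge0.
    - exact: emeasurable_funM.
    apply: ge0_le_integral => //.
    - by move=> q _; rewrite lee_fin mulr_ge0 ?powR_ge0 ?gb_ge0.
    - by apply: emeasurable_funD; exact: emeasurable_funM.
    - move=> q _; rewrite -!EFinM -EFinD lee_fin mulrA -mulrDl ler_wpM2r ?gb_ge0 //=.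
      by rewrite powRr1 ?gam0_ge0 //; apply: threshold_powR => //; exact: gam0_ge0.
  apply: leeD => //; apply: (le_trans (lee_wpmul2l _ integral_gb)); first by rewrite lee_fin ltW.
  rewrite -EFinM lee_fin /w le_eqVlt; apply/orP; left; apply/eqP.
  by field; rewrite gt_eqF.
have hS3 : ((c * u y s / 4)%:E <= (w `^ (1 - lambda))%:E * Spot lambda (s, y))%E.
  have := le_trans hS hS2.
  case: (_ * Spot lambda _)%E => [r||] //; last by move=> _; exact: leey.
  by rewrite -EFinD !lee_fin => h; lra.
have wE : w `^ (1 - lambda) = (w `^ (lambda - 1))^-1 by rewrite -powRN opprB.
move: hS3; rewrite wE lee_pdivlMl ?powR_gt0 // -EFinM => hS3.
rewrite /C3 lee_pdivlMl; last by rewrite mulr_gt0 ?powR_gt0 ?divr_gt0 // mulr_gt0.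
apply: le_trans hS3; rewrite -EFinM lee_fin le_eqVlt; apply/orP; left; apply/eqP.
rewrite UE /w (_ : c * u y s / (4 * Mg) = c / (4 * Mg) * u y s); last by ring.
have cM0 : 0 <= c / (4 * Mg) by rewrite divr_ge0 ?mulr_ge0 // ltW.
rewrite [X in _ = X * _]powRM //.
by ring.
Qed.

Lemma measurable_Ppot : measurable_fun setT Ppot.
Proof.
rewrite (_ : Ppot = fubini_F rv (fun q : (mR * 'rV[R]_n) * 'rV[R]_n =>
  (gam0 (q.1.1 / 2) (sqnorm (q.2 - q.1.2)) * ub ((q.1.1 / 2)%R, q.2))%:E)) //.
have m11 : measurable_fun setT (fun q : (mR * 'rV[R]_n) * 'rV[R]_n => q.1.1 / 2 : mR).
  by apply: measurable_funM => //; apply: (measurableT_comp measurable_fst measurable_fst).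
apply: measurable_fun_fubini_tonelli_F; last first.
  by move=> q; rewrite lee_fin mulr_ge0 ?gam0_ge0 ?ub_ge0.
apply/measurable_EFinP; apply: measurable_funM.
  apply: measurable_gam0 => //; apply: measurable_sqnormB => //.
  exact: (measurableT_comp measurable_snd measurable_fst).
by apply: (measurableT_comp measurable_ub); exact: measurable_fun_pair.
Qed.

Lemma measurable_potential_kernel (l : R) :
  measurable_fun setT (fun q : (mR * 'rV[R]_n) * (mR * 'rV[R]_n) =>
    gam0 (q.1.1 - q.2.1) (sqnorm (q.2.2 - q.1.2)) `^ l * gb q.2 : mR).
Proof.
apply: measurable_funM; last by apply: (measurableT_comp measurable_gb); exact: measurable_snd.
apply: (measurableT_comp (measurable_powR l)); apply: measurable_gam0.
  apply: measurable_funB; first exact: (measurableT_comp measurable_fst measurable_fst).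
  exact: (measurableT_comp measurable_fst measurable_snd).
apply: measurable_sqnormB; first exact: (measurableT_comp measurable_snd measurable_snd).
exact: (measurableT_comp measurable_snd measurable_fst).
Qed.

Lemma measurable_Spot (l : R) : measurable_fun setT (Spot l).
Proof.
rewrite (_ : Spot l = fubini_F st (fun q : (mR * 'rV[R]_n) * (mR * 'rV[R]_n) =>
  (gam0 (q.1.1 - q.2.1) (sqnorm (q.2.2 - q.1.2)) `^ l * gb q.2)%:E)) //.
apply: measurable_fun_fubini_tonelli_F; last first.
  by move=> q; rewrite lee_fin mulr_ge0 ?powR_ge0 ?gb_ge0.
by apply/measurable_EFinP; exact: measurable_potential_kernel.
Qed.

Let Cg (l : R) : R := Num.sqrt (pi / (l / 8)) ^+ n.
Let Cg_ge0 l : 0 <= Cg l. Proof. by rewrite exprn_ge0 // sqrtr_ge0. Qed.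

(** At exponent 1 the space integral of the kernel does not depend on time, so the bound is uniform
    in [s]. *)
Lemma integral_Ppot s : 0 < s <= 1 -> (\int[rv]_y Ppot (s, y) <= (Cg 1 * M)%:E)%E.
Proof.
move=> /andP[s0 s1]; have s20 : 0 < s / 2 by lra.
have s2 : 0 < s / 2 <= 1 by rewrite s20; lra.
have mub : measurable_fun setT (fun z : 'rV[R]_n => ub ((s / 2)%R, z) : mR).
  exact: (measurableT_comp measurable_ub (pair1_measurable (s / 2 : mR))).
rewrite (fubini_tonelli (fun q : 'rV[R]_n * 'rV[R]_n =>
  (gam0 (s / 2) (sqnorm (q.2 - q.1)) * ub ((s / 2)%R, q.2))%:E)); last 2 first.
- apply/measurable_EFinP; apply: measurable_funM; last first.
    by apply: (measurableT_comp mub); exact: measurable_snd.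
  by apply: measurable_gam0 => //; apply: measurable_sqnormB.
- by move=> q; rewrite lee_fin mulr_ge0 ?gam0_ge0 ?ub_ge0.
rewrite (eq_integral (fun z => (Cg 1)%:E * (ub ((s / 2)%R, z))%:E)%E); last first.
  move=> z _.
  rewrite (eq_integral (fun y : 'rV[R]_n => (ub ((s / 2)%R, z))%:E *
      (gam0 (s / 2) (sqnorm (z - y)) `^ 1)%:E)%E); last first.
    by move=> y _; rewrite -EFinM powRr1 ?gam0_ge0 // mulrC.
  rewrite ge0_integralZl //; last 3 first.
  - apply/measurable_EFinP; apply: (measurableT_comp (measurable_powR 1)).
    by apply: measurable_gam0 => //; apply: measurable_sqnormB => //; exact: measurable_id.
  - by move=> y _; rewrite lee_fin powR_ge0.
  - by rewrite lee_fin ub_ge0.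
  rewrite integral_gam_pow // subrr mulr0 mul0r oppr0 powRr0 mulr1.
  by rewrite muleC.
rewrite ge0_integralZl //; last 3 first.
- exact/measurable_EFinP.
- by move=> y _; rewrite lee_fin ub_ge0.
- by rewrite lee_fin.
by rewrite EFinM lee_wpmul2l ?lee_fin //; exact: integral_ub.
Qed.

(** The exponential in [kp] is dropped, leaving [(t - s)^(-alpha/2)]. Integration in space turns the
    slice term into [s^(-eps)], and the source term, after Tonelli, into [(s - sg)^(-eps)] for each
    source time [sg]. Both leave the beta integral with exponents [alpha/2] and [eps], of sum below
    1 by subcriticality. *)
Lemma near_superlinear : 1 <= lambda -> alpha + n%:R * lambda < n%:R + 2 ->
  exists C, forall (x : 'rV[R]_n) t, 0 < t <= 1 ->
  (\int[st]_(p in tbox `]0%R, t[ ball52)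
     (@kp R n alpha (t - p.1) (sqnorm (p.2 - x)) * u p.2 p.1 `^ lambda)%:E <= C%:E)%E.
Proof.
move=> l1 al; have n0 : 0 < n%:R :> R by rewrite ltr0n.
have l0 : 0 < lambda by exact: lt_le_trans l1.
pose a := alpha / 2; have a0 : 0 <= a by rewrite divr_ge0 // ltW.
have e0 : 0 <= eps by rewrite /eps divr_ge0 // mulr_ge0 // subr_ge0.
have ae : a + eps < 1 by rewrite /a /eps; lra.
pose K := 2 / (1 - (a + eps)); have K0 : 0 <= K by rewrite divr_ge0 //; lra.
exists (C2 * (Cg 1 * M) * K + C3 * Cg lambda * K * Mg) => x t /andP[t0 t1].
have hin (s : R) : `]0, t[%classic s -> 0 < s <= 1.
  by rewrite /= in_itv /= => /andP[-> h]; lra.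
have h16 (s : R) : `]0, t[%classic s -> 0 < s < 16.
  by move=> /hin /andP[-> ?]; lra.
have mN := @measurable_ball52 R n.
have mA : measurable (`]0, t[%classic : set mR) by exact: measurable_itv.
have mAN : measurable (tbox `]0, t[ ball52) by exact: measurable_tbox.
have mAT : measurable (tbox `]0, t[ (setT : set 'rV[R]_n)) by exact: measurable_tbox.
have mtau : measurable_fun setT (fun p : mR * 'rV[R]_n => t - p.1 : mR) by apply: measurable_funB.
have P0 p : (0 <= Ppot p)%E.
  by apply: integral_ge0 => z _; rewrite lee_fin mulr_ge0 ?gam0_ge0 ?ub_ge0.
have S0 p : (0 <= Spot lambda p)%E.
  by apply: integral_ge0 => z _; rewrite lee_fin mulr_ge0 ?powR_ge0 ?gb_ge0.
pose w (s : R) : R := (t - s) `^ (- a).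
have w0 s : 0 <= w s by exact: powR_ge0.
have mw : measurable_fun setT (fun p : mR * 'rV[R]_n => w p.1 : mR).
  exact: (measurableT_comp (measurable_powR _) mtau).
have mw1 : measurable_fun setT (w : mR -> mR) by exact: measurable_powR_right.
have mse : measurable_fun setT (fun s : mR => s `^ (- eps) : mR) by exact: measurable_powR.
have mH1 : measurable_fun setT (fun p : mR * 'rV[R]_n =>
    (C2 * (w p.1 * p.1 `^ (- eps)))%:E * Ppot p)%E.
  apply: emeasurable_funM; last exact: measurable_Ppot.
  apply/measurable_EFinP; apply: measurable_funM => //; apply: measurable_funM => //.
  by apply: (measurableT_comp mse); exact: measurable_fst.
have mH2 : measurable_fun setT (fun p : mR * 'rV[R]_n => (C3 * w p.1)%:E * Spot lambda p)%E.
  apply: emeasurable_funM; last exact: measurable_Spot.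
  by apply/measurable_EFinP; apply: measurable_funM.
have H10 p : (0 <= (C2 * (w p.1 * p.1 `^ (- eps)))%:E * Ppot p)%E.
  by rewrite mule_ge0 // lee_fin mulr_ge0 // mulr_ge0 // powR_ge0.
have H20 p : (0 <= (C3 * w p.1)%:E * Spot lambda p)%E.
  by rewrite mule_ge0 // lee_fin mulr_ge0 // ltW.
apply: (@le_trans _ _ (\int[st]_(p in tbox `]0%R, t[ setT)
   ((C2 * (w p.1 * p.1 `^ (- eps)))%:E * Ppot p + (C3 * w p.1)%:E * Spot lambda p))%E).
  apply: (@le_trans _ _ (\int[st]_(p in tbox `]0%R, t[ ball52)
     ((C2 * (w p.1 * p.1 `^ (- eps)))%:E * Ppot p + (C3 * w p.1)%:E * Spot lambda p))%E).
    apply: ge0_le_integral => //.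
    - by move=> [s y] _; rewrite lee_fin mulr_ge0 ?kp_ge0 ?powR_ge0.
    - apply/measurable_EFinP; apply: measurable_funM; last exact: measurable_upow.
      apply: measurable_funTS; apply: measurable_kp => //.
      by apply: measurable_sqnormB.
    - by apply: measurable_funTS; exact: emeasurable_funD.
    - move=> [s y] [/= hs Ny]; have hs' := hin _ hs.
      have kw : @kp R n alpha (t - s) (sqnorm (y - x)) <= w s.
        rewrite /kp /w ler_piMr ?powR_ge0 // -expR0 ler_expR oppr_le0.
        move: hs; rewrite in_itv /= => /andP[_ st'].
        by rewrite !mulr_ge0 ?invr_ge0 ?sqnorm_ge0 ?mulr_ge0 ?subr_ge0 // ltW.
      apply: (@le_trans _ _ ((w s)%:E * (u y s `^ lambda)%:E)%E).
        by rewrite -EFinM lee_fin ler_wpM2r ?powR_ge0.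
      apply: (le_trans (lee_wpmul2l _ (upow_le l1 Ny hs'))); first by rewrite lee_fin.
      rewrite ge0_muleDr; last 2 first.
      + by rewrite mule_ge0 // lee_fin mulr_ge0 ?powR_ge0.
      + by rewrite mule_ge0 // lee_fin ltW.
      rewrite !muleA -!EFinM le_eqVlt; apply/orP; left; apply/eqP.
      by congr (_%:E * _ + _%:E * _)%E; rewrite /=; ring.
  apply: ge0_subset_integral => //.
  - by apply: measurable_funTS; exact: emeasurable_funD.
  - by move=> p _; rewrite adde_ge0.
  - by move=> [s y] [/= hs _]; split.
rewrite ge0_integralD //; last 2 first.
- exact: measurable_funTS.
- exact: measurable_funTS.
rewrite EFinD; apply: leeD.
  apply: (@le_trans _ _ (\int[leb]_(s in `]0%R, t[)
      ((C2 * (Cg 1 * M))%:E * (w s * (s - 0) `^ (- eps))%:E))%E).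
    apply: integral_tbox_le => //.
    - exact: measurable_funTS.
    - apply: emeasurable_funM => //; apply/measurable_EFinP; apply: measurable_funTS.
      by apply: measurable_funM => //; exact: measurable_powR_left.
    move=> s hs; rewrite /= (@ge0_integralZl _ _ _ rv setT _ (fun y => Ppot (s, y))) //; last 2 first.
    - exact: (measurableT_comp measurable_Ppot (pair1_measurable (s : mR))).
    - by rewrite lee_fin mulr_ge0 // mulr_ge0 // powR_ge0.
    apply: (le_trans (lee_wpmul2l _ (integral_Ppot (hin _ hs)))).
      by rewrite lee_fin mulr_ge0 // mulr_ge0 // powR_ge0.
    rewrite -!EFinM lee_fin subr0 le_eqVlt; apply/orP; left; apply/eqP.
    by rewrite /=; ring.
  rewrite ge0_integralZl //; last 3 first.
  - apply/measurable_EFinP; apply: measurable_funTS.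
    by apply: measurable_funM => //; exact: measurable_powR_left.
  - by move=> s _; rewrite lee_fin mulr_ge0 ?powR_ge0.
  - by rewrite lee_fin mulr_ge0 // mulr_ge0.
  rewrite [leRHS]EFinM; apply: lee_wpmul2l; first by rewrite lee_fin;  rewrite mulr_ge0 // mulr_ge0.
  by apply: integral_beta_le => //; lra.
(* The time window is moved into the weight, so that the exchange of integrals takes place over
   whole spaces. *)
pose w' (p : mR * 'rV[R]_n) : R := (fun p => C3 * w p.1) \_ (tbox `]0%R, t[ setT) p.
have w'0 p : 0 <= w' p.
  by rewrite /w' patchE; case: ifP => // _; rewrite mulr_ge0 // ltW.
have mw' : measurable_fun setT (w' : _ -> mR).
  apply/(measurable_restrictT _ mAT); apply: measurable_funTS.
  exact: measurable_funM.
have mker p : measurable_fun setT (fun q : mR * 'rV[R]_n =>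
    (gam0 (p.1 - q.1) (sqnorm (q.2 - p.2)) `^ lambda * gb q)%:E).
  apply/measurable_EFinP; exact: (measurableT_comp (measurable_potential_kernel lambda)
    (pair1_measurable (p : mR * 'rV[R]_n))).
rewrite integral_mkcond.
rewrite (eq_integral (fun p => \int[st]_q
   (w' p * (gam0 (p.1 - q.1) (sqnorm (q.2 - p.2)) `^ lambda * gb q))%:E)%E); last first.
  move=> p _; rewrite patchE /w' patchE; case: ifP => hp.
    rewrite -ge0_integralZl //.
    - by move=> q _; rewrite lee_fin mulr_ge0 ?powR_ge0 ?gb_ge0.
    - by rewrite lee_fin mulr_ge0 // ltW.
  by rewrite integral0_eq // => q _; rewrite mul0r.
rewrite (fubini_tonelli (fun r : (mR * 'rV[R]_n) * (mR * 'rV[R]_n) =>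
  (w' r.1 * (gam0 (r.1.1 - r.2.1) (sqnorm (r.2.2 - r.1.2)) `^ lambda * gb r.2))%:E)); last 2 first.
- apply/measurable_EFinP; apply: measurable_funM; last exact: measurable_potential_kernel.
  by apply: (measurableT_comp mw'); exact: measurable_fst.
- by move=> r; rewrite lee_fin mulr_ge0 // mulr_ge0 ?powR_ge0 ?gb_ge0.
have mgb : measurable_fun setT (fun q => (gb q)%:E) by apply/measurable_EFinP; exact: measurable_gb.
have C30 : 0 <= C3 * Cg lambda * K by rewrite mulr_ge0 // mulr_ge0 // ltW.
apply: (@le_trans _ _ (\int[st]_q ((C3 * Cg lambda * K)%:E * (gb q)%:E))%E); last first.
  rewrite ge0_integralZl //; last by move=> q _; rewrite lee_fin gb_ge0.
  by rewrite [leRHS]EFinM lee_wpmul2l ?lee_fin //; exact: integral_gb.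
apply: ge0_le_integral => //.
- move=> q _; apply: integral_ge0 => p _.
  by rewrite lee_fin mulr_ge0 // mulr_ge0 ?powR_ge0 ?gb_ge0.
- apply: (measurable_fun_fubini_tonelli_G (fun r : (mR * 'rV[R]_n) * (mR * 'rV[R]_n) =>
  (w' r.1 * (gam0 (r.1.1 - r.2.1) (sqnorm (r.2.2 - r.1.2)) `^ lambda * gb r.2))%:E)).
    apply/measurable_EFinP; apply: measurable_funM; last exact: measurable_potential_kernel.
    by apply: (measurableT_comp mw'); exact: measurable_fst.
  by move=> r; rewrite lee_fin mulr_ge0 // mulr_ge0 ?powR_ge0 ?gb_ge0.
- exact: emeasurable_funM.
move=> [sg z] _.
(* [gb] vanishes at nonpositive times. For [sg > 0] the interval []sg, t[] is shorter than 1 and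
   lies in []0, t[], as the beta bound needs. *)
have [hz|hz] := ltP 0 sg; last first.
  have g0 : gb (sg, z) = 0.
    by rewrite /gb patchE memNset // => -[/=]; rewrite in_itv /= ltNge hz.
  by rewrite g0 mule0 integral0_eq // => p _; rewrite /= !mulr0.
pose F (p : mR * 'rV[R]_n) : \bar R := (w p.1 * gam0 (p.1 - sg) (sqnorm (z - p.2)) `^ lambda)%:E.
have F0 p : (0 <= F p)%E by rewrite lee_fin mulr_ge0 ?powR_ge0.
have mF : measurable_fun setT F.
  apply/measurable_EFinP; apply: measurable_funM => //.
  apply: (measurableT_comp (measurable_powR lambda)); apply: measurable_gam0.
    exact: measurable_funB.
  by apply: measurable_sqnormB.
rewrite (eq_integral ((fun p => (gb (sg, z) * C3)%:E * F p)%E \_ (tbox `]0%R, t[ setT))); last first.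
  move=> p _; rewrite /w' !patchE; case: ifP => _; last by rewrite mul0r.
  by rewrite -EFinM; congr EFin; ring.
rewrite -integral_mkcond ge0_integralZl //; last 2 first.
- exact: measurable_funTS.
- by rewrite lee_fin mulr_ge0 ?gb_ge0 // ltW.
rewrite -[leRHS]EFinM (_ : C3 * Cg lambda * K * gb (sg, z) = gb (sg, z) * C3 * (Cg lambda * K)); last by ring.
rewrite [leRHS]EFinM lee_wpmul2l ?lee_fin ?mulr_ge0 ?gb_ge0 ?(ltW C3_gt0) //.
pose G (s : R) : R := if sg < s then w s * (s - sg) `^ (- eps) else 0.
have G0 s : 0 <= G s by rewrite /G; case: ifP => // _; rewrite mulr_ge0 ?powR_ge0.
have mG : measurable_fun setT (G : mR -> mR).
  apply: measurable_fun_ifT => //; first exact: measurable_fun_ltr.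
  by apply: measurable_funM => //; exact: measurable_powR_left.
apply: (@le_trans _ _ (\int[leb]_(s in `]0%R, t[) ((Cg lambda)%:E * (G s)%:E))%E).
  apply: integral_tbox_le => //.
  - exact: measurable_funTS.
  - by apply: emeasurable_funM => //; apply/measurable_EFinP; exact: measurable_funTS.
  move=> s hs; rewrite /F /G /=; case: ifPn => h.
    rewrite (eq_integral (fun y : 'rV[R]_n => (w s)%:E * (gam0 (s - sg) (sqnorm (z - y)) `^ lambda)%:E)%E) //.
    rewrite ge0_integralZl //; last 3 first.
    - apply/measurable_EFinP; apply: (measurableT_comp (measurable_powR lambda)).
      by apply: measurable_gam0 => //; apply: measurable_sqnormB => //; exact: measurable_id.
    - by move=> y _; rewrite lee_fin powR_ge0.
    - by rewrite lee_fin.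
    rewrite integral_gam_pow ?subr_gt0 // -!EFinM lee_fin le_eqVlt; apply/orP; left; apply/eqP.
    by rewrite -/(Cg lambda) -/eps; ring.
  rewrite mule0 integral0_eq // => y _; rewrite /gam0 subr_gt0 (negbTE h).
  by rewrite powR0 ?mulr0 // gt_eqF.
rewrite ge0_integralZl //; last 3 first.
- by apply/measurable_EFinP; exact: measurable_funTS.
- by move=> s _; rewrite lee_fin.
- by rewrite lee_fin.
rewrite [leRHS]EFinM lee_wpmul2l ?lee_fin //.
have [ht|ht] := leP t sg.
  rewrite integral0_eq ?lee_fin // => s; rewrite /= in_itv /= => /andP[_ st'].
  by rewrite /G ifF //; apply/negbTE; rewrite -leNgt ltW // (lt_le_trans st').
apply: le_trans (@integral_beta_le _ a eps sg t _ _ _ _ _) => //; last lra.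
rewrite integral_mkcond [leRHS]integral_mkcond le_eqVlt; apply/orP; left; apply/eqP.
apply: eq_integral => s _; rewrite !patchE !mem_setE !in_itv /= /G.
have [h|h] := ltP sg s; first by rewrite (lt_trans hz h).
by case: ifP.
Qed.

End near_superlinear.

(** * Uniform bound for the potential *)

Section potential_bound.
Context {R : realType} {n : nat}.
Local Notation leb := (@lebesgue_measure R).
Local Notation mR := (measurableTypeR R).
Local Notation rv := (@lebesgue_rv R n).
Local Notation st := (leb \x rv)%E.
Local Notation ball52 := (@ball52 R n).
Variables alpha lambda : R.
Hypothesis n_gt0 : (0 < n)%N.
Hypothesis alpha_gt0 : 0 < alpha.
Hypothesis lambda_gt0 : 0 < lambda.
Hypothesis subcritical : alpha + n%:R * lambda < n%:R + 2.
Variable u : 'rV[R]_n -> R -> R.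
Hypothesis Cu : C21 16 u.
Hypothesis u_ge0 : forall x t, 0 < t < 16 -> 0 <= u x t.
Hypothesis f_ge0 : forall x t, sqnorm x < 16 -> 0 < t < 16 -> 0 <= heat_op u x t.

Lemma near_bound : exists C, forall (x : 'rV[R]_n) t, 0 < t <= 1 ->
  (\int[st]_(p in tbox `]0%R, t[ ball52)
     (@kp R n alpha (t - p.1) (sqnorm (p.2 - x)) * u p.2 p.1 `^ lambda)%:E <= C%:E)%E.
Proof.
have [M M0 hM] := mass_u_bound Cu u_ge0 f_ge0.
have [Mf Mf0 hMf] := mass_f_bound Cu u_ge0 f_ge0.
have [l1|l1] := ltP lambda 1; first exact: (near_sublinear n_gt0 alpha_gt0 lambda_gt0 Cu u_ge0 M0 hM).
exact: (near_superlinear n_gt0 alpha_gt0 Cu u_ge0 f_ge0 M0 Mf0 hM hMf).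
Qed.

(** For [x] in the ball of radius 2 and [y] outside radius 5/2, the distance is at least 1/2 and
    [kp_far] applies; the global integral of [u^lambda] then bounds the far part. *)
Lemma potential_bound :
  (int_strip 16 (fun y s => (u y s `^ lambda)%:E) < +oo)%E ->
  exists2 C, 0 <= C & forall x t, sqnorm x <= 4 -> 0 < t <= 1 ->
  (int_strip 16 (fun y s =>
    (heat_kernel (x - y) (t - s) `^ (alpha / n%:R) * u y s `^ lambda)%:E) <= C%:E)%E.
Proof.
rewrite int_strip_upow // => Lfin; have [C hC] := near_bound.
set L := (\int[_]_(p in _) _)%E in Lfin.
have L0 : (0 <= L)%E by apply: integral_ge0 => p _; rewrite lee_fin powR_ge0.
pose Cf : R := (alpha / 2 / (alpha / (4 * n%:R) / 4)) `^ (alpha / 2).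
have Cf0 : 0 <= Cf by exact: powR_ge0.
have Lr : L = (fine L)%:E by rewrite fineK // ge0_fin_numE.
exists (Num.max 0 (C + Cf * fine L)) => [|x t x4 /andP[t0 t1]]; first by rewrite le_max lexx.
have t16 : 0 < t < 16 by rewrite t0; lra.
apply: (le_trans (int_strip_potential_le lambda n_gt0 alpha_gt0 Cu x t16)).
apply: (@le_trans _ _ (C + Cf * fine L)%:E); last by rewrite lee_fin le_max lexx orbT.
have mN := @measurable_ball52 R n; have mNC := measurableC mN.
have h16 (s : R) : `]0, t[%classic s -> 0 < s < 16.
  by rewrite /= in_itv /= => /andP[-> h]; lra.
have mA : measurable (`]0, t[%classic : set mR) by exact: measurable_itv.
have mAN : measurable (tbox `]0, t[ ball52) by exact: measurable_tbox.
have mANC : measurable (tbox `]0, t[ (~` ball52)) by exact: measurable_tbox.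
have mF B : measurable B -> measurable_fun (tbox `]0, t[ B)
    (fun p : mR * 'rV[R]_n =>
     (@kp R n alpha (t - p.1) (sqnorm (p.2 - x)) * u p.2 p.1 `^ lambda)%:E).
  move=> mB; apply/measurable_EFinP; apply: measurable_funM; last exact: measurable_upow.
  apply: measurable_funTS; apply: measurable_kp => //; first exact: measurable_funB.
  by apply: measurable_sqnormB.
have F0 (p : mR * 'rV[R]_n) :
    (0 <= (@kp R n alpha (t - p.1) (sqnorm (p.2 - x)) * u p.2 p.1 `^ lambda)%:E)%E.
  by rewrite lee_fin mulr_ge0 ?kp_ge0 ?powR_ge0.
have TE : tbox `]0, t[ (setT : set 'rV[R]_n) = tbox `]0, t[ ball52 `|` tbox `]0, t[ (~` ball52).
  apply/seteqP; split => [[s y] [/= hs _]|[s y] [|] [/= hs _]] //.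
  by have [h|h] := EM (ball52 y); [left|right].
rewrite TE ge0_integral_setU //; last 2 first.
- by rewrite -TE; exact: mF.
- by apply/disj_setPS => -[s y] [[_ /= h1] [_ /= h2]].
rewrite EFinD; apply: leeD; first by apply: hC; rewrite t0.
apply: (@le_trans _ _ (\int[st]_(p in tbox `]0%R, t[ (~` ball52)) (Cf%:E * (u p.2 p.1 `^ lambda)%:E))%E).
  apply: ge0_le_integral => //; first exact: mF.
    by apply: emeasurable_funM => //; apply/measurable_EFinP; exact: measurable_upow.
  move=> [s y] [/=]; rewrite in_itv /= => /andP[s0 st'] /negP.
  rewrite /ball52 /= -ltNge => Ny; rewrite -EFinM lee_fin ler_wpM2r ?powR_ge0 //.
  apply: kp_far => //; first by rewrite subr_gt0.
  have h14 : 0 < 1 / 4 :> R by [].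
  by have := sqnorm_near x y h14; rewrite invf_div; lra.
rewrite ge0_integralZl //; last 2 first.
- by apply/measurable_EFinP; exact: measurable_upow.
- by move=> p _; rewrite lee_fin powR_ge0.
rewrite [leRHS]EFinM -Lr; apply: lee_wpmul2l; first by rewrite lee_fin.
apply: ge0_subset_integral => //.
- by apply: measurable_tbox.
- by apply/measurable_EFinP; exact: measurable_upow.
- by move=> p _; rewrite lee_fin powR_ge0.
- by move=> [s y] [/= hs _]; split => //=; rewrite in_itv; exact: h16.
Qed.

End potential_bound.

(** * The pole inequality at the scale of concentration *)

Section pole_rescaled.
Context {R : realType} {n : nat}.
Local Notation leb := (@lebesgue_measure R).
Local Notation rv := (@lebesgue_rv R n).
Local Notation st := (leb \x rv)%E.
Local Notation gam := (@gam R n).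
Variable u : 'rV[R]_n -> R -> R.
Hypothesis Cu : C21 16 u.
Hypothesis u_ge0 : forall x t, 0 < t < 16 -> 0 <= u x t.
Hypothesis f_ge0 : forall x t, sqnorm x < 16 -> 0 < t < 16 -> 0 <= heat_op u x t.
Variables K sigma : R.
Hypothesis K_ge0 : 0 <= K.
Hypothesis sigma_ge0 : 0 <= sigma.
Hypothesis sigma_le : n%:R * sigma <= n%:R + 2.
Hypothesis f_le : forall x t, sqnorm x <= 4 -> 0 < t <= 1 ->
  heat_op u x t <= K * u x t `^ sigma.

(** The source contributes [K (2/r)^(n+2)], the truncation error [72 (2/r)^n]; the last factor is
    the integral of [gam] in space. Powers of [r] are divided out. *)
Definition rescaled_const : R :=
  (K * 2 ^+ n.+2 + 72 * 2 ^+ n) * Num.sqrt (pi / (1 / 8)) ^+ n.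

Lemma rescaled_const_ge0 : 0 <= rescaled_const.
Proof.
by rewrite mulr_ge0 ?exprn_ge0 ?sqrtr_ge0 // addr_ge0 // mulr_ge0 // exprn_ge0.
Qed.

(** Since [r <= 2], the base [2/r] is at least 1 and [n sigma <= n + 2] may be used in the exponent.
    The result scales as [r^(-n-2)], like one time derivative of a quantity of size [r^(-n)]. *)
Lemma critical_source (r : R) y s : 0 < r -> r <= 2 -> sqnorm y <= 4 -> 0 < s <= 1 ->
  u y s <= (2 / r) ^+ n -> heat_op u y s <= K * (2 / r) ^+ n.+2.
Proof.
move=> r0 r2 y4 hs uy; apply: (le_trans (f_le y4 hs)); rewrite ler_wpM2l //.
have U0 : 0 <= u y s by rewrite u_ge0 //; case/andP : hs => -> ?; rewrite /=; lra.
have h1 : 1 <= 2 / r by rewrite ler_pdivlMr // mul1r.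
have h0 : 0 <= 2 / r by exact: le_trans h1.
apply: (@le_trans _ _ (((2 / r) ^+ n) `^ sigma)).
  by apply: ge0_ler_powR; rewrite ?nnegrE ?exprn_ge0.
rewrite -!powR_mulrn // -powRrM; apply: ler_powR => //.
by rewrite -(addn2 n) natrD.
Qed.

(** With [b = r^2] and initial time [t - theta r^2], every term of [pole_ineq] carries the factor
    [b^3 r^(-n)], which cancels and leaves an inequality free of [r]. *)
Lemma pole_rescaled (theta r m t : R) (x : 'rV[R]_n) :
  0 < theta -> 0 < r -> r <= 2 -> 0 < t - theta * r ^+ 2 -> t <= 1 ->
  (forall y, sqnorm (y - x) < r ^+ 2 -> sqnorm y <= 4) ->
  u x t * r ^+ n = 1 ->
  (forall y s, sqnorm (y - x) < r ^+ 2 -> t - theta * r ^+ 2 <= s <= t ->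
    u y s <= (2 / r) ^+ n) ->
  (\int[rv]_(y in [set y : 'rV[R]_n | (sqnorm (y - x) < r ^+ 2)%R])
     (u y (t - theta * r ^+ 2))%:E <= m%:E)%E ->
  @pole_const R n <= theta `^ (- (n%:R / 2)) * m + rescaled_const * theta.
Proof.
move=> th0 r0 r2 s00 t1 xB4 ux ule um; set s0 := t - _ in s00 ule um.
set b := r ^+ 2; have b0 : 0 < b by rewrite exprn_gt0.
have bB y : sqnorm (y - x) < b -> sqnorm y < 16 by move=> /xB4; lra.
have tb0 : 0 < theta * b by rewrite mulr_gt0.
have s0t : s0 < t by rewrite /s0 ltrBlDr ltrDl.
have t16 : t < 16 by lra.
have hs0 : 0 < s0 < 16 by rewrite s00 (lt_trans s0t).
have ts0 : t - s0 = theta * b by rewrite /s0 /b; ring.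
have G := pole_ineq Cu u_ge0 f_ge0 b0 bB s00 s0t t16.
set Bx : set 'rV[R]_n := [set y | sqnorm (y - x) < b] in G um *.
have mB : measurable Bx by exact: measurable_sqball.
have b30 : 0 <= b ^+ 3 by rewrite exprn_ge0 // ltW.
have hin (s : R) : `[s0, t[%classic s -> [/\ s0 <= s <= t, s < t, 0 < s < 16 & 0 < s <= 1].
  by rewrite /= in_itv /= => /andP[h1 h2]; split; lra.
have r_ne0 : r != 0 by rewrite gt_eqF.
pose D : R := K * 2 ^+ n.+2 + 72 * 2 ^+ n.
have D0 : 0 <= D by rewrite addr_ge0 // mulr_ge0 // exprn_ge0.
(* Source [b^3 (2/r)^(n+2)] and truncation error [b^2 (2/r)^n] scale alike because [b = r^2]. *)
pose E : R := b ^+ 2 * r ^- n * D.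
have E0 : 0 <= E by rewrite /E !mulr_ge0 ?invr_ge0 ?exprn_ge0 // ltW.
have src y s : Bx y -> s0 <= s <= t -> 0 < s <= 1 ->
    b ^+ 3 * heat_op u y s + 72 * b ^+ 2 * u y s <= E.
  move=> By hs hs1; have uy := ule y s By hs.
  have fy := critical_source r0 r2 (xB4 y By) hs1 uy.
  apply: (@le_trans _ _ (b ^+ 3 * (K * (2 / r) ^+ n.+2) + 72 * b ^+ 2 * (2 / r) ^+ n)).
    by rewrite lerD // ler_wpM2l // mulr_ge0 // exprn_ge0 // ltW.
  rewrite le_eqVlt; apply/orP; left; apply/eqP.
  rewrite /E /D /b !expr_div_n -(addn2 n) !exprD; field.
  by rewrite r_ne0 expf_neq0.
have T1 : (\int[rv]_(y in Bx) (b ^+ 3 * (gam (t - s0) (sqnorm (y - x)) * u y s0))%:E <=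
    (b ^+ 3 * ((theta * b) `^ (- (n%:R / 2)) * m))%:E)%E.
  have mu : measurable_fun Bx (fun y => (u y s0)%:E).
    apply/measurable_EFinP; apply: measurable_funTS; apply: measurable_slice => y.
    exact: (C21_jcont Cu).
  rewrite mulrA EFinM; apply: (le_trans _ (lee_wpmul2l _ um)); last first.
    by rewrite lee_fin mulr_ge0 ?powR_ge0.
  rewrite -ge0_integralZl //; last 2 first.
  - by move=> y _; rewrite lee_fin u_ge0.
  - by rewrite lee_fin mulr_ge0 ?powR_ge0.
  apply: ge0_le_integral => //.
  - by move=> y _; rewrite lee_fin mulr_ge0 // mulr_ge0 ?gam_ge0 ?u_ge0.
  - apply/measurable_EFinP; apply: measurable_funTS.
    apply: (@measurable_slice _ _ (fun z t' => b ^+ 3 * (gam (t - t') (sqnorm (z - x)) * u z t'))) => z.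
    apply: jcontM; first exact: jcont_cst.
    by apply: jcontM; [exact: jcont_gam|exact: (C21_jcont Cu)].
  - exact: emeasurable_funM.
  - move=> y _; rewrite -EFinM lee_fin -[leRHS]mulrA ler_wpM2l // ler_wpM2r ?u_ge0 // ts0.
    by apply: gam_le => //; exact: sqnorm_ge0.
have T2 : (\int[st]_(p in tbox `[s0, t[ Bx)
     (gam (t - p.1) (sqnorm (p.2 - x)) *
       (b ^+ 3 * heat_op u p.2 p.1 + 72 * b ^+ 2 * u p.2 p.1))%:E <=
    (E * Num.sqrt (pi / (1 / 8)) ^+ n * (theta * b))%:E)%E.
  apply: (@le_trans _ _ (\int[leb]_(s in `[s0, t[) (cst (E * Num.sqrt (pi / (1 / 8)) ^+ n)%:E s))%E).
    apply: integral_tbox_le => //.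
    - apply/measurable_EFinP.
      apply: (@measurable_jcont _ _ (fun z t' => gam (t - t') (sqnorm (z - x)) *
        (b ^+ 3 * heat_op u z t' + 72 * b ^+ 2 * u z t'))) => //.
        exact: measurable_tbox.
      move=> s z [/= /hin [_ st' hs _] _]; apply: jcontM; first exact: jcont_gam.
      by apply: jcontD; apply: jcontM; [exact: jcont_cst|exact: jcont_heat_op hs
        |exact: jcont_cst|exact: C21_jcont hs].
    - move=> [s y] [/= /hin [_ _ hs _] By]; rewrite lee_fin mulr_ge0 ?gam_ge0 //.
      by rewrite addr_ge0 // mulr_ge0 ?f_ge0 ?u_ge0 ?bB // mulr_ge0 // exprn_ge0 // ltW.
    move=> s /hin [hs st' hs16 hs1] /=. pose tau : R := t - s; have tau0 : 0 < tau by rewrite subr_gt0.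
    apply: (@le_trans _ _ (\int[rv]_y (E%:E * (@gam0 R n tau (sqnorm (x - y)) `^ 1)%:E))%E).
      rewrite [leLHS]integral_mkcond; apply: ge0_le_integral => //.
      - move=> y _; rewrite patchE; case: ifPn => //; rewrite inE => By.
        rewrite lee_fin mulr_ge0 ?gam_ge0 //.
        by rewrite addr_ge0 // mulr_ge0 ?f_ge0 ?u_ge0 ?bB // mulr_ge0 // exprn_ge0 // ltW.
      - apply/(measurable_restrictT _ mB); apply/measurable_EFinP; apply: measurable_funTS.
        apply: (@measurable_slice _ _ (fun z t' => gam (t - t') (sqnorm (z - x)) *
          (b ^+ 3 * heat_op u z t' + 72 * b ^+ 2 * u z t'))) => z.
        apply: jcontM; first exact: jcont_gam.
        by apply: jcontD; apply: jcontM; [exact: jcont_cst|exact: jcont_heat_op hs16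
          |exact: jcont_cst|exact: C21_jcont hs16].
      - apply: emeasurable_funM => //; apply/measurable_EFinP.
        apply: (measurableT_comp (measurable_powR 1)).
        by apply: measurable_gam0 => //; apply: measurable_sqnormB => //; exact: measurable_id.
      - move=> y _; rewrite patchE; case: ifPn => [|_]; last first.
          by rewrite -EFinM lee_fin mulr_ge0 ?powR_ge0.
        rewrite inE => By; rewrite -EFinM lee_fin powRr1 ?gam0_ge0 // /gam0 tau0.
        by rewrite sqnormBC mulrC ler_wpM2r ?gam_ge0 //; exact: src.
    rewrite ge0_integralZl //; last 2 first.
    - apply/measurable_EFinP; apply: (measurableT_comp (measurable_powR 1)).
      by apply: measurable_gam0 => //; apply: measurable_sqnormB => //; exact: measurable_id.
    - by move=> y _; rewrite lee_fin powR_ge0.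
    by rewrite integral_gam_pow // subrr mulr0 mul0r oppr0 powRr0 mulr1 EFinM.
  rewrite integral_cst //= lebesgue_measure_itv /= lte_fin s0t -EFinB ts0.
  by rewrite EFinM.
have := le_trans G (leeD T1 T2); rewrite -EFinD lee_fin => {}G.
have rn0 : r ^+ n != 0 by rewrite expf_neq0.
have uE : u x t = r ^- n by apply: (mulIf rn0); rewrite ux mulVf.
have thE : (theta * b) `^ (- (n%:R / 2)) = theta `^ (- (n%:R / 2)) * r ^- n.
  by rewrite powRM ?(ltW th0) ?(ltW b0) // /b powR_sqr_half // ltW.
have k0 : 0 < b ^+ 3 * r ^- n by rewrite mulr_gt0 ?invr_gt0 ?exprn_gt0.
rewrite -(ler_pM2r k0); apply: le_trans (le_trans G _); rewrite ?uE ?thE.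
  by rewrite mulrA.
rewrite /E /rescaled_const -/D le_eqVlt; apply/orP; left; apply/eqP.
by ring.
Qed.

End pole_rescaled.

(** * Selection of a concentration point *)

Section doubling.
Context {R : realType} {n : nat}.
Variable u : 'rV[R]_n -> R -> R.
Hypothesis n_gt0 : (0 < n)%N.
Hypothesis u_ge0 : forall x t, 0 < t < 16 -> 0 <= u x t.
Hypothesis cu : forall x t, 0 < t < 16 -> jcont u x t.

(* The point is a maximum of [u d^n], [d] being the parabolic distance to the
   lateral and bottom boundary of a cylinder with top centre [(x0, t0)]. *)
Lemma doubling (x0 : 'rV[R]_n) (t0 B : R) : 0 < t0 -> t0 < 16 -> 2 <= B ->
  B ^+ n < u x0 t0 * Num.sqrt (t0 / 2) ^+ n ->
  exists (x : 'rV[R]_n) (t r : R),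
  [/\ 0 < r, u x t * r ^+ n = 1,
      `|x - x0| <= Num.sqrt t0 /\ t <= t0,
      B ^+ 2 * r ^+ 2 <= t - t0 / 2 &
      forall y s, `|y - x| <= r -> t - r ^+ 2 <= s <= t -> u y s <= (2 / r) ^+ n].
Proof.
move=> t00 t16 B2 big; set h := Num.sqrt t0.
have B0 : 0 < B by lra.
have h0 : 0 <= h by exact: sqrtr_ge0.
pose d (p : 'rV[R]_n * R) : R := pos (Num.min (Num.sqrt (p.2 - t0 / 2)) (h - `|p.1 - x0|)).
have cd : continuous d.
  move=> p; rewrite /d; apply: (@continuous_comp _ _ _ (fun p : 'rV[R]_n * R =>
    Num.min (Num.sqrt (p.2 - t0 / 2)) (h - `|p.1 - x0|)) pos); last exact: continuous_pos.
  apply: continuous_min.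
    apply: (@continuous_comp _ _ _ (fun p : 'rV[R]_n * R => p.2 - t0 / 2) Num.sqrt).
      by apply: cvgB; [exact: cvg_snd|exact: cvg_cst].
    exact: sqrt_continuous.
  apply: cvgB; first exact: cvg_cst.
  apply: (@cvg_norm _ _ _ _ _ (fun p : 'rV[R]_n * R => p.1 - x0)).
  by apply: cvgB; [exact: cvg_fst|exact: cvg_cst].
have d_ge0 p : 0 <= d p by exact: pos_ge0.
pose A := [set y : 'rV[R]_n | `|y| <= h + `|x0|] `*` `[t0 / 2, t0]%classic.
pose F (p : 'rV[R]_n * R) : R := u p.1 p.2 * d p ^+ n.
have cA : compact A by apply: compact_setX; [exact: compact_rv_ball|exact: segment_compact].
have Ain s : t0 / 2 <= s <= t0 -> 0 < s < 16 by move=> hs; lra.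
have cF : {within A, continuous F}.
  apply: continuous_in_subspaceT => -[y s]; rewrite inE => -[/= hy].
  rewrite in_itv /= => /Ain hs; apply: cvgM; first exact: cu.
  by apply: (@continuous_comp _ _ _ d (fun a => a ^+ n)); [exact: cd|exact: exprn_continuous].
have A0 : A (x0, t0).
  by split => /=; [rewrite lerDr|rewrite in_itv /=; lra].
have [[x t]] := compact_EVT_max (ex_intro _ _ A0) cA cF.
rewrite inE => -[/= xA]; rewrite in_itv /= => tA maxF.
have dx0 : d (x0, t0) = Num.sqrt (t0 / 2).
  rewrite /d /= subrr normr0 subr0 min_l; last by rewrite ler_wsqrtr //; lra.
  by rewrite (_ : t0 - t0 / 2 = t0 / 2) ?pos_id ?sqrtr_ge0 //; field.
have Fx : B ^+ n < F (x, t).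
  by apply: (lt_le_trans _ (maxF (x0, t0) _)); [rewrite /F dx0|rewrite inE].
have U0 : 0 <= u x t by rewrite u_ge0 // Ain.
have Fp : 0 < F (x, t) by rewrite (lt_trans _ Fx) // exprn_gt0.
have dn : d (x, t) != 0.
  by apply/eqP => d0; move: Fp; rewrite /F d0 expr0n gtn_eqF // mulr0 ltxx.
have dp : 0 < d (x, t) by rewrite lt_neqAle eq_sym dn d_ge0.
have Up : 0 < u x t.
  by rewrite lt_neqAle U0 andbT eq_sym; apply/eqP => z; move: Fp; rewrite /F /= z mul0r ltxx.
set D := d (x, t) in dn dp; have DE : D = Num.min (Num.sqrt (t - t0 / 2)) (h - `|x - x0|).
  rewrite /D /d /pos /= max_r //; move: dp; rewrite /D /d /pos /= lt_max ltxx /=.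
  exact: ltW.
have [D1 D2] : D <= Num.sqrt (t - t0 / 2) /\ D <= h - `|x - x0|.
  by rewrite DE !ge_min !lexx orbT.
(* The scale at which [u x t] equals [r^(-n)]. *)
pose r := u x t `^ (- n%:R^-1).
have n0 : n%:R != 0 :> R by rewrite pnatr_eq0 gtn_eqF.
have r0 : 0 < r by exact: powR_gt0.
have rn : u x t * r ^+ n = 1.
  rewrite -powR_mulrn ?(ltW r0) // /r -powRrM mulNr mulVf // powR_inv1 //.
  by rewrite mulfV // gt_eqF.
have rE : r ^- n = u x t.
  by apply: (mulIf (expf_neq0 n (lt0r_neq0 r0))); rewrite rn mulVf // expf_neq0 // gt_eqF.
(* The maximum of [u d^n] exceeds [B^n], that is, [(D / r)^n > B^n]. *)
have Br : B * r <= D.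
  have : (B * r) ^+ n <= D ^+ n.
    rewrite exprMn -ler_pdivlMr ?exprn_gt0 // mulrC rE; exact: ltW.
  by rewrite ler_pXn2r ?nnegrE // ?mulr_ge0 ?(ltW B0) ?(ltW r0) // ltW.
have rD : r <= D / 2.
  have := ler_wpM2r (ltW r0) B2; lra.
have tge : 0 <= t - t0 / 2 by lra.
have D2t : D ^+ 2 <= t - t0 / 2.
  by rewrite -[leRHS]sqr_sqrtr // ler_sqr ?nnegrE ?sqrtr_ge0 // ltW.
have r2D : r ^+ 2 <= D ^+ 2 / 4.
  have : r ^+ 2 <= (D / 2) ^+ 2 by rewrite ler_sqr ?nnegrE ?(ltW r0) // divr_ge0 // ltW.
  by rewrite expr_div_n (_ : 2 ^+ 2 = 4) //; ring.
exists x, t, r; split => //.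
- by split; [lra|case/andP : tA].
- by rewrite -exprMn; apply: le_trans D2t; rewrite ler_sqr ?nnegrE ?mulr_ge0 ?(ltW B0) ?(ltW r0) // ltW.
move=> y s hy /andP[hs1 hs2].
have D20 : 0 <= D ^+ 2 by rewrite exprn_ge0 // ltW.
have hs : t0 / 2 <= s <= t0 by lra.
have yx0 : `|y - x0| <= `|y - x| + `|x - x0|.
  by rewrite (_ : y - x0 = (y - x) + (x - x0)) ?ler_normD // addrA subrK.
(* The lateral distance loses at most [r <= D/2]; the elapsed time loses [r^2 <= D^2/4] out of at
   least [D^2], and its square root stays above [D/2]. So maximality costs a factor [2^n]. *)
have dy : D / 2 <= d (y, s).
  rewrite /d /= /pos le_max le_min; apply/orP; right; apply/andP; split; last by lra.
  rewrite -[leLHS]ger0_norm ?divr_ge0 ?(ltW dp) // -sqrtr_sqr ler_wsqrtr //.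
  by rewrite expr_div_n (_ : 2 ^+ 2 = 4); [lra|ring].
have yA : `|y| <= h + `|x0|.
  have : `|y| <= `|y - x0| + `|x0| by rewrite -{1}(subrK x0 y) ler_normD.
  by lra.
have := maxF (y, s); rewrite inE => /(_ (conj yA _)).
rewrite /= in_itv /= => /(_ hs); rewrite /F /= -/D => FF.
have uy0 : 0 <= u y s by rewrite u_ge0 // Ain.
have : u y s * (D / 2) ^+ n <= u x t * D ^+ n.
  apply: le_trans FF; rewrite ler_wpM2l //.
  by rewrite lerXn2r ?nnegrE ?divr_ge0 // ltW.
rewrite -ler_pdivlMr ?exprn_gt0 ?divr_gt0 // => uy; apply: (le_trans uy).
rewrite -rE !expr_div_n le_eqVlt; apply/orP; left; apply/eqP; field.
by rewrite !expf_neq0 // gt_eqF.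
Qed.

End doubling.

Lemma sqnorm_le_norm (R : realType) n (x : 'rV[R]_n) : sqnorm x <= n%:R * `|x| ^+ 2.
Proof.
rewrite /sqnorm (@le_trans _ _ (\sum_(i < n) `|x| ^+ 2)) //; last first.
  by rewrite sumr_const card_ord mulr_natl.
apply: ler_sum => i _; rewrite -[leLHS]real_normK ?num_real //.
by rewrite ler_sqr ?nnegrE // coord_norm_le.
Qed.

(** * The estimate at a concentration point *)

Section blowup.
Context {R : realType} {n : nat}.
Local Notation rv := (@lebesgue_rv R n).
Local Notation st := (@lebesgue_measure R \x rv)%E.
Hypothesis n_gt0 : (0 < n)%N.
Variable u : 'rV[R]_n -> R -> R.
Hypothesis Cu : C21 16 u.
Hypothesis u_ge0 : forall x t, 0 < t < 16 -> 0 <= u x t.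
Hypothesis f_ge0 : forall x t, sqnorm x < 16 -> 0 < t < 16 -> 0 <= heat_op u x t.
Variable M : R.
Hypothesis M_ge0 : 0 <= M.
Hypothesis hM : forall s, 0 < s <= 1 -> (\int[rv]_(y in ball3) (u y s)%:E <= M%:E)%E.

(** [local_mass] with initial time [s1/2]: the ratio of the squared radius [q] to [s1/2] is at most
    [(2/B)^2], so the old mass is weighted by [(2/B)^n <= 2/B]. *)
Lemma parabolic_mass (x : 'rV[R]_n) (q s1 B e : R) :
  sqnorm x <= 9 / 4 -> 0 < q -> q <= 1 / 2 -> 2 <= B -> 0 < s1 -> s1 <= 1 ->
  B ^+ 2 * q <= 2 * s1 ->
  (\int[st]_(p in tbox `[(s1 / 2)%R, s1] ball3) (heat_op u p.2 p.1)%:E <= e%:E)%E ->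
  (\int[rv]_(y in [set y : 'rV[R]_n | (sqnorm (y - x) < q)%R]) (u y s1)%:E <=
    (16 * (2 / B * M + (e + 36 * M * s1)))%:E)%E.
Proof.
move=> x94 q0 qh B2 s10 s1_1 s1q he; have B0 : 0 < B by lra.
have s11 : 0 < s1 / 2 by lra.
have s12 : s1 / 2 < s1 by lra.
have s1_16 : 0 < s1 < 16 by lra.
have lm := local_mass Cu u_ge0 f_ge0 hM x94 q0 qh s11 s12 s1_1 he.
apply: (@le_trans _ _ (\int[rv]_(y in
    [set y : 'rV[R]_n | (sqnorm (y - x) <= q)%R]) (u y s1)%:E)%E).
  apply: ge0_subset_integral => //.
  - exact: measurable_sqball.
  - exact: measurable_sqcball.
  - apply/measurable_EFinP; apply: measurable_funTS; apply: measurable_slice => y.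
    exact: (C21_jcont Cu).
  - by move=> y _; rewrite lee_fin u_ge0.
  - by move=> y /= /ltW.
apply: (le_trans lm); rewrite lee_fin.
rewrite [s1 - s1 / 2](_ : _ = s1 / 2); last by field.
rewrite (_ : 72 * M * (s1 / 2) = 36 * M * s1); last by field.
rewrite ler_wpM2l // lerD2r ler_wpM2r //.
have B20 : 0 <= 2 / B by rewrite divr_ge0 // ltW.
have B21 : 2 / B <= 1 by rewrite ler_pdivrMr // mul1r.
apply: (@le_trans _ _ (((2 / B) ^+ 2) `^ (n%:R / 2))).
  apply: ge0_ler_powR; rewrite ?nnegrE ?exprn_ge0 ?divr_ge0 ?(ltW q0) ?(ltW s10) ?(ltW B0) //.
  rewrite ler_pdivrMr // expr_div_n mulrAC ler_pdivlMr ?exprn_gt0 //.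
  by rewrite (_ : 2 ^+ 2 = 4); [lra|ring].
rewrite -powR_mulrn // -powRrM (_ : 2 * (n%:R / 2) = n%:R); last by field.
by rewrite powR_mulrn // -(prednK n_gt0) exprS ler_piMr // exprn_ile1.
Qed.

Variables K sigma : R.
Hypothesis K_ge0 : 0 <= K.
Hypothesis sigma_ge0 : 0 <= sigma.
Hypothesis sigma_le : n%:R * sigma <= n%:R + 2.
Hypothesis f_le : forall x t, sqnorm x <= 4 -> 0 < t <= 1 ->
  heat_op u x t <= K * u x t `^ sigma.

Lemma blowup_estimate (theta B e t0 : R) (x0 : 'rV[R]_n) :
  0 < theta -> theta <= 1 -> 2 <= B -> sqnorm x0 <= 1 ->
  0 < t0 -> t0 <= 1 -> n%:R * t0 <= 1 / 8 ->
  (forall s0 s1, 0 < s0 -> s0 < s1 -> s1 <= t0 ->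
    (\int[st]_(p in tbox `[s0, s1] ball3) (heat_op u p.2 p.1)%:E <= e%:E)%E) ->
  B ^+ n < u x0 t0 * Num.sqrt (t0 / 2) ^+ n ->
  @pole_const R n <= theta `^ (- (n%:R / 2)) * (16 * (2 / B * M + (e + 36 * M * t0)))
    + @rescaled_const R n K * theta.
Proof.
move=> th0 th1 B2 hx0 t00 t01 nt0 he big.
have n0 : 0 <= n%:R :> R by [].
have t16 : t0 < 16 by lra.
have [x [t [r [r0 ur [xx0 tt0] Brt ule]]]] :=
  doubling n_gt0 u_ge0 (fun x t ht => C21_jcont Cu ht) t00 t16 B2 big.
have {big} _ := big.
pose q := r ^+ 2; have q0 : 0 < q by rewrite exprn_gt0.
have B4 : 4 <= B ^+ 2.
  by rewrite (_ : 4 = 2 ^+ 2); [rewrite ler_sqr ?nnegrE //; lra|ring].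
have Bq : 4 * q <= B ^+ 2 * q by rewrite ler_wpM2r // ltW.
rewrite -/q in Brt ule.
have thq : theta * q <= q by rewrite ler_piMl // ltW.
pose s1 := t - theta * q.
have s1q : B ^+ 2 * q <= 2 * s1 by rewrite /s1; lra.
have s1t : s1 <= t0 by rewrite /s1; have := mulr_gt0 th0 q0; lra.
have s10 : 0 < s1 by lra.
have s11 : 0 < s1 / 2 by lra.
have s12 : s1 / 2 < s1 by lra.
have s1_1 : s1 <= 1 by lra.
have qh : q <= 1 / 8 by lra.
have qh2 : q <= 1 / 2 by lra.
have r2 : r <= 2.
  have : r ^+ 2 <= 2 ^+ 2 by rewrite -/q (_ : 2 ^+ 2 = 4); [lra|ring].
  by rewrite ler_sqr ?nnegrE // ltW.
have x94 : sqnorm x <= 9 / 4.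
  (* The maximum norm costs a factor [n], so the squared Euclidean displacement is at most
     [n t0 <= 1/8], and [2 * 1 + 2 / 8 = 9/4]. *)
  have : `|x - x0| ^+ 2 <= t0.
    by rewrite -[leRHS]sqr_sqrtr ?(ltW t00) // ler_sqr ?nnegrE ?sqrtr_ge0.
  move=> /(ler_wpM2l n0) h1.
  by have := sqnorm_near x0 x ltr01; have := sqnorm_le_norm (x - x0); rewrite invr1; lra.
have xB4 y : sqnorm (y - x) < q -> sqnorm y <= 4.
  move=> hy; have h12 : 0 < 1 / 2 :> R by [].
  by have := sqnorm_near x y h12; rewrite invf_div; lra.
have qy y : sqnorm (y - x) < q -> `|y - x| <= r.
  move=> hy; rewrite -ler_sqr ?nnegrE ?(ltW r0) //.
  by rewrite (le_trans (norm_sqr_le_sqnorm _)) // ltW.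
have t1 : t <= 1 by lra.
have ule' y s : sqnorm (y - x) < q -> s1 <= s <= t -> u y s <= (2 / r) ^+ n.
  move=> hy /andP[hs1 hs2]; apply: ule; first exact: qy.
  by rewrite hs2 andbT; move: hs1; rewrite /s1; lra.
have mle := parabolic_mass x94 q0 qh2 B2 s10 s1_1 s1q (he _ _ s11 s12 s1t).
apply: (le_trans (pole_rescaled Cu u_ge0 f_ge0 K_ge0 sigma_ge0 sigma_le f_le
  th0 r0 r2 s10 t1 xB4 ur ule' mle)).
rewrite lerD2r ler_wpM2l ?powR_ge0 // ler_wpM2l // lerD2l lerD2l ler_wpM2l //.
by rewrite mulr_ge0.
Qed.

End blowup.

(** * Choice of the constants and conclusion *)

Theorem theorem3p1 (R : realType) (n : nat) (alpha lambda sigma : R)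
  (u : 'rV[R]_n -> R -> R) :
  (1 <= n)%N ->
  0 < alpha < n%:R + 2 ->
  0 < lambda < (n%:R + 2 - alpha) / n%:R ->
  0 <= sigma <= (n%:R + 2) / n%:R ->
  (forall x t, 0 < t < 16 -> 0 <= u x t) ->
  C21 16 u ->
  (int_strip 16 (fun y s => (powR (u y s) lambda)%:E) < +oo)%E ->
  (forall x t, sqnorm x < 4 ^+ 2 -> 0 < t < 16 ->
     0 <= pdt u x t - laplacian u x t /\
     ((pdt u x t - laplacian u x t)%:E <=
       int_strip 16 (fun y s =>
         (powR (heat_kernel (x - y) (t - s)) (alpha / n%:R)
          * powR (u y s) lambda)%:E)
       * (powR (u x t) sigma)%:E)%E) ->
  exists C delta : R, 0 < delta /\
    forall t, 0 < t < delta ->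
      forall x, sqnorm x <= 1 -> u x t <= C * powR t (- (n%:R / 2)).
Proof.
move=> n_gt0 /andP[a0 _] /andP[l0 ln] /andP[s0 sn] u_ge0 Cu Lfin H.
have n0 : 0 < n%:R :> R by rewrite ltr0n.
have sub : alpha + n%:R * lambda < n%:R + 2.
  by move: ln; rewrite ltr_pdivlMr // => ln; lra.
have sg : n%:R * sigma <= n%:R + 2 by move: sn; rewrite ler_pdivlMr // mulrC.
have f_ge0 x t : sqnorm x < 16 -> 0 < t < 16 -> 0 <= heat_op u x t.
  by move=> hx ht; case: (H x t _ ht) => //; rewrite (_ : 4 ^+ 2 = 16) //; ring.
have [K K0 hK] := potential_bound n_gt0 a0 l0 sub Cu u_ge0 f_ge0 Lfin.
have f_le x t : sqnorm x <= 4 -> 0 < t <= 1 -> heat_op u x t <= K * u x t `^ sigma.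
  move=> hx ht; have ht16 : 0 < t < 16 by lra.
  have hx16 : sqnorm x < 4 ^+ 2 by rewrite (_ : 4 ^+ 2 = 16); [lra|ring].
  have [_ hf] := H x t hx16 ht16; rewrite -lee_fin EFinM; apply: (le_trans hf).
  by apply: lee_wpmul2r; [rewrite lee_fin powR_ge0|exact: hK].
have [M M0 hM] := mass_u_bound Cu u_ge0 f_ge0.
pose c := @pole_const R n; have c0 : 0 < c by exact: pole_const_gt0.
pose D := @rescaled_const R n K; have D0 : 0 <= D by exact: rescaled_const_ge0.
(* The source term becomes at most [c/4]; the summand 1 covers [D = 0]. *)
pose theta := Num.min 1 (c / (4 * (D + 1))).
have D1 : 0 < 4 * (D + 1) by lra.
have th0 : 0 < theta by rewrite lt_min ltr01 divr_gt0.
have th1 : theta <= 1 by rewrite ge_min lexx.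
have Dth : D * theta <= c / 4.
  have : theta <= c / (4 * (D + 1)) by rewrite ge_min lexx orbT.
  by rewrite ler_pdivlMr // => h; lra.
(* Level for which [theta^(-n/2) * 16 mu = c/4]. It is shared in thirds by the old mass, the mass of
   the source and the truncation error. *)
pose mu := theta `^ (n%:R / 2) * (c / 4) / 16.
have mu0 : 0 < mu by rewrite divr_gt0 // mulr_gt0 ?powR_gt0 ?divr_gt0.
pose B := Num.max 2 (6 * M / mu).
have B2 : 2 <= B by rewrite le_max lexx.
have B0 : 0 < B by lra.
have MB : 2 / B * M <= mu / 3.
  have : 6 * M / mu <= B by rewrite le_max lexx orbT.
  by rewrite ler_pdivrMr // mulrAC ler_pdivrMr // => h; lra.
have e0 : 0 < mu / 3 by rewrite divr_gt0.
have [d /andP[d0 d1] hd] := mass_f_small Cu u_ge0 f_ge0 e0.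
pose N := 36 * M; have N0 : 0 <= N by rewrite mulr_ge0.
have N1 : 0 < 3 * N + 1 by lra.
have n8 : 0 < 8 * n%:R :> R by rewrite mulr_gt0.
(* The three bounds make the source mass at most [mu/3], keep the selected point near [x0], and make
   [36 M t0] at most [mu/3]. *)
pose delta := Num.min d (Num.min (1 / (8 * n%:R)) (mu / (3 * N + 1))).
have del0 : 0 < delta by rewrite !lt_min d0 (divr_gt0 ltr01 n8) (divr_gt0 mu0 N1).
(* The power of 2 comes from [sqrt (t0 / 2)], the parabolic distance of [(x0, t0)] in the doubling
   argument. *)
exists (B ^+ n * 2 `^ (n%:R / 2)), delta; split => // t0 /andP[t00].
rewrite !lt_min => /and3P[t0d]; rewrite (ltr_pdivlMr _ _ n8) => t0n.
rewrite (ltr_pdivlMr _ _ N1) => t0M x0 hx0; rewrite leNgt; apply/negP => big.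
have {}big : B ^+ n < u x0 t0 * Num.sqrt (t0 / 2) ^+ n.
  have t20 : 0 < t0 / 2 by rewrite divr_gt0.
  rewrite -ltr_pdivrMr ?exprn_gt0 ?sqrtr_gt0 // -powR_sqr_half ?sqrtr_ge0 //.
  rewrite sqr_sqrtr ?(ltW t20) //.
  apply: le_lt_trans big; rewrite -mulrA ler_wpM2l ?exprn_ge0 ?(ltW B0) //.
  rewrite powRM ?invr_ge0 ?(ltW t00) // mulrC -[2^-1]powR_inv1 //.
  by rewrite -powRrM mulN1r opprK.
have t01 : t0 <= 1 by exact: ltW (lt_le_trans t0d d1).
have nt0 : n%:R * t0 <= 1 / 8 by lra.
have he s0' s1 : 0 < s0' -> s0' < s1 -> s1 <= t0 ->
    (\int[@lebesgue_measure R \x lebesgue_rv n]_(p in tbox `[s0', s1] ball3)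
      (heat_op u p.2 p.1)%:E <= (mu / 3)%:E)%E.
  by move=> h0 h1 h2; apply: hd => //; exact: le_trans h2 (ltW t0d).
have := blowup_estimate n_gt0 Cu u_ge0 f_ge0 M0 hM K0 s0 sg f_le
  th0 th1 B2 hx0 t00 t01 nt0 he big.
have small : 16 * (2 / B * M + (mu / 3 + 36 * M * t0)) <= theta `^ (n%:R / 2) * (c / 4).
  rewrite [leRHS](_ : _ = 16 * mu); last by rewrite /mu; field.
  by rewrite -/N; lra.
(* The blow-up estimate now reads [c <= c/4 + c/4], which contradicts [c > 0]. *)
move=> /le_trans /(_ (lerD (ler_wpM2l (powR_ge0 _ _) small) (lexx _))).
rewrite -/c -/D (mulrA (theta `^ (- (n%:R / 2)))) -powRD; last by rewrite (gt_eqF th0) implybT.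
by rewrite addNr powRr0 mul1r; lra.
Qed.
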